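(* Let $f\colon\mathbf{X}\to\mathbf{Y}$ be a 1-morphism of geometric stacks, $p\colon X\to\mathbf{X}$ and $q\colon Y\to\mathbf{Y}$ affine presentations, $f_0\colon X\to Y$ a morphism and $\gamma\colon fp\Rightarrow qf_0$ a 2-morphism. Let $B_\bullet$ and $A_\bullet$ be the Hopf algebroids associated to $p$ and $q$, and $\varphi\colon A_\bullet\to B_\bullet$ the homomorphism of Hopf algebroids associated to these data. There is a natural isomorphism of functors from $\mathsf{Qco}(\mathbf{Y})$ to $B_\bullet\text{-}\mathsf{coMod}$ $$\boldsymbol{\Gamma}^{\mathbf{X}}_p\,f^*\xrightarrow{\ \sim\ }B_0\otimes_{A_0}\boldsymbol{\Gamma}^{\mathbf{Y}}_q.$$
   Context: Stacks are stacks in groupoids for the étale topology on affine schemes over a fixed base scheme; algebraic stacks are in the sense of Laumon–Moret-Bailly. A geometric stack is an algebraic stack $\mathbf{X}$ whose diagonal is representable by affine schemes and which admits a smooth surjective morphism from an affine scheme. An (affine) presentation is a surjective flat finitely presented 1-morphism $p\colon X\to\mathbf{X}$ with $X$ an affine scheme (for instance a smooth surjective one). Site and quasi-coherent sheaves. $\mathsf{Aff}_{\mathsf{fppf}}/\mathbf{X}$: objects are pairs $(U,u)$ with $U$ an affine scheme and $u\colon U\to\mathbf{X}$ a flat finitely presented 1-morphism; a morphism $(l,\alpha)\colon(U,u)\to(U',u')$ is $l\colon U\to U'$ with a 2-morphism $\alpha\colon u\Rightarrow u'l$; composition is $(g,\beta)\circ(l,\alpha)=(gl,\beta l\circ\alpha)$;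 coverings are finite jointly surjective families of flat finitely presented maps. $\mathcal{O}_{\mathbf{X}}(U,u)=\Gamma(U,\mathcal{O}_U)$. $\mathsf{Qco}(\mathbf{X})$ is the category of sheaves of $\mathcal{O}_{\mathbf{X}}$-modules which on a covering of each object admit presentations $\mathcal{O}^{(I)}\to\mathcal{O}^{(J)}\to\mathcal{M}\to0$ on the slice sites; equivalently, presheaves of modules $\mathcal{M}$ with $\mathcal{O}(U)\otimes_{\mathcal{O}(V)}\mathcal{M}(V)\to\mathcal{M}(U)$ an isomorphism for every morphism $(U,u)\to(V,v)$. Inverse image. For $(U,u)\in\mathsf{Aff}_{\mathsf{fppf}}/\mathbf{X}$, $\mathbf{I}(u,f)$ is the category with objects $(V,v,h,\gamma)$, $(V,v)\in\mathsf{Aff}_{\mathsf{fppf}}/\mathbf{Y}$, $h\colon U\to V$, $\gamma\colon fu\Rightarrow vh$, and morphisms to $(V',v',h',\gamma')$ the $(j,\beta)\colon(V,v)\to(V',v')$ with $jh=h'$, $\gamma'=\beta h\circ\gamma$. $f^{-1}\mathcal{F}$ is the sheaf associated to $(U,u)\mapsto\varinjlim_{\mathbf{I}(u,f)}\mathcal{F}(V,v)$ (restriction along $(l,\alpha)\colon(U_1,u_1)\to(U_2,u_2)$ induced by $(V,v,h,\gamma)\mapsto(V,v,hl,\gamma l\circ f\alpha)$). It commutes with finite products, $f^{-1}\mathcal{O}_{\mathbf{Y}}$ is a sheaf of rings with a ring morphism to $\mathcal{O}_{\mathbf{X}}$ induced by the maps $\Gamma(V,\mathcal{O}_V)\to\Gamma(U,\mathcal{O}_U)$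 given by $h$, and $f^*\mathcal{F}=\mathcal{O}_{\mathbf{X}}\otimes_{f^{-1}\mathcal{O}_{\mathbf{Y}}}f^{-1}\mathcal{F}$. It sends $\mathsf{Qco}(\mathbf{Y})$ to $\mathsf{Qco}(\mathbf{X})$. Hopf algebroid of a presentation. For $p\colon X\to\mathbf{X}$, put $X=\operatorname{Spec}(B_0)$, $X_1=X\times_{\mathbf{X}}X=\operatorname{Spec}(B_1)$, with projections $p_1,p_2$ and canonical 2-morphism $\phi\colon pp_1\Rightarrow pp_2$; $\eta_L,\eta_R\colon B_0\to B_1$ correspond to $p_1,p_2$; the counit $\epsilon\colon B_1\to B_0$ to the diagonal $X\to X_1$; the conjugation $\kappa$ to interchanging factors; identifying $X\times_{\mathbf{X}}X\times_{\mathbf{X}}X$ with $\operatorname{Spec}(B_1\,{}_{\eta_R}\otimes_{\eta_L}B_1)$ so that $b\mapsto b\otimes1$, $b\mapsto1\otimes b$ correspond to the projections $p_{12},p_{23}$, the comultiplication $\nabla$ corresponds to $p_{13}$. Similarly $A_\bullet=(A_0,A_1)$ for $q\colon Y\to\mathbf{Y}$, with projections $q_1,q_2\colon Y_1=Y\times_{\mathbf{Y}}Y\to Y$ and 2-morphism $\phi'\colon qq_1\Rightarrow qq_2$. The homomorphism $\varphi=(\varphi_0,\varphi_1)$ has $\varphi_0\colon A_0\to B_0$ corresponding to $f_0$ and $\varphi_1\colon A_1\to B_1$ corresponding to the morphism $f_1\colon X_1\to Y_1$ with $q_if_1=f_0p_i$ and $\phi'f_1=\gamma p_2\circ f\phi\circ\gamma^{-1}p_1$.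 Comodules. A (left) $B_\bullet$-comodule is a $B_0$-module $N$ with a $B_0$-linear map $\psi\colon N\to B_1\,{}_{\eta_R}\otimes_{B_0}N$ (target a $B_0$-module via $\eta_L$) with $(\nabla\otimes\mathrm{id})\psi=(\mathrm{id}\otimes\psi)\psi$, $(\epsilon\otimes\mathrm{id})\psi=\mathrm{id}$; morphisms are linear maps commuting with $\psi$. The functor $\boldsymbol{\Gamma}^{\mathbf{X}}_p\colon\mathsf{Qco}(\mathbf{X})\to B_\bullet\text{-}\mathsf{coMod}$ (an equivalence) sends $\mathcal{F}$ to $M=\mathcal{F}(X,p)$ with structure map the composite $M\xrightarrow{\mathcal{F}(p_1,\phi^{-1})}\mathcal{F}(X_1,pp_2)\cong B_1\,{}_{\eta_R}\otimes_{B_0}M$, the last isomorphism being inverse to the one induced by $\mathcal{F}(p_2,\mathrm{id})$. Similarly for $\boldsymbol{\Gamma}^{\mathbf{Y}}_q$. The functor $B_0\otimes_{A_0}-\colon A_\bullet\text{-}\mathsf{coMod}\to B_\bullet\text{-}\mathsf{coMod}$ sends $(M,\psi)$ to $B_0\otimes_{A_0}M$ with structure map $$B_0\otimes_{A_0}M\xrightarrow{\mathrm{id}\otimes\psi}B_0\otimes_{\eta_L}A_1\,{}_{\eta_R}\otimes_{A_0}M\xrightarrow{\overline{\varphi}\otimes\mathrm{id}}B_1\,{}_{\eta_R}\otimes_{A_0}M\cong B_1\,{}_{\eta_R}\otimes_{B_0}(B_0\otimes_{A_0}M),$$ where $\overline{\varphi}(b_0\otimes a_1)=\eta_L(b_0)\varphi_1(a_1)$.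 *)

(* Defs.v *)
From HB Require Import structures.
From mathcomp Require Import all_boot all_algebra.
From mathcomp Require Import boolp.
Set Implicit Arguments. Unset Strict Implicit. Unset Printing Implicit Defensive.
Import GRing.Theory.
Local Open Scope ring_scope.
Local Open Scope quotient_scope.

(** Formal sums of [m_i (x) n_i], written as sequences of pairs, are identified
    when no balanced biadditive map separates them; the quotient is the tensor
    product, by [balanced_ptens], [balt_sum_tens], [balt_sumD], [balt_eq_ext]. *)
Section BalancedTensor.
Variables (R : Type) (M N : zmodType) (ra : R -> M -> M) (la : R -> N -> N).

Definition balanced (Z : zmodType) (b : M -> N -> Z) : Prop :=
  [/\ forall m m' n, b (m + m') n = b m n + b m' n,
      forall m n n', b m (n + n') = b m n + b m n'
    & forall r m n, b (ra r m) n = b m (la r n)].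

Definition fsum (Z : zmodType) (b : M -> N -> Z) (s : seq (M * N)) : Z :=
  \sum_(x <- s) b x.1 x.2.

Definition tens_equiv (s t : seq (M * N)) : Prop :=
  forall (Z : zmodType) (b : M -> N -> Z), balanced b -> fsum b s = fsum b t.

Definition tens_eq (s t : seq (M * N)) : bool := `[< tens_equiv s t >].

Lemma tens_eq_equiv : equiv_class_of tens_eq.
Proof.
split=> [s|s t|t s u].
- by apply/asboolP.
- by apply/asboolP/asboolP => h Z b hb; rewrite h.
- move=> /asboolP h /asboolP k; apply/asboolP => Z b hb.
  by rewrite h // k.
Qed.
Canonical tens_eq_rel := EquivRelPack tens_eq_equiv.

Definition balt := {eq_quot tens_eq_rel}.
HB.instance Definition _ := Choice.on balt.
HB.instance Definition _ := EqQuotient.on balt.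

Lemma balt_eqP (s t : seq (M * N)) :
  \pi_balt s = \pi_balt t <-> tens_equiv s t.
Proof.
split=> [/eqP|h]; first by rewrite eqmodE => /asboolP.
by apply/eqP; rewrite eqmodE; apply/asboolP.
Qed.

Lemma balt_repr (s : seq (M * N)) : tens_equiv (repr (\pi_balt s)) s.
Proof. by apply/balt_eqP; rewrite reprK. Qed.

Definition ptens (m : M) (n : N) : balt := \pi_balt [:: (m, n)].

Definition balt_sum (Z : zmodType) (b : M -> N -> Z) (t : balt) : Z :=
  fsum b (repr t).

Lemma balt_sum_pi (Z : zmodType) (b : M -> N -> Z) s :
  balanced b -> balt_sum b (\pi_balt s) = fsum b s.
Proof. by move=> hb; rewrite /balt_sum; apply: balt_repr. Qed.

Definition balt_add (s t : balt) : balt := \pi_balt (repr s ++ repr t).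
Definition balt_opp (s : balt) : balt :=
  \pi_balt [seq (- x.1, x.2) | x <- repr s].

Lemma balanced0 (Z : zmodType) (b : M -> N -> Z) n : balanced b -> b 0 n = 0.
Proof. by case=> h _ _; apply: (addrI (b 0 n)); rewrite -h !addr0. Qed.

Lemma balancedN (Z : zmodType) (b : M -> N -> Z) m n :
  balanced b -> b (- m) n = - b m n.
Proof.
move=> hb; apply: (addrI (b m n)); case: (hb) => h _ _.
by rewrite -h !subrr (balanced0 _ hb).
Qed.

Lemma fsum_cat (Z : zmodType) (b : M -> N -> Z) s t :
  fsum b (s ++ t) = fsum b s + fsum b t.
Proof. exact: big_cat. Qed.

Lemma fsum_opp (Z : zmodType) (b : M -> N -> Z) s :
  balanced b -> fsum b [seq (- x.1, x.2) | x <- s] = - fsum b s.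
Proof.
move=> hb; rewrite /fsum big_map -sumrN.
by apply: eq_bigr => x _; rewrite (balancedN _ _ hb).
Qed.

Lemma balt_sum_add (Z : zmodType) (b : M -> N -> Z) s t :
  balanced b -> balt_sum b (balt_add s t) = balt_sum b s + balt_sum b t.
Proof. by move=> hb; rewrite balt_sum_pi // fsum_cat. Qed.

Lemma balt_sum_opp (Z : zmodType) (b : M -> N -> Z) s :
  balanced b -> balt_sum b (balt_opp s) = - balt_sum b s.
Proof. by move=> hb; rewrite balt_sum_pi // fsum_opp. Qed.

Lemma balt_sumP (s t : balt) :
  (forall (Z : zmodType) (b : M -> N -> Z), balanced b ->
     balt_sum b s = balt_sum b t) -> s = t.
Proof. by move=> h; rewrite -[s]reprK -[t]reprK; apply/balt_eqP. Qed.

Lemma balt_addA : associative balt_add.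
Proof. by move=> s t u; apply: balt_sumP => Z b hb; rewrite !balt_sum_add ?addrA. Qed.
Lemma balt_addC : commutative balt_add.
Proof. by move=> s t; apply: balt_sumP => Z b hb; rewrite !balt_sum_add // addrC. Qed.
Lemma balt_add0 : left_id (\pi_balt [::]) balt_add.
Proof.
move=> s; apply: balt_sumP => Z b hb.
by rewrite balt_sum_add // balt_sum_pi // /fsum big_nil add0r.
Qed.
Lemma balt_addN : left_inverse (\pi_balt [::]) balt_opp balt_add.
Proof.
move=> s; apply: balt_sumP => Z b hb.
by rewrite balt_sum_add // balt_sum_opp // balt_sum_pi // /fsum big_nil addNr.
Qed.

HB.instance Definition _ :=
  GRing.isZmodule.Build balt balt_addA balt_addC balt_add0 balt_addN.

Lemma balt_sum_tens (Z : zmodType) (b : M -> N -> Z) m n :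
  balanced b -> balt_sum b (ptens m n) = b m n.
Proof. by move=> hb; rewrite balt_sum_pi // /fsum big_seq1. Qed.

Lemma balt_sumD (Z : zmodType) (b : M -> N -> Z) s t :
  balanced b -> balt_sum b (s + t) = balt_sum b s + balt_sum b t.
Proof. exact: balt_sum_add. Qed.

Lemma balanced_ptens : balanced ptens.
Proof.
by split=> *; apply: balt_sumP => Z b hb; rewrite ?balt_sumD ?balt_sum_tens //;
  case: hb.
Qed.

Lemma balt_reprE (t : balt) : t = \sum_(x <- repr t) ptens x.1 x.2.
Proof.
rewrite -{1}[t]reprK; elim: (repr t) => [|[m n] s IH]; first by rewrite big_nil.
rewrite big_cons -IH; apply: balt_sumP => Z b hb.
by rewrite balt_sumD // balt_sum_tens // !balt_sum_pi // /fsum big_cons.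
Qed.

Lemma balt_ind (P : balt -> Prop) :
  P 0 -> (forall m n t, P t -> P (ptens m n + t)) -> forall t, P t.
Proof.
move=> h0 hS t; rewrite [t]balt_reprE; elim: (repr t) => [|[m n] s IH].
  by rewrite big_nil.
by rewrite big_cons; apply: hS.
Qed.

Lemma balt_eq_ext (Z : zmodType) (f g : balt -> Z) :
  (forall s t, f (s + t) = f s + f t) -> (forall s t, g (s + t) = g s + g t) ->
  (forall m n, f (ptens m n) = g (ptens m n)) -> f =1 g.
Proof.
move=> hf hg h; apply: balt_ind => [|m n t IH]; last by rewrite hf hg h IH.
have e0 (k : balt -> Z) : (forall s t, k (s + t) = k s + k t) -> k 0 = 0.
  by move=> hk; apply: (addrI (k 0)); rewrite -hk !addr0.
by rewrite (e0 f) ?(e0 g).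
Qed.

End BalancedTensor.
Arguments ptens {R M N ra la} m n.
Arguments balt_sum {R M N ra la Z} b t.

Section BaseChange.
Variables (A B : comPzRingType) (eta : {rmorphism A -> B}) (N : lmodType A).

(** [bc eta N] is the [B]-module [B (x)_A N], where [B] is an [A]-module via
    [eta]. *)
Definition bc := balt (fun (a : A) (b : B) => b * eta a)
                      (fun (a : A) (n : N) => a *: n).
HB.instance Definition _ := GRing.Zmodule.on bc.

Definition bct (b : B) (n : N) : bc := ptens b n.

Lemma bctDl b b' n : bct (b + b') n = bct b n + bct b' n.
Proof. by case: (@balanced_ptens A B N (fun a b => b * eta a) (fun a n => a *: n)). Qed.
Lemma bctDr b n n' : bct b (n + n') = bct b n + bct b n'.
Proof. by case: (@balanced_ptens A B N (fun a b => b * eta a) (fun a n => a *: n)). Qed.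
Lemma bctA b a n : bct (b * eta a) n = bct b (a *: n).
Proof. by case: (@balanced_ptens A B N (fun a b => b * eta a) (fun a n => a *: n)). Qed.

(** For [rho : B -> C] and a [C]-module [P], [bc_ext rho f] is the map
    [b (x) n |-> rho b *: f n]; it is meant for [f] additive with
    [f (a *: n) = rho (eta a) *: f n]. *)
Definition bc_ext (C : comPzRingType) (P : lmodType C) (rho : B -> C)
  (f : N -> P) (t : bc) : P := balt_sum (fun b n => rho b *: f n) t.

Section Ext.
Variables (C : comPzRingType) (P : lmodType C).
Variables (rho : {rmorphism B -> C}) (f : N -> P).
Hypotheses (fD : {morph f : x y / x + y})
  (fZ : forall a n, f (a *: n) = rho (eta a) *: f n).

Lemma bc_ext_balanced :
  balanced (fun (a : A) (b : B) => b * eta a) (fun (a : A) (n : N) => a *: n)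
    (fun b n => rho b *: f n).
Proof.
split=> [b b' n|b n n'|a b n].
- by rewrite rmorphD scalerDl.
- by rewrite fD scalerDr.
- by rewrite rmorphM fZ scalerA.
Qed.

Lemma bc_ext_tens b n : bc_ext rho f (bct b n) = rho b *: f n.
Proof. exact/balt_sum_tens/bc_ext_balanced. Qed.

Lemma bc_extD : {morph bc_ext rho f : s t / s + t}.
Proof. by move=> s t; apply/balt_sumD/bc_ext_balanced. Qed.
End Ext.

Definition bc_scale (c : B) (t : bc) : bc :=
  balt_sum (fun b n => bct (c * b) n) t.

Lemma bc_scale_balanced c :
  balanced (fun (a : A) (b : B) => b * eta a) (fun (a : A) (n : N) => a *: n)
    (fun b n => bct (c * b) n).
Proof.
split=> [b b' n|b n n'|a b n].
- by rewrite mulrDr bctDl.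
- exact: bctDr.
- by rewrite mulrA bctA.
Qed.
Lemma bc_scale_tens c b n : bc_scale c (bct b n) = bct (c * b) n.
Proof. exact/balt_sum_tens/bc_scale_balanced. Qed.
Lemma bc_scaleD c s t : bc_scale c (s + t) = bc_scale c s + bc_scale c t.
Proof. exact/balt_sumD/bc_scale_balanced. Qed.

Lemma bc_eq_ext (Z : zmodType) (f g : bc -> Z) :
  {morph f : s t / s + t} -> {morph g : s t / s + t} ->
  (forall b n, f (bct b n) = g (bct b n)) -> f =1 g.
Proof. exact: balt_eq_ext. Qed.

Fact bc_scaleA c d t : bc_scale c (bc_scale d t) = bc_scale (c * d) t.
Proof.
move: t; apply: bc_eq_ext => [s t|s t|b n]; rewrite ?bc_scaleD //.
by rewrite !bc_scale_tens mulrA.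
Qed.
Fact bc_scale1 : left_id 1 bc_scale.
Proof.
by apply: bc_eq_ext => [s t|s t|b n] //; rewrite ?bc_scaleD ?bc_scale_tens ?mul1r.
Qed.
Fact bc_scaleDr : right_distributive bc_scale +%R.
Proof. exact: bc_scaleD. Qed.
Fact bc_scaleDl t : {morph bc_scale^~ t : c d / c + d}.
Proof.
move=> c d; move: t; apply: bc_eq_ext => [s t|s t|b n] /=.
- exact: bc_scaleD.
- by rewrite !bc_scaleD addrACA.
- by rewrite !bc_scale_tens mulrDl bctDl.
Qed.

HB.instance Definition _ :=
  GRing.Zmodule_isLmodule.Build B bc bc_scaleA bc_scale1 bc_scaleDr bc_scaleDl.

Lemma bcZ c b n : c *: bct b n = bct (c * b) n.
Proof. exact: bc_scale_tens. Qed.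

Lemma bc_extZ (C : comPzRingType) (P : lmodType C)
  (rho : {rmorphism B -> C}) (f : N -> P) :
  {morph f : x y / x + y} -> (forall a n, f (a *: n) = rho (eta a) *: f n) ->
  forall b t, bc_ext rho f (b *: t) = rho b *: bc_ext rho f t.
Proof.
move=> fD fZ b; apply: bc_eq_ext => [s t|s t|b' n].
- by rewrite scalerDr bc_extD.
- by rewrite bc_extD // scalerDr.
- by rewrite bcZ !bc_ext_tens // rmorphM scalerA.
Qed.

End BaseChange.
Arguments bct {A B eta N} b n.

Section RingTensor.
Variables (R A B : comPzRingType).
Variables (f : {rmorphism R -> A}) (g : {rmorphism R -> B}).

(** [rtens f g] is the ring [A (x)_R B]. *)
Definition rtens := balt (fun (r : R) (a : A) => a * f r)
                         (fun (r : R) (b : B) => g r * b).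
HB.instance Definition _ := GRing.Zmodule.on rtens.

Definition rt (a : A) (b : B) : rtens := ptens a b.
Definition rt_inl (a : A) : rtens := rt a 1.
Definition rt_inr (b : B) : rtens := rt 1 b.

Lemma rt_balanced : balanced (fun (r : R) (a : A) => a * f r)
  (fun (r : R) (b : B) => g r * b) rt.
Proof. exact: balanced_ptens. Qed.
Lemma rtDl a a' b : rt (a + a') b = rt a b + rt a' b.
Proof. by case: rt_balanced. Qed.
Lemma rtDr a b b' : rt a (b + b') = rt a b + rt a b'.
Proof. by case: rt_balanced. Qed.
Lemma rtA a r b : rt (a * f r) b = rt a (g r * b).
Proof. by case: rt_balanced. Qed.

Lemma rt_eq_ext (Z : zmodType) (h k : rtens -> Z) :
  {morph h : s t / s + t} -> {morph k : s t / s + t} ->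
  (forall a b, h (rt a b) = k (rt a b)) -> h =1 k.
Proof. exact: balt_eq_ext. Qed.

Definition rt_mulp (a : A) (b : B) (t : rtens) : rtens :=
  balt_sum (fun a' b' => rt (a * a') (b * b')) t.

Lemma rt_mulp_balanced a b : balanced (fun (r : R) (a : A) => a * f r)
  (fun (r : R) (b : B) => g r * b) (fun a' b' => rt (a * a') (b * b')).
Proof.
split=> *; rewrite ?mulrDr ?rtDl ?rtDr //.
by rewrite mulrA rtA; congr (rt _ _); rewrite mulrCA.
Qed.
Lemma rt_mulp_tens a b a' b' : rt_mulp a b (rt a' b') = rt (a * a') (b * b').
Proof. exact/balt_sum_tens/rt_mulp_balanced. Qed.
Lemma rt_mulpD a b : {morph rt_mulp a b : s t / s + t}.
Proof. by move=> s t; apply/balt_sumD/rt_mulp_balanced. Qed.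

Definition rt_mul (s t : rtens) : rtens := balt_sum (fun a b => rt_mulp a b t) s.

Lemma rt_mul_balanced t : balanced (fun (r : R) (a : A) => a * f r)
  (fun (r : R) (b : B) => g r * b) (fun a b => rt_mulp a b t).
Proof.
split=> [a a' b|a b b'|r a b]; move: t;
  apply: rt_eq_ext => [s t|s t|x y] /=; rewrite ?rt_mulpD ?rt_mulp_tens //.
- by rewrite addrACA.
- by rewrite mulrDl rtDl.
- by rewrite addrACA.
- by rewrite mulrDl rtDr.
- by rewrite -mulrA [f r * _]mulrC mulrA rtA mulrA.
Qed.
Lemma rt_mul_tensl a b t : rt_mul (rt a b) t = rt_mulp a b t.
Proof. exact/balt_sum_tens/rt_mul_balanced. Qed.
Lemma rt_mul_tens a b a' b' : rt_mul (rt a b) (rt a' b') = rt (a * a') (b * b').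
Proof. by rewrite rt_mul_tensl rt_mulp_tens. Qed.
Lemma rt_mulDl : left_distributive rt_mul +%R.
Proof. by move=> s t u; apply/balt_sumD/rt_mul_balanced. Qed.
Lemma rt_mulDr : right_distributive rt_mul +%R.
Proof.
move=> s t u; move: s; apply: rt_eq_ext => [s s'|s s'|a b].
- exact: rt_mulDl.
- by rewrite !rt_mulDl addrACA.
- by rewrite !rt_mul_tensl rt_mulpD.
Qed.

Fact rt_mulC : commutative rt_mul.
Proof.
move=> s t; move: s; apply: rt_eq_ext => [s s'|s s'|a b].
- exact: rt_mulDl.
- exact: rt_mulDr.
- move: t; apply: rt_eq_ext => [s s'|s s'|a' b'].
  + exact: rt_mulDr.
  + exact: rt_mulDl.
  + by rewrite !rt_mul_tens [a * _]mulrC [b * _]mulrC.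
Qed.
Fact rt_mulA : associative rt_mul.
Proof.
move=> s t u; move: s; apply: rt_eq_ext => [s s'|s s'|a b]; rewrite ?rt_mulDl //.
move: t; apply: rt_eq_ext => [s s'|s s'|a' b'];
  rewrite ?(rt_mulDl, rt_mulDr) //.
move: u; apply: rt_eq_ext => [s s'|s s'|a'' b''];
  rewrite ?(rt_mulDl, rt_mulDr) //.
by rewrite !rt_mul_tens !mulrA.
Qed.
Fact rt_mul1 : left_id (rt 1 1) rt_mul.
Proof.
apply: rt_eq_ext => [s t|s t|a b] //; first by rewrite rt_mulDr.
by rewrite rt_mul_tens !mul1r.
Qed.

HB.instance Definition _ :=
  GRing.Zmodule_isComPzRing.Build rtens rt_mulA rt_mulC rt_mul1 rt_mulDl.

Lemma rtM a b a' b' : rt a b * rt a' b' = rt (a * a') (b * b').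
Proof. exact: rt_mul_tens. Qed.

Fact rt_inl_zmod : zmod_morphism rt_inl.
Proof.
move=> a a'; apply: (addIr (rt_inl a')).
by rewrite /rt_inl -rtDl !subrK.
Qed.
Fact rt_inl_monoid : monoid_morphism rt_inl.
Proof. by split=> [//|a a']; rewrite /rt_inl rtM mulr1. Qed.
HB.instance Definition _ := GRing.isZmodMorphism.Build A rtens rt_inl rt_inl_zmod.
HB.instance Definition _ := GRing.isMonoidMorphism.Build A rtens rt_inl rt_inl_monoid.

Fact rt_inr_zmod : zmod_morphism rt_inr.
Proof.
move=> a a'; apply: (addIr (rt_inr a')).
by rewrite /rt_inr -rtDr !subrK.
Qed.
Fact rt_inr_monoid : monoid_morphism rt_inr.
Proof. by split=> [//|a a']; rewrite /rt_inr rtM mulr1. Qed.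
HB.instance Definition _ := GRing.isZmodMorphism.Build B rtens rt_inr rt_inr_zmod.
HB.instance Definition _ := GRing.isMonoidMorphism.Build B rtens rt_inr rt_inr_monoid.

Lemma rtE a b : rt a b = rt_inl a * rt_inr b.
Proof. by rewrite /rt_inl /rt_inr rtM mulr1 mul1r. Qed.

Lemma rt_glue r : rt_inl (f r) = rt_inr (g r).
Proof. by rewrite /rt_inl -[f r]mul1r rtA mulr1. Qed.

(** [rt_ext h k] is [a (x) b |-> h a * k b], meant for ring morphisms [h], [k]
    agreeing on [R]. *)
Definition rt_ext (C : comPzRingType) (h : A -> C) (k : B -> C) (t : rtens) : C :=
  balt_sum (fun a b => h a * k b) t.

Section Ext.
Variables (C : comPzRingType) (h : {rmorphism A -> C}) (k : {rmorphism B -> C}).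
Hypothesis hk : forall r, h (f r) = k (g r).

Lemma rt_ext_balanced : balanced (fun (r : R) (a : A) => a * f r)
  (fun (r : R) (b : B) => g r * b) (fun a b => h a * k b).
Proof.
split=> *; rewrite ?rmorphD ?mulrDl ?mulrDr //.
by rewrite !rmorphM hk mulrA.
Qed.
Lemma rt_ext_tens a b : rt_ext h k (rt a b) = h a * k b.
Proof. exact/balt_sum_tens/rt_ext_balanced. Qed.
Lemma rt_extD : {morph rt_ext h k : s t / s + t}.
Proof. by move=> s t; apply/balt_sumD/rt_ext_balanced. Qed.
Lemma rt_extM : {morph rt_ext h k : s t / s * t}.
Proof.
move=> s t; move: s; apply: rt_eq_ext => [s s'|s s'|a b].
- by rewrite mulrDl rt_extD.
- by rewrite rt_extD mulrDl.
- move: t; apply: rt_eq_ext => [s s'|s s'|a' b'].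
  + by rewrite mulrDr rt_extD.
  + by rewrite rt_extD mulrDr.
  + by rewrite rtM !rt_ext_tens !rmorphM mulrACA.
Qed.
End Ext.

End RingTensor.
Arguments rt {R A B f g} a b.
Arguments rt_inl {R A B f g} a.
Arguments rt_inr {R A B f g} b.
Arguments rt_ext {R A B f g C} h k t.

Lemma rmorph_ext (A B : comPzRingType) (f g : {rmorphism A -> B}) :
  f =1 g -> f = g.
Proof.
case: f g => [f [[f1] [f2]]] [g [[g1] [g2]]] /= h.
have e : f = g by apply: funext.
by subst g; rewrite (Prop_irrelevance f1 g1) (Prop_irrelevance f2 g2).
Qed.

Definition bc_map (A B : comPzRingType) (eta : {rmorphism A -> B})
  (N N' : lmodType A) (h : N -> N') : bc eta N -> bc eta N' :=
  bc_ext (P := bc eta N') (@idfun B) (fun n => bct 1 (h n)).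
Arguments bc_map {A B} eta {N N'} h.

Section RingMaps.
Variables (A B : comPzRingType) (phi : {rmorphism A -> B}).

Definition flat : Prop :=
  forall (N N' : lmodType A) (h : {linear N -> N'}),
    injective h -> injective (bc_map phi h).

(** Polynomial expressions over [A] in [n] variables; the polynomial rings of
    the library exclude the zero ring as a ring of coefficients. *)
Inductive pexp (n : nat) :=
| PVar of 'I_n | PConst of A | PAdd of pexp n & pexp n | PMul of pexp n & pexp n.

Fixpoint peval (C : comPzRingType) (psi : A -> C) n (c : 'I_n -> C) (e : pexp n) :=
  match e with
  | PVar i => c i
  | PConst a => psi a
  | PAdd e1 e2 => peval psi c e1 + peval psi c e2
  | PMul e1 e2 => peval psi c e1 * peval psi c e2
  end.

(** [B] is isomorphic to [A[x_1, ..., x_n] / (e_1, ..., e_m)], with [b i] the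
    class of [x_i]. *)
Definition finitely_presented : Prop :=
  exists (n m : nat) (e : 'I_m -> pexp n) (b : 'I_n -> B),
    (forall k, peval phi b (e k) = 0) /\
    forall (C : comPzRingType) (psi : {rmorphism A -> C}) (c : 'I_n -> C),
      (forall k, peval psi c (e k) = 0) ->
      exists! theta : {rmorphism B -> C},
        (forall a, theta (phi a) = psi a) /\ (forall i, theta (b i) = c i).

Definition lifting (C C' : comPzRingType) (pi : {rmorphism C -> C'})
    (psi : {rmorphism A -> C}) (theta : {rmorphism B -> C'})
    (lft : {rmorphism B -> C}) : Prop :=
  (forall a, lft (phi a) = psi a) /\ (forall b, pi (lft b) = theta b).

Definition square_zero_extension (C C' : comPzRingType)
    (pi : {rmorphism C -> C'}) : Prop :=
  (forall c', exists c, pi c = c') /\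
  (forall c d, pi c = 0 -> pi d = 0 -> c * d = 0).

Definition formally_smooth : Prop :=
  forall (C C' : comPzRingType) (pi : {rmorphism C -> C'})
    (psi : {rmorphism A -> C}) (theta : {rmorphism B -> C'}),
    square_zero_extension pi -> (forall a, theta (phi a) = pi (psi a)) ->
    exists lft, lifting pi psi theta lft.

Definition formally_etale : Prop :=
  forall (C C' : comPzRingType) (pi : {rmorphism C -> C'})
    (psi : {rmorphism A -> C}) (theta : {rmorphism B -> C'}),
    square_zero_extension pi -> (forall a, theta (phi a) = pi (psi a)) ->
    exists! lft, lifting pi psi theta lft.

Definition smooth : Prop := finitely_presented /\ formally_smooth.
Definition etale : Prop := finitely_presented /\ formally_etale.
Definition flat_fp : Prop := flat /\ finitely_presented.

End RingMaps.

Record prime_ideal (A : comPzRingType) := PrimeIdeal {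
  pideal :> A -> Prop;
  pideal0 : pideal 0;
  pidealD : forall a b, pideal a -> pideal b -> pideal (a + b);
  pidealM : forall a b, pideal b -> pideal (a * b);
  pideal1 : ~ pideal 1;
  pideal_prime : forall a b, pideal (a * b) -> pideal a \/ pideal b }.

Definition jointly_surjective (A : comPzRingType) (n : nat)
    (B : 'I_n -> comPzRingType) (phi : forall i, {rmorphism A -> B i}) : Prop :=
  forall P : prime_ideal A, exists (i : 'I_n) (Q : prime_ideal (B i)),
    forall a, P a <-> Q (phi i a).

Definition spec_surjective (A B : comPzRingType) (phi : {rmorphism A -> B}) :=
  forall P : prime_ideal A, exists Q : prime_ideal B, forall a, P a <-> Q (phi a).

(** Schemes are given by their functors of points (Demazure-Gabriel): Zariski
    sheaves covered by open affine subfunctors. *)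
Record ring_functor := RingFunctor {
  pts :> comPzRingType -> Type;
  pts_map : forall A B : comPzRingType, {rmorphism A -> B} -> pts A -> pts B;
  pts_id : forall (A : comPzRingType) (s : pts A),
    pts_map (@idfun A : {rmorphism A -> A}) s = s;
  pts_comp : forall (A B C : comPzRingType) (g : {rmorphism B -> C})
    (f : {rmorphism A -> B}) s,
    pts_map (g \o f : {rmorphism A -> C}) s = pts_map g (pts_map f s) }.

Definition unit_ideal (A : comPzRingType) (I : A -> Prop) : Prop :=
  exists (n : nat) (r a : 'I_n -> A), (forall i, I (a i)) /\ \sum_i r i * a i = 1.

Definition is_localization (A B : comPzRingType) (a : A)
    (l : {rmorphism A -> B}) : Prop :=
  (exists b, l a * b = 1) /\
  forall (C : comPzRingType) (g : {rmorphism A -> C}),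
    (exists c, g a * c = 1) ->
    exists! h : {rmorphism B -> C}, forall x, h (l x) = g x.

Definition zariski_sheaf (S : ring_functor) : Prop :=
  forall (A : comPzRingType) (n : nat) (a : 'I_n -> A) (B : 'I_n -> comPzRingType)
    (l : forall i, {rmorphism A -> B i}),
    unit_ideal (fun x => exists i, x = a i) ->
    (forall i, is_localization (a i) (l i)) ->
  forall s : forall i, S (B i),
    (forall i j (C : comPzRingType) (g : {rmorphism B i -> C})
       (h : {rmorphism B j -> C}), (forall x, g (l i x) = h (l j x)) ->
       pts_map g (s i) = pts_map h (s j)) ->
  exists! t : S A, forall i, pts_map (l i) t = s i.

(** The morphism [Spec A -> S] given by [a] is an open immersion. *)
Definition affine_open (S : ring_functor) (A : comPzRingType) (a : S A) : Prop :=
  (forall (R : comPzRingType) (g h : {rmorphism A -> R}),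
     pts_map g a = pts_map h a -> g =1 h) /\
  (forall (R : comPzRingType) (s : S R), exists I : R -> Prop,
     forall (R' : comPzRingType) (g : {rmorphism R -> R'}),
       (exists h : {rmorphism A -> R'}, pts_map h a = pts_map g s) <->
       unit_ideal (fun x => exists2 i, I i & x = g i)).

Definition is_scheme (S : ring_functor) : Prop :=
  zariski_sheaf S /\
  exists (J : Type) (A : J -> comPzRingType) (a : forall j, S (A j)),
    (forall j, affine_open (a j)) /\
    (forall (K : fieldType) (s : S K), exists (j : J) (h : {rmorphism A j -> K}),
       pts_map h (a j) = s).

(** [U : aff S] stands for [Spec (ring U)] over [S]; a morphism [U -> V] is a
    homomorphism [ring V -> ring U]. *)
Record aff (S : ring_functor) := Aff { ring :> comPzRingType; struct : S ring }.

Record amor (S : ring_functor) (U V : aff S) := AMor {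
  comor :> {rmorphism V -> U};
  comor_struct : pts_map comor (struct V) = struct U }.

(** Categories fibred in groupoids over the affine [S]-schemes. [ob X U] is the
    class of objects over [U]; by the 2-Yoneda lemma, these are the 1-morphisms
    [U -> X]. A morphism [arrow x y] lying over [l : U -> V] is the same thing as
    [l] together with a 2-morphism [x => y l], and [comp (g, beta) (l, alpha)] is
    [(g l, beta l o alpha)]. *)
Record cfg (S : ring_functor) := CFG {
  ob : aff S -> Type;
  arrow : forall U V : aff S, ob U -> ob V -> Type;
  base : forall (U V : aff S) (x : ob U) (y : ob V), arrow x y -> amor U V;
  id_arrow : forall (U : aff S) (x : ob U), arrow x x;
  comp : forall (U V W : aff S) (x : ob U) (y : ob V) (z : ob W),
    arrow y z -> arrow x y -> arrow x z;
  base_id : forall (U : aff S) (x : ob U) r, base (id_arrow x) r = r;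
  base_comp : forall (U V W : aff S) (x : ob U) (y : ob V) (z : ob W)
    (b : arrow y z) (a : arrow x y) r, base (comp b a) r = base a (base b r);
  comp_idl : forall (U V : aff S) (x : ob U) (y : ob V) (a : arrow x y),
    comp (id_arrow y) a = a;
  comp_idr : forall (U V : aff S) (x : ob U) (y : ob V) (a : arrow x y),
    comp a (id_arrow x) = a;
  comp_assoc : forall (T U V W : aff S) (t : ob T) (x : ob U) (y : ob V) (z : ob W)
    (c : arrow y z) (b : arrow x y) (a : arrow t x),
    comp c (comp b a) = comp (comp c b) a;
  pullback : forall (U V : aff S) (l : amor U V) (y : ob V),
    exists (x : ob U) (a : arrow x y), base a =1 l;
  cartesian : forall (T U V : aff S) (t : ob T) (x : ob U) (y : ob V)
    (a : arrow x y) (b : arrow t y) (l : amor T U),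
    (forall r, base b r = l (base a r)) ->
    exists! c : arrow t x, comp a c = b /\ base c =1 l }.

Arguments ob {S} X U : rename.
Arguments arrow {S X U V} x y : rename.
Arguments base {S X U V x y} a : rename.
Arguments id_arrow {S X U} x : rename.
Arguments comp {S X U V W x y z} b a : rename.

Record fmor (S : ring_functor) (X Y : cfg S) := FMor {
  fob :> forall U : aff S, ob X U -> ob Y U;
  fhom : forall (U V : aff S) (x : ob X U) (y : ob X V),
    arrow x y -> arrow (fob x) (fob y);
  fhom_base : forall (U V : aff S) (x : ob X U) (y : ob X V) (a : arrow x y),
    base (fhom a) =1 base a;
  fhom_id : forall (U : aff S) (x : ob X U), fhom (id_arrow x) = id_arrow (fob x);
  fhom_comp : forall (U V W : aff S) (x : ob X U) (y : ob X V) (z : ob X W)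
    (b : arrow y z) (a : arrow x y), fhom (comp b a) = comp (fhom b) (fhom a) }.

Section Stack.
Variables (S : ring_functor) (X : cfg S).

Definition etale_cover (U : aff S) (n : nat) (V : 'I_n -> aff S)
    (l : forall i, amor (V i) U) : Prop :=
  (forall i, etale (l i)) /\ jointly_surjective (fun i => comor (l i)).

Definition morphisms_glue : Prop :=
  forall (U : aff S) (n : nat) (V : 'I_n -> aff S) (l : forall i, amor (V i) U),
    etale_cover l ->
  forall (x y : ob X U) (xi : forall i, ob X (V i))
    (chi : forall i, arrow (xi i) x) (m : forall i, arrow (xi i) y),
    (forall i, base (chi i) =1 l i) -> (forall i, base (m i) =1 l i) ->
    (forall i j (T : aff S) (t : ob X T) (a : arrow t (xi i)) (b : arrow t (xi j)),
       comp (chi i) a = comp (chi j) b -> comp (m i) a = comp (m j) b) ->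
  exists! h : arrow x y, base h =1 idfun /\ forall i, comp h (chi i) = m i.

(** A descent datum on the objects [xi i] over [V i]. Pulling back along
    [a : arrow t (xi i)] identifies [t] with the restriction of [xi i], and
    [glue a b] says that the transition isomorphism, from the restriction of
    [xi i] to that of [xi j], is the one determined by [a] and [b]. *)
Record descent_datum (U : aff S) (n : nat) (V : 'I_n -> aff S)
    (l : forall i, amor (V i) U) (xi : forall i, ob X (V i))
    (glue : forall (i j : 'I_n) (T : aff S) (t : ob X T),
      arrow t (xi i) -> arrow t (xi j) -> Prop) : Prop := DescentDatum {
  glue_base : forall i j T (t : ob X T) (a : arrow t (xi i)) (b : arrow t (xi j)),
    glue i j T t a b -> forall r, base a (l i r) = base b (l j r);
  glue_iso : forall i j T (t : ob X T) (a : arrow t (xi i)) (k : amor T (V j)),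
    (forall r, base a (l i r) = k (l j r)) ->
    exists! b : arrow t (xi j), base b =1 k /\ glue i j T t a b;
  glue_restrict : forall i j T T' (t : ob X T) (t' : ob X T')
    (a : arrow t (xi i)) (b : arrow t (xi j)) (c : arrow t' t),
    glue i j T t a b -> glue i j T' t' (comp a c) (comp b c);
  glue_refl : forall i T (t : ob X T) (a : arrow t (xi i)), glue i i T t a a;
  glue_cocycle : forall i j k T (t : ob X T) (a : arrow t (xi i))
    (b : arrow t (xi j)) (c : arrow t (xi k)),
    glue i j T t a b -> glue j k T t b c -> glue i k T t a c }.

Definition objects_glue : Prop :=
  forall (U : aff S) (n : nat) (V : 'I_n -> aff S) (l : forall i, amor (V i) U),
    etale_cover l ->
  forall (xi : forall i, ob X (V i)) glue, descent_datum l (xi := xi) glue ->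
  exists (x : ob X U) (chi : forall i, arrow (xi i) x),
    (forall i, base (chi i) =1 l i) /\
    forall i j T (t : ob X T) (a : arrow t (xi i)) (b : arrow t (xi j)),
      glue i j T t a b -> comp (chi i) a = comp (chi j) b.

Definition is_stack : Prop := morphisms_glue /\ objects_glue.

(** [w], with [a] and [b], is the 2-fibre product of [x : U -> X] and
    [y : V -> X]: morphisms [T -> U], [T -> V] with a 2-isomorphism between the
    composites to [X] are the same thing as an object [t] over [T], determined
    up to unique isomorphism, with morphisms to [x] and [y]. *)
Definition is_fibre_product (U V W : aff S) (x : ob X U) (y : ob X V) (w : ob X W)
    (a : arrow w x) (b : arrow w y) : Prop :=
  forall (T : aff S) (t : ob X T) (a' : arrow t x) (b' : arrow t y),
    exists! c : arrow t w, comp a c = a' /\ comp b c = b'.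

(** The diagonal is representable by affine schemes: the functor of isomorphisms
    between two objects over [U] is an affine [U]-scheme. *)
Definition affine_diagonal : Prop :=
  forall (U : aff S) (x y : ob X U),
  exists (V : aff S) (z : ob X V) (a : arrow z x) (b : arrow z y),
    base a =1 base b /\
    forall (T : aff S) (t : ob X T) (a' : arrow t x) (b' : arrow t y),
      base a' =1 base b' -> exists! c : arrow t z, comp a c = a' /\ comp b c = b'.

(** [u : U -> X] is representable by affine schemes and has the property [P]:
    every base change [U x_X T -> T] to an affine [T] is affine and has [P]. *)
Definition has_property (P : forall A B : comPzRingType, {rmorphism A -> B} -> Prop)
    (U : aff S) (u : ob X U) : Prop :=
  forall (T : aff S) (t : ob X T),
  exists (W : aff S) (w : ob X W) (a : arrow w u) (b : arrow w t),
    is_fibre_product a b /\ P T W (base b).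

Definition is_geometric : Prop :=
  [/\ is_stack, affine_diagonal &
    exists (U : aff S) (p : ob X U),
      has_property (fun A B phi => smooth phi /\ spec_surjective phi) p].

Definition flat_fp_mor (U : aff S) (u : ob X U) : Prop :=
  has_property flat_fp u.

Definition presentation (U : aff S) (p : ob X U) : Prop :=
  has_property (fun A B phi => flat_fp phi /\ spec_surjective phi) p.

Lemma presentation_flat (U : aff S) (p : ob X U) : presentation p -> flat_fp_mor p.
Proof.
move=> h T t; have [W [w [a [b [hw [hb _]]]]]] := h T t.
by exists W, w, a, b.
Qed.

End Stack.

(** Objects of [Aff_fppf / X]; morphisms are those of [X]. *)
Record site (S : ring_functor) (X : cfg S) := Site {
  saff : aff S;
  sob :> ob X saff;
  sflat : flat_fp_mor sob }.
Notation shom u v := (arrow (sob u) (sob v)).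

Section Sheaves.
Variables (S : ring_functor) (X : cfg S).

Definition fppf_cover (u : site X) (n : nat) (v : 'I_n -> site X)
    (g : forall i, shom (v i) u) : Prop :=
  (forall i, flat_fp (base (g i))) /\
  jointly_surjective (fun i => comor (base (g i))).

Record psh := Psh {
  sec :> site X -> Type;
  res : forall u v : site X, shom u v -> sec v -> sec u;
  res_id : forall u s, res (id_arrow (sob u)) s = s;
  res_comp : forall (u v w : site X) (b : shom v w) (a : shom u v) s,
    res (comp b a) s = res a (res b s) }.

Record pmap (P Q : psh) := PMap {
  pmap_fun :> forall u, P u -> Q u;
  pmap_nat : forall u v (a : shom u v) s,
    pmap_fun (res a s) = res a (pmap_fun s) }.

Definition is_sheaf (P : psh) : Prop :=
  forall (u : site X) (n : nat) (v : 'I_n -> site X) (g : forall i, shom (v i) u),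
    fppf_cover g ->
  forall s : forall i, P (v i),
    (forall i j (w : site X) (a : shom w (v i)) (b : shom w (v j)),
       comp (g i) a = comp (g j) b -> res a (s i) = res b (s j)) ->
  exists! t : P u, forall i, res (g i) t = s i.

Record assoc_sheaf (P : psh) := AssocSheaf {
  ash :> psh;
  ash_unit : pmap P ash;
  ash_sheaf : is_sheaf ash;
  ash_univ : forall H : psh, is_sheaf H -> forall m : pmap P H,
    exists n : pmap ash H,
      (forall u s, n u (ash_unit u s) = m u s) /\
      forall n' : pmap ash H, (forall u s, n' u (ash_unit u s) = m u s) ->
        forall u s, n' u s = n u s }.

Definition sheafification := forall P : psh, assoc_sheaf P.

Definition pmap_comp (P Q R : psh) (n : pmap Q R) (m : pmap P Q) : pmap P R.
Proof. by exists (fun u s => n u (m u s)) => u v a s; rewrite !pmap_nat. Defined.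

Definition ash_map (a : sheafification) (P Q : psh) (m : pmap P Q) :
    pmap (a P) (a Q) :=
  projT1 (cid (ash_univ (a P) (@ash_sheaf _ (a Q)) (pmap_comp (ash_unit (a Q)) m))).

Definition prod_psh (P Q : psh) : psh.
Proof.
exists (fun u => (P u * Q u)%type) (fun u v a s => (res a s.1, res a s.2)).
- by move=> u [s t]; rewrite !res_id.
- by move=> u v w b a [s t]; rewrite !res_comp.
Defined.

Definition fst_psh (P Q : psh) : pmap (prod_psh P Q) P.
Proof. by exists (fun u s => s.1). Defined.
Definition snd_psh (P Q : psh) : pmap (prod_psh P Q) Q.
Proof. by exists (fun u s => s.2). Defined.

Definition structure_psh : psh.
Proof.
exists (fun u => saff u : Type) (fun u v a s => base a s).
- by move=> u s; rewrite base_id.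
- by move=> u v w b a s; rewrite base_comp.
Defined.

Record pmod := PMod {
  msec :> forall u : site X, lmodType (saff u);
  mres : forall u v : site X, shom u v -> msec v -> msec u;
  mresD : forall u v (a : shom u v), {morph mres a : s t / s + t};
  mresZ : forall u v (a : shom u v) r s, mres a (r *: s) = base a r *: mres a s;
  mres_id : forall u s, mres (id_arrow (sob u)) s = s;
  mres_comp : forall (u v w : site X) (b : shom v w) (a : shom u v) s,
    mres (comp b a) s = mres a (mres b s) }.

Definition psh_of (M : pmod) : psh := Psh (@mres_id M) (@mres_comp M).

Record pmod_hom (M N : pmod) := PModHom {
  mhom :> forall u, M u -> N u;
  mhomD : forall u, {morph @mhom u : s t / s + t};
  mhomZ : forall u r (s : M u), mhom (r *: s) = r *: mhom s;
  mhom_nat : forall u v (a : shom u v) s, mhom (mres a s) = mres a (mhom s) }.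

Lemma pmod_hom_ext (M N : pmod) (h k : pmod_hom M N) :
  (forall u s, h u s = k u s) -> h = k.
Proof.
case: h k => [h h1 h2 h3] [k k1 k2 k3] /= e.
have e' : h = k by apply: functional_extensionality_dep => u; apply: funext.
by subst k; congr PModHom; apply: Prop_irrelevance.
Qed.

Definition pmod_hom_id (M : pmod) : pmod_hom M M.
Proof. by exists (fun u s => s). Defined.
Definition pmod_hom_comp (M N P : pmod) (k : pmod_hom N P) (h : pmod_hom M N) :
  pmod_hom M P.
Proof.
exists (fun u s => k u (h u s)).
- by move=> u s t; rewrite !mhomD.
- by move=> u r s; rewrite !mhomZ.
- by move=> u v a s; rewrite !mhom_nat.
Defined.

Definition pmap_of (M N : pmod) (h : pmod_hom M N) : pmap (psh_of M) (psh_of N).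
Proof. by exists (mhom h); apply: mhom_nat. Defined.

Definition add_psh (M : pmod) : pmap (prod_psh (psh_of M) (psh_of M)) (psh_of M).
Proof.
by exists (fun u (s : (M u * M u)%type) => s.1 + s.2) => u v a [s t];
  rewrite /= mresD.
Defined.
Definition scale_psh (M : pmod) :
  pmap (prod_psh structure_psh (psh_of M)) (psh_of M).
Proof.
by exists (fun u (s : (saff u * M u)%type) => s.1 *: s.2) => u v a [s t];
  rewrite /= mresZ.
Defined.

(** The map is [O(U) (x)_{O(V)} M(V) -> M(U)]. By flat descent, such presheaves
    are sheaves. *)
Definition qcoh (M : pmod) : Prop :=
  forall u v (a : shom u v),
    bijective (bc_ext (@idfun (saff u)) (mres a) : bc (base a) (M v) -> M u).

End Sheaves.
Arguments structure_psh {S} X.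

Section InverseImage.
Variables (S : ring_functor) (X Y : cfg S) (f : fmor X Y).

(** An object [(V, v, h, gamma)] of [I(u, f)] is an object [(V, v)] of the site
    of [Y] with a morphism [f u -> v] of [Y] (lying over [h]); morphisms of
    [I(u, f)] are the commuting triangles. The colimit over [I(u, f)] is the set
    of classes of triples [(v, gamma, s)], [s] a section of [F] over [v]. *)
Record germ (F : psh Y) (u : site X) := Germ {
  germ_ob : site Y;
  germ_hom : arrow (f _ (sob u)) (sob germ_ob);
  germ_sec : F germ_ob }.

Inductive germ_eq (F : psh Y) (u : site X) : germ F u -> germ F u -> Prop :=
| GermStep (v v' : site Y) (gamma : arrow (f _ (sob u)) (sob v)) (j : shom v v')
    (s : F v') : germ_eq (Germ gamma (res j s)) (Germ (comp j gamma) s)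
| GermRefl e : germ_eq e e
| GermSym e e' : germ_eq e e' -> germ_eq e' e
| GermTrans e e' e'' : germ_eq e e' -> germ_eq e' e'' -> germ_eq e e''.

Definition colim (F : psh Y) (u : site X) : Type :=
  {c : germ F u -> Prop | exists e, c = germ_eq e}.

Lemma colim_ext (F : psh Y) (u : site X) (c d : colim F u) : sval c = sval d -> c = d.
Proof.
by case: c d => [c hc] [d hd] /= e; subst d; congr exist; apply: Prop_irrelevance.
Qed.

Definition germ_class (F : psh Y) (u : site X) (e : germ F u) : colim F u :=
  exist _ (germ_eq e) (ex_intro _ e erefl).

Definition germ_repr (F : psh Y) (u : site X) (c : colim F u) : germ F u :=
  projT1 (cid (svalP c)).

Lemma germ_reprK F u : cancel (@germ_repr F u) (@germ_class F u).
Proof.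
by move=> c; apply: colim_ext; rewrite /= -(projT2 (cid (svalP c))).
Qed.

Lemma germ_classP F u (e e' : germ F u) :
  germ_class e = germ_class e' <-> germ_eq e e'.
Proof.
split=> [/(congr1 sval) /= h|h]; first by rewrite h; apply: GermRefl.
apply: colim_ext; apply: funext => x; apply: propext; split=> k.
  exact: GermTrans (GermSym h) k.
exact: GermTrans h k.
Qed.

Lemma germ_repr_class F u (e : germ F u) : germ_eq (germ_repr (germ_class e)) e.
Proof. by apply/germ_classP; rewrite germ_reprK. Qed.

Definition germ_res (F : psh Y) (u v : site X) (a : shom u v) (e : germ F v) :
  germ F u := Germ (comp (germ_hom e) (fhom f a)) (germ_sec e).

Lemma germ_res_eq F u v (a : shom u v) (e e' : germ F v) :
  germ_eq e e' -> germ_eq (germ_res a e) (germ_res a e').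
Proof.
elim=> {e e'} [w w' gamma j s|e|e e' _|e e' e'' _ h _].
- by rewrite /germ_res /= -comp_assoc; apply: GermStep.
- exact: GermRefl.
- exact: GermSym.
- exact: GermTrans.
Qed.

(** The presheaf [(U, u) |-> colim_{I(u, f)} F]. *)
Definition pre_inv (F : psh Y) : psh X.
Proof.
exists (colim F) (fun u v a c => germ_class (germ_res a (germ_repr c))).
- move=> u c; rewrite -[RHS]germ_reprK; congr germ_class.
  by case: (germ_repr c) => v g s; rewrite /germ_res /= fhom_id comp_idr.
- move=> u v w b a c; apply/germ_classP.
  apply: (GermTrans (e' := germ_res a (germ_res b (germ_repr c)))).
    rewrite /germ_res /= fhom_comp comp_assoc; exact: GermRefl.
  exact/germ_res_eq/GermSym/germ_repr_class.
Defined.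

Definition germ_push (F G : psh Y) (m : pmap F G) (u : site X) (e : germ F u) :
  germ G u := Germ (germ_hom e) (m _ (germ_sec e)).

Lemma germ_push_eq F G (m : pmap F G) u (e e' : germ F u) :
  germ_eq e e' -> germ_eq (germ_push m e) (germ_push m e').
Proof.
elim=> {e e'} [w w' gamma j s|e|e e' _|e e' e'' _ h _].
- by rewrite /germ_push /= pmap_nat; apply: GermStep.
- exact: GermRefl.
- exact: GermSym.
- exact: GermTrans.
Qed.

Definition pre_inv_map (F G : psh Y) (m : pmap F G) :
  pmap (pre_inv F) (pre_inv G).
Proof.
exists (fun u c => germ_class (germ_push m (germ_repr c))).
move=> u v a c; apply/germ_classP.
apply: GermTrans (germ_push_eq m (germ_repr_class _)) _.
apply/GermSym; exact: germ_res_eq (germ_repr_class _).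
Defined.

(** The morphism to the structure sheaf of [X] induced by the homomorphisms
    [h : O(V) -> O(U)]. *)
Definition germ_fun (u : site X) (e : germ (structure_psh Y) u) : saff u :=
  base (germ_hom e) (germ_sec e).

Lemma germ_fun_eq u (e e' : germ (structure_psh Y) u) :
  germ_eq e e' -> germ_fun e = germ_fun e'.
Proof.
elim=> {e e'} [w w' gamma j s|e|e e' _ ->|e e' e'' _ -> _ ->] //.
by rewrite /germ_fun /= base_comp.
Qed.

Definition pre_inv_structure : pmap (pre_inv (structure_psh Y)) (structure_psh X).
Proof.
exists (fun u c => germ_fun (germ_repr c)).
move=> u v a c; rewrite (germ_fun_eq (germ_repr_class _)).
by rewrite /germ_fun /= base_comp fhom_base.
Defined.

Variable sh : sheafification X.

(** [inv F] is the sheaf of sets [f^{-1} F]. *)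
Definition inv (F : psh Y) : psh X := sh (pre_inv F).
Definition inv_map (F G : psh Y) (m : pmap F G) : pmap (inv F) (inv G) :=
  ash_map sh (pre_inv_map m).

(** As [f^{-1}] commutes with finite products, [m : F x G -> H] induces an
    operation [f^{-1} F x f^{-1} G -> f^{-1} H]; [inv_op m s t r] says that its
    value at [(s, t)] is [r]. For [m] the addition of a module [F], or the
    multiplication by scalars, this is the addition of [f^{-1} F], or its
    multiplication by sections of [f^{-1} O_Y]. *)
Definition inv_op (F G H : psh Y) (m : pmap (prod_psh F G) H) (u : site X)
    (s : inv F u) (t : inv G u) (r : inv H u) : Prop :=
  exists z : inv (prod_psh F G) u,
    [/\ inv_map (fst_psh F G) u z = s, inv_map (snd_psh F G) u z = t
      & inv_map m u z = r].

(** [rho] is the ring homomorphism [f^{-1} O_Y -> O_X]. *)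
Definition is_inv_structure
    (rho : pmap (inv (structure_psh Y)) (structure_psh X)) : Prop :=
  forall u c, rho u (ash_unit (sh (pre_inv (structure_psh Y))) u c)
              = pre_inv_structure u c.

Variable rho : pmap (inv (structure_psh Y)) (structure_psh X).

(** Bilinear maps from [O_X x f^{-1} F] to a module [T], balanced over
    [f^{-1} O_Y] and linear over [O_X]. *)
Record balanced_pairing (F : pmod Y) (T : pmod X)
    (tau : forall u : site X, saff u -> inv (psh_of F) u -> T u) : Prop :=
  BalancedPairing {
  pairingDl : forall u b b' s, tau u (b + b') s = tau u b s + tau u b' s;
  pairingDr : forall u b s t r, inv_op (add_psh F) s t r ->
    tau u b r = tau u b s + tau u b t;
  pairingA : forall u b c s r, inv_op (scale_psh F) c s r ->
    tau u b r = tau u (b * rho u c) s;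
  pairingZ : forall u b c s, tau u (c * b) s = c *: tau u b s;
  pairing_nat : forall u v (a : shom u v) b s,
    tau u (base a b) (res a s) = mres a (tau v b s) }.

(** [T], with [tau], is the sheaf [O_X (x)_{f^{-1} O_Y} f^{-1} F]. *)
Record is_tensor (F : pmod Y) (T : pmod X)
    (tau : forall u : site X, saff u -> inv (psh_of F) u -> T u) : Prop :=
  IsTensor {
  tensor_sheaf : is_sheaf (psh_of T);
  tensor_pairing : balanced_pairing tau;
  tensor_univ : forall (T' : pmod X)
    (tau' : forall u : site X, saff u -> inv (psh_of F) u -> T' u),
    is_sheaf (psh_of T') -> balanced_pairing tau' ->
    exists! h : pmod_hom T T', forall u b s, h u (tau u b s) = tau' u b s }.

End InverseImage.

Record category := Category {
  cob :> Type;
  mor : cob -> cob -> Type;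
  mor_id : forall x, mor x x;
  mor_comp : forall x y z, mor y z -> mor x y -> mor x z;
  mor_idl : forall x y (a : mor x y), mor_comp (mor_id y) a = a;
  mor_idr : forall x y (a : mor x y), mor_comp a (mor_id x) = a;
  mor_assoc : forall t x y z (c : mor y z) (b : mor x y) (a : mor t x),
    mor_comp c (mor_comp b a) = mor_comp (mor_comp c b) a }.
Arguments mor {C} x y : rename.
Arguments mor_id {C} x : rename.
Arguments mor_comp {C x y z} b a : rename.

Record functor (C D : category) := Functor {
  fun_ob :> C -> D;
  fun_mor : forall x y : C, mor x y -> mor (fun_ob x) (fun_ob y);
  fun_id : forall x : C, fun_mor (mor_id x) = mor_id (fun_ob x);
  fun_comp : forall (x y z : C) (b : mor y z) (a : mor x y),
    fun_mor (mor_comp b a) = mor_comp (fun_mor b) (fun_mor a) }.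

Definition functor_comp (C D E : category) (G : functor D E) (F : functor C D) :
  functor C E.
Proof.
exists (fun x => G (F x)) (fun x y a => fun_mor G (fun_mor F a)).
- by move=> x; rewrite !fun_id.
- by move=> x y z b a; rewrite !fun_comp.
Defined.

Record natural_iso (C D : category) (F G : functor C D) := NaturalIso {
  niso : forall x : C, mor (F x) (G x);
  niso_inv : forall x : C, mor (G x) (F x);
  nisoK : forall x, mor_comp (niso_inv x) (niso x) = mor_id (F x);
  niso_invK : forall x, mor_comp (niso x) (niso_inv x) = mor_id (G x);
  niso_nat : forall (x y : C) (a : mor x y),
    mor_comp (niso y) (fun_mor F a) = mor_comp (fun_mor G a) (niso x) }.

Definition Qco (S : ring_functor) (X : cfg S) : category.
Proof.
exists {M : pmod X | qcoh M} (fun M N => pmod_hom (sval M) (sval N))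
  (fun M => pmod_hom_id (sval M)) (fun M N P k h => pmod_hom_comp k h);
  by move=> *; apply: pmod_hom_ext.
Defined.

(** The inverse image functor on quasi-coherent sheaves: [F] is sent to a tensor
    product [O_X (x)_{f^{-1} O_Y} f^{-1} F], and [h] to [id (x) f^{-1} h]. *)
Record inverse_image (S : ring_functor) (X Y : cfg S) (f : fmor X Y)
    (sh : sheafification X) := InverseImage {
  ii_structure : pmap (inv f sh (structure_psh Y)) (structure_psh X);
  ii_structureP : is_inv_structure ii_structure;
  ii_functor :> functor (Qco Y) (Qco X);
  ii_pairing : forall (F : Qco Y) (u : site X),
    saff u -> inv f sh (psh_of (sval F)) u -> sval (ii_functor F) u;
  ii_tensor : forall F : Qco Y, is_tensor ii_structure (@ii_pairing F);
  ii_mor : forall (F G : Qco Y) (h : mor F G) (u : site X) b s,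
    (fun_mor ii_functor h : pmod_hom _ _) u (@ii_pairing F u b s)
    = @ii_pairing G u b (inv_map f sh (pmap_of h) u s) }.

(** Hopf algebroids [(B0, B1)], as cogroupoid objects in commutative rings.
    [rtens hetaR hetaL] is [B1 (x) B1], with the left factor a [B0]-module via
    [hetaR] and the right one via [hetaL]. Coassociativity is tested on the
    triples of composable points of [B1] in a ring [R], i.e. on the homomorphisms
    from [B1 (x) B1 (x) B1] to [R]. *)
Record hopf_algebroid (B0 B1 : comPzRingType) := HopfAlgebroid {
  hetaL : {rmorphism B0 -> B1};
  hetaR : {rmorphism B0 -> B1};
  heps : {rmorphism B1 -> B0};
  hkappa : {rmorphism B1 -> B1};
  hnabla : {rmorphism B1 -> rtens hetaR hetaL};
  heps_etaL : forall b, heps (hetaL b) = b;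
  heps_etaR : forall b, heps (hetaR b) = b;
  hkappa_etaL : forall b, hkappa (hetaL b) = hetaR b;
  hkappa_etaR : forall b, hkappa (hetaR b) = hetaL b;
  hkappaK : involutive hkappa;
  hnabla_etaL : forall b, hnabla (hetaL b) = rt_inl (hetaL b);
  hnabla_etaR : forall b, hnabla (hetaR b) = rt_inr (hetaR b);
  hcounitl : forall b, rt_ext (hetaL \o heps) idfun (hnabla b) = b;
  hcounitr : forall b, rt_ext idfun (hetaR \o heps) (hnabla b) = b;
  hantipodel : forall b, rt_ext hkappa idfun (hnabla b) = hetaR (heps b);
  hantipoder : forall b, rt_ext idfun hkappa (hnabla b) = hetaL (heps b);
  hcoassoc : forall (R : comPzRingType) (x y z : {rmorphism B1 -> R}),
    (forall b, x (hetaR b) = y (hetaL b)) ->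
    (forall b, y (hetaR b) = z (hetaL b)) ->
    forall b, rt_ext (rt_ext x y \o hnabla) z (hnabla b)
              = rt_ext x (rt_ext y z \o hnabla) (hnabla b) }.

Record hopf_hom (A0 A1 B0 B1 : comPzRingType) (A : hopf_algebroid A0 A1)
    (B : hopf_algebroid B0 B1) := HopfHom {
  hh0 : {rmorphism A0 -> B0};
  hh1 : {rmorphism A1 -> B1};
  hh_etaL : forall a, hh1 (hetaL A a) = hetaL B (hh0 a);
  hh_etaR : forall a, hh1 (hetaR A a) = hetaR B (hh0 a);
  hh_eps : forall a, heps B (hh1 a) = hh0 (heps A a);
  hh_kappa : forall a, hkappa B (hh1 a) = hh1 (hkappa A a);
  hh_nabla : forall a, hnabla B (hh1 a)
    = rt_ext (rt_inl \o hh1) (rt_inr \o hh1) (hnabla A a) }.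

Section Comodules.
Variables (B0 B1 : comPzRingType) (B : hopf_algebroid B0 B1).

Definition B2 : comPzRingType := rtens (hetaR B) (hetaL B).
Definition etaR2 : {rmorphism B0 -> B2} := rt_inr \o hetaR B.

(** [B1 (x) B1 (x) N] is written [B2 (x)_{B0} N] with [B2 = B1 (x) B1]. *)
Definition nabla_id (N : lmodType B0) : bc (hetaR B) N -> bc etaR2 N :=
  bc_ext (P := bc etaR2 N) (hnabla B) (bct 1).
Definition inr_id (N : lmodType B0) : bc (hetaR B) N -> bc etaR2 N :=
  bc_ext (P := bc etaR2 N) (rt_inr : B1 -> B2) (bct 1).
Definition id_coact (N : lmodType B0) (psi : N -> bc (hetaR B) N) :
  bc (hetaR B) N -> bc etaR2 N :=
  bc_ext (P := bc etaR2 N) (rt_inl : B1 -> B2) (fun n => inr_id (psi n)).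
Definition eps_id (N : lmodType B0) : bc (hetaR B) N -> N :=
  bc_ext (heps B) (@idfun N).

Record comodule := Comodule {
  carrier :> lmodType B0;
  coact : carrier -> bc (hetaR B) carrier;
  coactD : {morph coact : m n / m + n};
  coactZ : forall b n, coact (b *: n) = hetaL B b *: coact n;
  coact_assoc : forall n, nabla_id (coact n) = id_coact coact (coact n);
  coact_counit : forall n, eps_id (coact n) = n }.

Record comodule_hom (M N : comodule) := ComoduleHom {
  chom :> M -> N;
  chomD : {morph chom : m n / m + n};
  chomZ : forall b m, chom (b *: m) = b *: chom m;
  chom_coact : forall m, coact (chom m) = bc_map (hetaR B) chom (coact m) }.

Lemma comodule_hom_ext (M N : comodule) (h k : comodule_hom M N) :
  h =1 k -> h = k.
Proof.
case: h k => [h h1 h2 h3] [k k1 k2 k3] /= e.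
have e' : h = k by apply: funext.
by subst k; congr ComoduleHom; apply: Prop_irrelevance.
Qed.

End Comodules.

Section BcMap.
Variables (A B : comPzRingType) (eta : {rmorphism A -> B}).

Lemma bct1Z (N : lmodType A) a (n : N) :
  bct 1 (a *: n) = eta a *: (bct 1 n : bc eta N).
Proof. by rewrite bcZ mulr1 -bctA mul1r. Qed.

Section One.
Variables (N N' : lmodType A) (h : N -> N').
Hypotheses (hD : {morph h : m n / m + n}) (hZ : forall a n, h (a *: n) = a *: h n).
Let fD : {morph (fun n => bct 1 (h n) : bc eta N') : m n / m + n}.
Proof. by move=> m n; rewrite hD bctDr. Qed.
Let fZ a n : (bct 1 (h (a *: n)) : bc eta N') = (idfun (eta a)) *: bct 1 (h n).
Proof. by rewrite hZ bct1Z. Qed.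
Lemma bc_map_tens b n : bc_map eta h (bct b n) = bct b (h n).
Proof. by rewrite /bc_map (bc_ext_tens fD fZ) bcZ mulr1. Qed.
Lemma bc_mapD : {morph bc_map eta h : s t / s + t}.
Proof. exact: (bc_extD fD fZ). Qed.
Lemma bc_mapZ b t : bc_map eta h (b *: t) = b *: bc_map eta h t.
Proof. exact: (bc_extZ fD fZ). Qed.
End One.

Lemma bc_map_id (N : lmodType A) : bc_map eta (@idfun N) =1 id.
Proof.
by apply: bc_eq_ext => [s t|s t|b n] //; [rewrite bc_mapD | rewrite bc_map_tens].
Qed.

Lemma bc_map_comp (N N' N'' : lmodType A) (k : N' -> N'') (h : N -> N') :
  {morph h : m n / m + n} -> (forall a n, h (a *: n) = a *: h n) ->
  {morph k : m n / m + n} -> (forall a n, k (a *: n) = a *: k n) ->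
  forall t, bc_map eta (fun n => k (h n)) t = bc_map eta k (bc_map eta h t).
Proof.
move=> hD hZ kD kZ.
have khD : {morph (fun n => k (h n)) : m n / m + n}.
  by move=> m n; rewrite hD kD.
have khZ a n : k (h (a *: n)) = a *: k (h n) by rewrite hZ kZ.
apply: bc_eq_ext => [s t|s t|b n].
- by rewrite bc_mapD.
- by rewrite !bc_mapD.
- by rewrite !bc_map_tens.
Qed.
End BcMap.

Section ComoduleCategory.
Variables (B0 B1 : comPzRingType) (B : hopf_algebroid B0 B1).

Definition comodule_id (M : comodule B) : comodule_hom M M.
Proof. by exists (@idfun M) => // m; rewrite bc_map_id. Defined.

Definition comodule_comp (M N P : comodule B) (k : comodule_hom N P)
  (h : comodule_hom M N) : comodule_hom M P.
Proof.
exists (fun m => k (h m)).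
- by move=> m n; rewrite !chomD.
- by move=> b m; rewrite !chomZ.
- move=> m; rewrite !chom_coact.
  exact/esym/(bc_map_comp (@chomD _ _ _ _ _ h) (@chomZ _ _ _ _ _ h)
    (@chomD _ _ _ _ _ k) (@chomZ _ _ _ _ _ k)).
Defined.

Definition coMod : category.
Proof.
exists (comodule B) (@comodule_hom _ _ B) comodule_id comodule_comp;
  by move=> *; apply: comodule_hom_ext.
Defined.

Section Maps.
Variable N : lmodType B0.
Notation B2 := (B2 B).
Notation etaR2 := (etaR2 B).

Let oneD : {morph (bct 1 : N -> bc etaR2 N) : m n / m + n}.
Proof. by move=> m n; rewrite bctDr. Qed.
Let nablaZ a n : (bct 1 (a *: n) : bc etaR2 N) = hnabla B (hetaR B a) *: bct 1 n.
Proof. by rewrite bct1Z hnabla_etaR. Qed.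
Let inrZ a n :
  (bct 1 (a *: n) : bc etaR2 N) = (rt_inr (hetaR B a) : B2) *: bct 1 n.
Proof. by rewrite bct1Z. Qed.

Lemma nabla_id_tens b n :
  nabla_id (bct b n : bc (hetaR B) N) = bct (hnabla B b : B2) n.
Proof. by rewrite /nabla_id (bc_ext_tens oneD nablaZ) bcZ mulr1. Qed.
Lemma nabla_idD : {morph @nabla_id _ _ B N : s t / s + t}.
Proof. exact: (bc_extD oneD nablaZ). Qed.
Lemma nabla_idZ b t : nabla_id (b *: t) = (hnabla B b : B2) *: @nabla_id _ _ B N t.
Proof. exact: (bc_extZ oneD nablaZ). Qed.

Lemma inr_id_tens b n :
  inr_id (bct b n : bc (hetaR B) N) = bct (rt_inr b : B2) n.
Proof. by rewrite /inr_id (bc_ext_tens oneD inrZ) bcZ mulr1. Qed.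
Lemma inr_idD : {morph @inr_id _ _ B N : s t / s + t}.
Proof. exact: (bc_extD oneD inrZ). Qed.
Lemma inr_idZ b t : inr_id (b *: t) = (rt_inr b : B2) *: @inr_id _ _ B N t.
Proof. exact: (bc_extZ oneD inrZ). Qed.

Let epsZ a (n : N) : idfun (a *: n) = heps B (hetaR B a) *: n.
Proof. by rewrite heps_etaR. Qed.
Lemma eps_id_tens b n : eps_id (bct b n : bc (hetaR B) N) = heps B b *: n.
Proof. by rewrite /eps_id (bc_ext_tens (f := @idfun N) (fun _ _ => erefl) epsZ). Qed.
Lemma eps_idD : {morph @eps_id _ _ B N : s t / s + t}.
Proof. exact: (bc_extD (f := @idfun N) (fun _ _ => erefl) epsZ). Qed.
Lemma eps_idZ b t : eps_id (b *: t) = heps B b *: @eps_id _ _ B N t.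
Proof. exact: (bc_extZ (f := @idfun N) (fun _ _ => erefl) epsZ). Qed.

Variable psi : N -> bc (hetaR B) N.
Hypotheses (psiD : {morph psi : m n / m + n})
  (psiZ : forall b n, psi (b *: n) = hetaL B b *: psi n).
Let fD : {morph (fun n => inr_id (psi n)) : m n / m + n}.
Proof. by move=> m n; rewrite psiD inr_idD. Qed.
Let fZ a n :
  inr_id (psi (a *: n)) = (rt_inl (hetaR B a) : B2) *: inr_id (psi n).
Proof. by rewrite psiZ inr_idZ rt_glue. Qed.
Lemma id_coact_tens b n :
  id_coact psi (bct b n) = (rt_inl b : B2) *: inr_id (psi n).
Proof. exact: (bc_ext_tens fD fZ). Qed.
Lemma id_coactD : {morph id_coact psi : s t / s + t}.
Proof. exact: (bc_extD fD fZ). Qed.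
Lemma id_coactZ b t : id_coact psi (b *: t) = (rt_inl b : B2) *: id_coact psi t.
Proof. exact: (bc_extZ fD fZ). Qed.
End Maps.
End ComoduleCategory.

Section BaseChangeComodule.
Variables (A0 A1 B0 B1 : comPzRingType).
Variables (A : hopf_algebroid A0 A1) (B : hopf_algebroid B0 B1) (phi : hopf_hom A B).
Notation phi0 := (hh0 phi).
Notation phi1 := (hh1 phi).

(** [A1 (x)_{A0} M -> B1 (x)_{B0} (B0 (x)_{A0} M)],
    [a (x) m |-> phi1 a (x) (1 (x) m)]. *)
Definition phi1_id (M : lmodType A0) :
    bc (hetaR A) M -> bc (hetaR B) (bc phi0 M) :=
  bc_ext (P := bc (hetaR B) (bc phi0 M)) phi1 (fun m => bct 1 (bct 1 m)).

(** [b (x) m] is sent to the sum of the [hetaL b * phi1 a_i (x) (1 (x) m_i)],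
    where [psi m] is the sum of the [a_i (x) m_i]. *)
Definition bc_coact (M : lmodType A0) (psi : M -> bc (hetaR A) M) :
    bc phi0 M -> bc (hetaR B) (bc phi0 M) :=
  bc_ext (P := bc (hetaR B) (bc phi0 M)) (hetaL B) (fun m => phi1_id (psi m)).

Section Lemmas.
Variable M : lmodType A0.
Let N : lmodType B0 := bc phi0 M.
Let oneD : {morph (fun m : M => bct 1 (bct 1 m : N) : bc (hetaR B) N) : m n / m + n}.
Proof. by move=> m n; rewrite !bctDr. Qed.
Let oneZ a (m : M) :
  (bct 1 (bct 1 (a *: m) : N) : bc (hetaR B) N)
  = phi1 (hetaR A a) *: bct 1 (bct 1 m).
Proof. by rewrite !bct1Z hh_etaR. Qed.
Lemma phi1_id_tens b m :
  phi1_id (bct b m : bc (hetaR A) M) = bct (phi1 b) (bct 1 m : N).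
Proof. by rewrite /phi1_id (bc_ext_tens oneD oneZ) bcZ mulr1. Qed.
Lemma phi1_idD : {morph @phi1_id M : s t / s + t}.
Proof. exact: (bc_extD oneD oneZ). Qed.
Lemma phi1_idZ a t : @phi1_id M (a *: t) = phi1 a *: phi1_id t.
Proof. exact: (bc_extZ oneD oneZ). Qed.

Variable psi : M -> bc (hetaR A) M.
Hypotheses (psiD : {morph psi : m n / m + n})
  (psiZ : forall b n, psi (b *: n) = hetaL A b *: psi n).
Let fD : {morph (fun m => phi1_id (psi m)) : m n / m + n}.
Proof. by move=> m n; rewrite psiD phi1_idD. Qed.
Let fZ a m : phi1_id (psi (a *: m)) = hetaL B (phi0 a) *: phi1_id (psi m).
Proof. by rewrite psiZ phi1_idZ hh_etaL. Qed.
Lemma bc_coact_tens b m :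
  bc_coact psi (bct b m) = hetaL B b *: phi1_id (psi m).
Proof. exact: (bc_ext_tens fD fZ). Qed.
Lemma bc_coactD : {morph bc_coact psi : s t / s + t}.
Proof. exact: (bc_extD fD fZ). Qed.
Lemma bc_coactZ b t : bc_coact psi (b *: t) = hetaL B b *: bc_coact psi t.
Proof. exact: (bc_extZ fD fZ). Qed.

Let phil : {rmorphism A1 -> B2 B} := rt_inl \o phi1.
Let phir : {rmorphism A1 -> B2 B} := rt_inr \o phi1.
Let phi2 : B2 A -> B2 B := rt_ext phil phir.
Let phi2_glue a : phil (hetaR A a) = phir (hetaL A a).
Proof. by rewrite /phil /phir /= hh_etaR hh_etaL rt_glue. Qed.
Let phi2_inl a : phi2 (rt_inl a) = rt_inl (phi1 a).
Proof. by rewrite /phi2 (rt_ext_tens phi2_glue) rmorph1 mulr1. Qed.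
Let phi2_inr a : phi2 (rt_inr a) = rt_inr (phi1 a).
Proof. by rewrite /phi2 (rt_ext_tens phi2_glue) rmorph1 mul1r. Qed.
Let phi2_nmod : nmod_morphism phi2.
Proof.
split; last by move=> s t; apply: (rt_extD phi2_glue).
by apply: (addrI (phi2 0)); rewrite -[LHS]rt_extD // !addr0.
Qed.
Let phi2_monoid : monoid_morphism phi2.
Proof.
split; last by move=> s t; apply: (rt_extM phi2_glue).
by rewrite -[1]/(rt_inl 1) phi2_inl rmorph1.
Qed.
HB.instance Definition _ := GRing.isNmodMorphism.Build (B2 A) (B2 B) phi2 phi2_nmod.
HB.instance Definition _ := GRing.isMonoidMorphism.Build (B2 A) (B2 B) phi2 phi2_monoid.

Let Phi2 : bc (etaR2 A) M -> bc (etaR2 B) N :=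
  bc_ext (P := bc (etaR2 B) N) phi2 (fun m => bct 1 (bct 1 m)).
Let PD : {morph (fun m : M => bct 1 (bct 1 m : N) : bc (etaR2 B) N) : m n / m + n}.
Proof. by move=> m n; rewrite !bctDr. Qed.
Let PZ a (m : M) :
  (bct 1 (bct 1 (a *: m) : N) : bc (etaR2 B) N)
  = phi2 (etaR2 A a) *: bct 1 (bct 1 m).
Proof. by rewrite !bct1Z /etaR2 /= phi2_inr hh_etaR. Qed.
Let Phi2_tens x m : Phi2 (bct x m) = bct (phi2 x) (bct 1 m : N).
Proof. by rewrite /Phi2 (bc_ext_tens PD PZ) bcZ mulr1. Qed.
Let Phi2D : {morph Phi2 : s t / s + t}.
Proof. exact: (bc_extD PD PZ). Qed.
Let Phi2Z x t : Phi2 (x *: t) = phi2 x *: Phi2 t.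
Proof. exact: (bc_extZ PD PZ). Qed.

Let nabla_phi t : nabla_id (phi1_id t) = Phi2 (nabla_id (t : bc (hetaR A) M)).
Proof.
move: t; apply: bc_eq_ext => [s t|s t|b m].
- by rewrite phi1_idD nabla_idD.
- by rewrite nabla_idD Phi2D.
- by rewrite phi1_id_tens !nabla_id_tens Phi2_tens hh_nabla.
Qed.
Let inr_phi t : inr_id (phi1_id t) = Phi2 (inr_id (t : bc (hetaR A) M)).
Proof.
move: t; apply: bc_eq_ext => [s t|s t|b m].
- by rewrite phi1_idD inr_idD.
- by rewrite inr_idD Phi2D.
- by rewrite phi1_id_tens !inr_id_tens Phi2_tens phi2_inr.
Qed.
Let coact_phi t : id_coact (bc_coact psi) (phi1_id t) = Phi2 (id_coact psi t).
Proof.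
move: t; apply: bc_eq_ext => [s t|s t|b m].
- by rewrite phi1_idD (id_coactD bc_coactD bc_coactZ).
- by rewrite (id_coactD psiD psiZ) Phi2D.
- rewrite phi1_id_tens (id_coact_tens bc_coactD bc_coactZ) bc_coact_tens.
  by rewrite (id_coact_tens psiD psiZ) rmorph1 scale1r inr_phi Phi2Z phi2_inl.
Qed.

Lemma bc_coact_assoc :
  (forall m, nabla_id (psi m) = id_coact psi (psi m)) ->
  forall t, nabla_id (bc_coact psi t) = id_coact (bc_coact psi) (bc_coact psi t).
Proof.
move=> h; apply: bc_eq_ext => [s t|s t|b m].
- by rewrite bc_coactD nabla_idD.
- by rewrite bc_coactD (id_coactD bc_coactD bc_coactZ).
- rewrite bc_coact_tens nabla_idZ (id_coactZ bc_coactD bc_coactZ) hnabla_etaL.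
  by rewrite nabla_phi coact_phi h.
Qed.

Lemma bc_coact_counit :
  (forall m, eps_id (psi m) = m) -> forall t, eps_id (bc_coact psi t) = t.
Proof.
move=> h; apply: bc_eq_ext => [s t|s t|b m] //.
- by rewrite bc_coactD eps_idD.
- rewrite bc_coact_tens eps_idZ heps_etaL.
  suff e t : eps_id (phi1_id t) = bct 1 (eps_id (t : bc (hetaR A) M)) :> N.
    by rewrite e h bcZ mulr1.
  move: t; apply: bc_eq_ext => [s t|s t|a n].
  + by rewrite phi1_idD eps_idD.
  + by rewrite eps_idD bctDr.
  + by rewrite phi1_id_tens !eps_id_tens hh_eps bct1Z.
Qed.
End Lemmas.

Definition bc_comodule (M : comodule A) : comodule B :=
  Comodule (bc_coactD (@coactD _ _ _ M) (@coactZ _ _ _ M))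
    (bc_coactZ (@coactD _ _ _ M) (@coactZ _ _ _ M))
    (bc_coact_assoc (@coactD _ _ _ M) (@coactZ _ _ _ M) (@coact_assoc _ _ _ M))
    (bc_coact_counit (@coactD _ _ _ M) (@coactZ _ _ _ M) (@coact_counit _ _ _ M)).

Lemma bc_map_coact (M M' : comodule A) (h : comodule_hom M M')
  (t : bc phi0 M) :
  bc_coact (@coact _ _ _ M') (bc_map phi0 h t)
  = bc_map (hetaR B) (bc_map phi0 h) (bc_coact (@coact _ _ _ M) t).
Proof.
have hD := @chomD _ _ _ _ _ h; have hZ := @chomZ _ _ _ _ _ h.
have kD := bc_mapD (eta := phi0) hD hZ; have kZ := bc_mapZ (eta := phi0) hD hZ.
have cD := @coactD _ _ A; have cZ := @coactZ _ _ A.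
move: t; apply: bc_eq_ext => [s t|s t|b m] /=.
- by rewrite kD (bc_coactD (cD M') (cZ M')).
- by rewrite (bc_coactD (cD M) (cZ M)) (bc_mapD kD kZ).
- rewrite (bc_map_tens _ hD hZ) (bc_coact_tens (cD M') (cZ M')).
  rewrite (bc_coact_tens (cD M) (cZ M)) (bc_mapZ kD kZ) chom_coact.
  congr (_ *: _); move: (coact m); apply: bc_eq_ext => [s t|s t|a n].
  + by rewrite (bc_mapD hD hZ) phi1_idD.
  + by rewrite phi1_idD (bc_mapD kD kZ).
  + rewrite (bc_map_tens _ hD hZ) !phi1_id_tens (bc_map_tens _ kD kZ).
    by rewrite (bc_map_tens _ hD hZ).
Qed.

Definition bc_comodule_hom (M M' : comodule A) (h : comodule_hom M M') :
    comodule_hom (bc_comodule M) (bc_comodule M') :=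
  @ComoduleHom _ _ B (bc_comodule M) (bc_comodule M') (bc_map phi0 h)
    (bc_mapD (@chomD _ _ _ _ _ h) (@chomZ _ _ _ _ _ h))
    (bc_mapZ (@chomD _ _ _ _ _ h) (@chomZ _ _ _ _ _ h))
    (bc_map_coact h).

Definition bc_functor : functor (coMod A) (coMod B).
Proof.
exists (bc_comodule : coMod A -> coMod B) bc_comodule_hom.
- by move=> M; apply: comodule_hom_ext => t; exact (bc_map_id (eta := phi0) t).
- move=> M N P k h; apply: comodule_hom_ext => t; 
  exact: (bc_map_comp (@chomD _ _ _ _ _ h) (@chomZ _ _ _ _ _ h)
    (@chomD _ _ _ _ _ k) (@chomZ _ _ _ _ _ k)).
Defined.

End BaseChangeComodule.

(** [B] is the Hopf algebroid of [p : U -> X]. [hp_x1] is [p p_2] over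
    [U1 = U x_X U]; with [phi : p p_1 => p p_2] the canonical 2-morphism,
    [hp_pi1] is [(p_1, phi^{-1})] and [hp_pi2] is [(p_2, id)]. By
    [hp_p12_p23], [hp_x2] is the fibre product of [hp_pi2] and [hp_pi1], that is
    the triple fibre product of [p] over the spectrum of [B1 (x) B1]. *)
Record hopf_of_presentation (S : ring_functor) (X : cfg S) (U U1 : aff S)
    (p : ob X U) (B : hopf_algebroid U U1) := HopfOfPresentation {
  hp_x1 : ob X U1;
  hp_flat1 : flat_fp_mor hp_x1;
  hp_pi1 : arrow hp_x1 p;
  hp_pi2 : arrow hp_x1 p;
  hp_product : is_fibre_product hp_pi1 hp_pi2;
  hp_etaL : base hp_pi1 =1 hetaL B;
  hp_etaR : base hp_pi2 =1 hetaR B;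
  hp_diag : arrow p hp_x1;
  hp_diag1 : comp hp_pi1 hp_diag = id_arrow p;
  hp_diag2 : comp hp_pi2 hp_diag = id_arrow p;
  hp_eps : base hp_diag =1 heps B;
  hp_swap : arrow hp_x1 hp_x1;
  hp_swap1 : comp hp_pi1 hp_swap = hp_pi2;
  hp_swap2 : comp hp_pi2 hp_swap = hp_pi1;
  hp_kappa : base hp_swap =1 hkappa B;
  hp_struct2 : S (B2 B);
  hp_x2 : ob X (Aff hp_struct2);
  hp_flat2 : flat_fp_mor hp_x2;
  hp_p12 : arrow hp_x2 hp_x1;
  hp_p23 : arrow hp_x2 hp_x1;
  hp_p12_base : base hp_p12 =1 (rt_inl : U1 -> B2 B);
  hp_p23_base : base hp_p23 =1 (rt_inr : U1 -> B2 B);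
  hp_p12_p23 : comp hp_pi2 hp_p12 = comp hp_pi1 hp_p23;
  hp_p13 : arrow hp_x2 hp_x1;
  hp_p13_1 : comp hp_pi1 hp_p13 = comp hp_pi1 hp_p12;
  hp_p13_2 : comp hp_pi2 hp_p13 = comp hp_pi2 hp_p23;
  hp_nabla : base hp_p13 =1 hnabla B }.

(** [phi] is the homomorphism of Hopf algebroids determined by [f0] and
    [gamma : f p => q f0]. The morphism [h1 : f (p p_2) -> q q_2] of [Y] lies over
    [f1 : X_1 -> Y_1]. *)
Definition hopf_hom_of_presentations (S : ring_functor) (X Y : cfg S)
    (f : fmor X Y) (U U1 V V1 : aff S) (p : ob X U) (q : ob Y V)
    (B : hopf_algebroid U U1) (A : hopf_algebroid V V1)
    (hB : hopf_of_presentation p B) (hA : hopf_of_presentation q A)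
    (f0 : amor U V) (gamma : arrow (f U p) q) (phi : hopf_hom A B) : Prop :=
  hh0 phi =1 f0 /\
  exists h1 : arrow (f U1 (hp_x1 hB)) (hp_x1 hA),
    [/\ base h1 =1 hh1 phi,
        comp (hp_pi1 hA) h1 = comp gamma (fhom f (hp_pi1 hB))
      & comp (hp_pi2 hA) h1 = comp gamma (fhom f (hp_pi2 hB))].

Lemma qcoh_bijective (S : ring_functor) (X : cfg S) (M : pmod X) (u v : site X)
    (a : shom u v) (eta : {rmorphism saff v -> saff u}) :
  qcoh M -> base a =1 eta ->
  bijective (bc_ext (@idfun (saff u)) (mres a) : bc eta (M v) -> M u).
Proof.
move=> hM /(@rmorph_ext (saff v) (saff u) (base a) eta) e.
by case: eta / e; apply: hM.
Qed.

Section Gamma.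
Variables (S : ring_functor) (X : cfg S) (U U1 : aff S) (p : ob X U).
Variables (B : hopf_algebroid U U1).
Variables (hp : presentation p) (hB : hopf_of_presentation p B).

Definition site_p : site X := Site (presentation_flat hp).
Definition site_x1 : site X := Site (hp_flat1 hB).
Definition site_x2 : site X := Site (hp_flat2 hB).

Section Object.
Variables (F : pmod X) (hF : qcoh F).
Let M : lmodType U := F site_p.

(** [B1 (x)_{B0} F(X, p) -> F(X_1, p p_2)], induced by [F(p_2, id)]. *)
Definition gamma_can : bc (hetaR B) M -> F site_x1 :=
  bc_ext (P := F site_x1) (@idfun U1) (@mres _ _ F site_x1 site_p (hp_pi2 hB)).

Lemma gamma_can_bij : bijective gamma_can.
Proof.
exact: (qcoh_bijective (u := site_x1) (v := site_p) (a := hp_pi2 hB) hF (hp_etaR hB)).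
Qed.

Lemma gamma_can_inv_exists : exists g, cancel g gamma_can.
Proof. by case: gamma_can_bij => g _ gK; exists g. Qed.

Definition gamma_can_inv : F site_x1 -> bc (hetaR B) M :=
  projT1 (cid gamma_can_inv_exists).

Lemma gamma_can_invK : cancel gamma_can_inv gamma_can.
Proof. exact (projT2 (cid gamma_can_inv_exists)). Qed.

Definition gamma_coact (m : M) : bc (hetaR B) M :=
  gamma_can_inv (@mres _ _ F site_x1 site_p (hp_pi1 hB) m).

Let canD_hyp : {morph @mres _ _ F site_x1 site_p (hp_pi2 hB) : m n / m + n}.
Proof. exact: mresD. Qed.
Let canZ_hyp b m : @mres _ _ F site_x1 site_p (hp_pi2 hB) (b *: m)
  = idfun (hetaR B b) *: @mres _ _ F site_x1 site_p (hp_pi2 hB) m.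
Proof. by rewrite mresZ hp_etaR. Qed.
Let can_tens b m :
  gamma_can (bct b m) = b *: @mres _ _ F site_x1 site_p (hp_pi2 hB) m.
Proof. exact: (bc_ext_tens canD_hyp canZ_hyp). Qed.
Let canD : {morph gamma_can : s t / s + t}.
Proof. exact: (bc_extD canD_hyp canZ_hyp). Qed.
Let canZ b t : gamma_can (b *: t) = b *: gamma_can t.
Proof. exact: (bc_extZ canD_hyp canZ_hyp). Qed.

Lemma gamma_coactD : {morph gamma_coact : m n / m + n}.
Proof.
move=> m n; apply: (bij_inj gamma_can_bij).
by rewrite canD !gamma_can_invK mresD.
Qed.
Lemma gamma_coactZ b m : gamma_coact (b *: m) = hetaL B b *: gamma_coact m.
Proof.
apply: (bij_inj gamma_can_bij).
by rewrite canZ !gamma_can_invK mresZ hp_etaL.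
Qed.

Lemma gamma_counit m : eps_id (gamma_coact m) = m.
Proof.
pose d := @mres _ _ F site_p site_x1 (hp_diag hB).
have e t : eps_id t = d (gamma_can t).
  move: t; apply: bc_eq_ext => [s t|s t|b n].
  - exact: eps_idD.
  - by rewrite canD /d mresD.
  - by rewrite eps_id_tens can_tens /d mresZ -mres_comp hp_diag2 mres_id hp_eps.
by rewrite e gamma_can_invK /d -mres_comp hp_diag1 mres_id.
Qed.

Let r23 := @mres _ _ F site_x2 site_p (comp (hp_pi2 hB) (hp_p23 hB)).
Let can2 : bc (etaR2 B) M -> F site_x2 :=
  bc_ext (P := F site_x2) (@idfun (B2 B)) r23.
Let base23 : base (comp (hp_pi2 hB) (hp_p23 hB)) =1 etaR2 B.
Proof. by move=> b; rewrite base_comp hp_p23_base hp_etaR. Qed.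
Let can2_bij : bijective can2.
Proof.
exact: (qcoh_bijective (u := site_x2) (v := site_p)
          (a := comp (hp_pi2 hB) (hp_p23 hB)) hF base23).
Qed.
Let r23D : {morph r23 : m n / m + n}.
Proof. exact: mresD. Qed.
Let r23Z b m : r23 (b *: m) = idfun (etaR2 B b) *: r23 m.
Proof. by rewrite /r23 mresZ base23. Qed.
Let can2_tens b m : can2 (bct b m) = b *: r23 m.
Proof. exact: (bc_ext_tens r23D r23Z). Qed.
Let can2D : {morph can2 : s t / s + t}.
Proof. exact: (bc_extD r23D r23Z). Qed.
Let can2Z b t : can2 (b *: t) = b *: can2 t.
Proof. exact: (bc_extZ r23D r23Z). Qed.

Lemma gamma_assoc m :
  nabla_id (gamma_coact m) = id_coact gamma_coact (gamma_coact m).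
Proof.
pose r12 := @mres _ _ F site_x2 site_x1 (hp_p12 hB).
pose r13 := @mres _ _ F site_x2 site_x1 (hp_p13 hB).
pose s23 := @mres _ _ F site_x2 site_x1 (hp_p23 hB).
have e1 t : can2 (nabla_id t) = r13 (gamma_can t).
  move: t; apply: bc_eq_ext => [s t|s t|b n].
  - by rewrite nabla_idD can2D.
  - by rewrite canD /r13 mresD.
  - rewrite nabla_id_tens can2_tens can_tens /r13 mresZ -mres_comp hp_p13_2.
    by rewrite hp_nabla.
have e2 t : can2 (inr_id t) = s23 (gamma_can t).
  move: t; apply: bc_eq_ext => [s t|s t|b n].
  - by rewrite inr_idD can2D.
  - by rewrite canD /s23 mresD.
  - rewrite inr_id_tens can2_tens can_tens /s23 mresZ -mres_comp.
    by rewrite hp_p23_base.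
have e3 t : can2 (id_coact gamma_coact t) = r12 (gamma_can t).
  move: t; apply: bc_eq_ext => [s t|s t|b n].
  - by rewrite (id_coactD gamma_coactD gamma_coactZ) can2D.
  - by rewrite canD /r12 mresD.
  - rewrite (id_coact_tens gamma_coactD gamma_coactZ) can2Z e2 gamma_can_invK.
    rewrite can_tens /r12 /s23 mresZ -!mres_comp hp_p12_p23.
    by rewrite hp_p12_base.
apply: (bij_inj can2_bij); rewrite e1 e3 gamma_can_invK /r12 /r13 -!mres_comp.
by rewrite hp_p13_1.
Qed.

Definition gamma_comodule : comodule B :=
  Comodule gamma_coactD gamma_coactZ gamma_assoc gamma_counit.

End Object.

Lemma gamma_hom_coact (F G : pmod X) (hF : qcoh F) (hG : qcoh G)
    (h : pmod_hom F G) (m : F site_p) :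
  gamma_coact hG (h site_p m)
  = bc_map (hetaR B) (h site_p) (gamma_coact hF m).
Proof.
apply: (bij_inj (gamma_can_bij hG)); rewrite gamma_can_invK.
have hD := @mhomD _ _ _ _ h site_p; have hZ := @mhomZ _ _ _ _ h site_p.
have e t : @gamma_can G (bc_map (hetaR B) (h site_p) t) = h site_x1 (@gamma_can F t).
  have D (H : pmod X) : {morph @mres _ _ H site_x1 site_p (hp_pi2 hB) : m n / m + n}.
    exact: mresD.
  have Z (H : pmod X) b m' : @mres _ _ H site_x1 site_p (hp_pi2 hB) (b *: m')
      = idfun (hetaR B b) *: @mres _ _ H site_x1 site_p (hp_pi2 hB) m'.
    by rewrite mresZ hp_etaR.
  move: t; apply: bc_eq_ext => [s t|s t|b n].
  - by rewrite (bc_mapD hD hZ) /gamma_can (bc_extD (D G) (Z G)).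
  - by rewrite /gamma_can (bc_extD (D F) (Z F)) mhomD.
  - rewrite (bc_map_tens _ hD hZ) /gamma_can (bc_ext_tens (D G) (Z G)).
    by rewrite (bc_ext_tens (D F) (Z F)) mhomZ mhom_nat.
by rewrite e gamma_can_invK mhom_nat.
Qed.

Definition gamma_hom (F G : Qco X) (h : mor F G) :
    comodule_hom (gamma_comodule (svalP F)) (gamma_comodule (svalP G)) :=
  @ComoduleHom _ _ B (gamma_comodule (svalP F)) (gamma_comodule (svalP G))
    ((h : pmod_hom _ _) site_p)
    (@mhomD _ _ _ _ (h : pmod_hom _ _) site_p)
    (@mhomZ _ _ _ _ (h : pmod_hom _ _) site_p)
    (gamma_hom_coact (svalP F) (svalP G) h).

Definition Gamma : functor (Qco X) (coMod B).
Proof.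
exists (fun F : Qco X => gamma_comodule (svalP F) : coMod B) gamma_hom;
  by move=> *; apply: comodule_hom_ext.
Defined.

End Gamma.

(* Main.v *)
(** Put [M = F(Y, q)] and [T = f^* F]. A section [s] of [F] over [v] and a morphism
    [g : f u -> v] give the section [1 (x) (germ of s along g)] of [T] over [u]; for
    [g = gamma] this is a [B_0]-linear map [B_0 (x)_{A_0} M -> T(X, p)], natural in
    [F] and compatible with the coactions because germs are compatible with
    restriction. It remains to see that it is bijective.

    For [u] in the site of [X] let [w_u = u x_X p]. By fppf descent the presheaf
    [u |-> O(w_u) (x)_{A_0} M] is a sheaf, and, since [F] is quasi-coherent, each
    germ [(v, g, s)] has a value in it: restrict [s] to [v x_Y q], where [F] is the
    base change of [M]. The universal property of the tensor product yields a
    morphism from [T] to this sheaf; taking sections over [p] and restricting along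
    the diagonal [p -> w_p] gives a left inverse. It is also a right inverse: the
    two morphisms from [T] to the sheaf [u |-> T(w_u)], one being restriction and
    the other passing through [O(w_u) (x)_{A_0} M], agree on germs, hence are equal. *)
From Pilot Require Import Defs.
From HB Require Import structures.
From mathcomp Require Import all_boot all_algebra.
From mathcomp Require Import boolp classical_sets.
Import Pilot.Defs.
Set Implicit Arguments. Unset Strict Implicit. Unset Printing Implicit Defensive.
Import GRing.Theory.
Local Open Scope ring_scope.
Local Open Scope quotient_scope.

(** * Restriction of scalars, quotient modules, prime ideals *)

(** Both [f^{-1}] and the tensor product are known only through universal properties, which describe
    maps out of [f^* F] and not its sections over [p]. These sections have to be detected by a
    morphism to a sheaf given by an explicit formula. An object [u] of the site need not map to [p],
    and the target [v] of a germ need not map to [q]; hence the formula is evaluated on [u x_X p],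
    where [f] and [gamma] supply an arrow to [q], and the coordinates of a germ are read off on
    [v x_Y q]. The assignment [u |-> E (u x_X p)] is the direct image of a sheaf [E] on the objects
    over [p]; that it is a sheaf requires covers to pull back to covers. For the coactions, the
    decisive fact is that [f1 : X_1 -> Y_1] lifts to an arrow [h1] of [Y] compatible with both
    projections: the second projection matches the canonical isomorphisms, the first one the
    structure maps. *)

Definition restr (A B : comPzRingType) (g : {rmorphism A -> B})
  (N : lmodType B) : Type := N.

Section RestrictionOfScalars.
Variables (A B : comPzRingType) (g : {rmorphism A -> B}) (N : lmodType B).
Notation restr := (restr g N).

HB.instance Definition _ := GRing.Zmodule.on restr.

(** The carrier is that of [N]; the alias keeps [g] in the type, so that the structure of [A]-module
    can be inferred from it. *)
Definition restr_scale (a : A) (n : restr) : restr := g a *: (n : N).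

Fact restr_scaleA a b n : restr_scale a (restr_scale b n) = restr_scale (a * b) n.
Proof. by rewrite /restr_scale scalerA rmorphM. Qed.
Fact restr_scale1 : left_id 1 restr_scale.
Proof. by move=> n; rewrite /restr_scale rmorph1 scale1r. Qed.
Fact restr_scaleDr : right_distributive restr_scale +%R.
Proof. by move=> a m n; apply: scalerDr. Qed.
Fact restr_scaleDl n : {morph restr_scale^~ n : a b / a + b}.
Proof. by move=> a b; rewrite /restr_scale rmorphD scalerDl. Qed.

HB.instance Definition _ :=
  GRing.Zmodule_isLmodule.Build A restr
    restr_scaleA restr_scale1 restr_scaleDr restr_scaleDl.

Lemma restrZ (a : A) (n : restr) : a *: n = (g a *: (n : N) : N).
Proof. by []. Qed.

End RestrictionOfScalars.

Record submodule (A : comPzRingType) (N : lmodType A) := Submodule {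
  smem :> N -> Prop;
  smem0 : smem 0;
  smemD : forall m n, smem m -> smem n -> smem (m + n);
  smemZ : forall a n, smem n -> smem (a *: n) }.

Section QuotientModule.
Variables (A : comPzRingType) (N : lmodType A) (K : submodule N).

Lemma smemN n : K n -> K (- n).
Proof. by rewrite -scaleN1r; apply: smemZ. Qed.

Definition qmod_eq (m n : N) : bool := `[< K (m - n) >].

Lemma qmod_eq_equiv : equiv_class_of qmod_eq.
Proof.
split=> [m|m n|n m k].
- by apply/asboolP; rewrite subrr; apply: smem0.
- by apply/asboolP/asboolP => /smemN; rewrite opprB.
- move=> /asboolP h /asboolP h'; apply/asboolP.
  by rewrite -(subrKA n); apply: smemD.
Qed.
Canonical qmod_eq_rel := EquivRelPack qmod_eq_equiv.

Definition qmod := {eq_quot qmod_eq_rel}.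
HB.instance Definition _ := Choice.on qmod.
HB.instance Definition _ := EqQuotient.on qmod.

Definition qclass (n : N) : qmod := \pi_qmod n.

Lemma qclass_eqP m n : qclass m = qclass n <-> K (m - n).
Proof.
split=> [/eqP|h]; first by rewrite eqmodE => /asboolP.
by apply/eqP; rewrite eqmodE; apply/asboolP.
Qed.

Lemma qclass_repr n : K (repr (qclass n) - n).
Proof. by apply/qclass_eqP; rewrite /qclass reprK. Qed.

Lemma qclassP (x : qmod) : exists n, x = qclass n.
Proof. by exists (repr x); rewrite /qclass reprK. Qed.

Definition qmod_add (x y : qmod) := qclass (repr x + repr y).
Definition qmod_opp (x : qmod) := qclass (- repr x).
Definition qmod_scale (a : A) (x : qmod) := qclass (a *: repr x).

Lemma qmod_addE m n : qmod_add (qclass m) (qclass n) = qclass (m + n).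
Proof.
by apply/qclass_eqP; rewrite opprD addrACA; apply: smemD; apply: qclass_repr.
Qed.
Lemma qmod_oppE n : qmod_opp (qclass n) = qclass (- n).
Proof. by apply/qclass_eqP; rewrite -opprD; apply/smemN/qclass_repr. Qed.
Lemma qmod_scaleE a n : qmod_scale a (qclass n) = qclass (a *: n).
Proof. by apply/qclass_eqP; rewrite -scalerBr; apply/smemZ/qclass_repr. Qed.

Fact qmod_addA : associative qmod_add.
Proof.
move=> x y z; have [[[m ->] [n ->]] [k ->]] := (qclassP x, qclassP y, qclassP z).
by rewrite !qmod_addE addrA.
Qed.
Fact qmod_addC : commutative qmod_add.
Proof.
by move=> x y; have [[m ->] [n ->]] := (qclassP x, qclassP y);
  rewrite !qmod_addE addrC.
Qed.
Fact qmod_add0 : left_id (qclass 0) qmod_add.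
Proof. by move=> x; have [m ->] := qclassP x; rewrite qmod_addE add0r. Qed.
Fact qmod_addN : left_inverse (qclass 0) qmod_opp qmod_add.
Proof.
by move=> x; have [m ->] := qclassP x; rewrite qmod_oppE qmod_addE addNr.
Qed.
HB.instance Definition _ :=
  GRing.isZmodule.Build qmod qmod_addA qmod_addC qmod_add0 qmod_addN.

Lemma qclassD : {morph qclass : m n / m + n}.
Proof. by move=> m n; rewrite [RHS]qmod_addE. Qed.

Fact qmod_scaleA a b x : qmod_scale a (qmod_scale b x) = qmod_scale (a * b) x.
Proof. by have [m ->] := qclassP x; rewrite !qmod_scaleE scalerA. Qed.
Fact qmod_scale1 : left_id 1 qmod_scale.
Proof. by move=> x; have [m ->] := qclassP x; rewrite qmod_scaleE scale1r. Qed.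
Fact qmod_scaleDr : right_distributive qmod_scale +%R.
Proof.
move=> a x y; have [[m ->] [n ->]] := (qclassP x, qclassP y).
by rewrite -qclassD !qmod_scaleE -qclassD scalerDr.
Qed.
Fact qmod_scaleDl x : {morph qmod_scale^~ x : a b / a + b}.
Proof.
move=> a b; have [m ->] := qclassP x.
by rewrite !qmod_scaleE -qclassD scalerDl.
Qed.
HB.instance Definition _ :=
  GRing.Zmodule_isLmodule.Build A qmod
    qmod_scaleA qmod_scale1 qmod_scaleDr qmod_scaleDl.

Lemma qclassZ a n : qclass (a *: n) = a *: qclass n.
Proof. by rewrite [RHS]qmod_scaleE. Qed.
Lemma qclass_eq0 n : qclass n = 0 <-> K n.
Proof. by rewrite (qclass_eqP n 0) subr0. Qed.

Section Lift.
Variables (P : lmodType A) (h : N -> P).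
Hypotheses (hD : {morph h : m n / m + n}) (hZ : forall a n, h (a *: n) = a *: h n)
  (hK : forall n, K n -> h n = 0).

Definition qmod_lift (x : qmod) : P := h (repr x).

Lemma qmod_liftE n : qmod_lift (qclass n) = h n.
Proof.
have := hK (qclass_repr n); rewrite -scaleN1r hD hZ scaleN1r => /eqP.
by rewrite subr_eq0 => /eqP.
Qed.
Lemma qmod_liftD : {morph qmod_lift : x y / x + y}.
Proof.
move=> x y; have [[m ->] [n ->]] := (qclassP x, qclassP y).
by rewrite -qclassD !qmod_liftE hD.
Qed.
Lemma qmod_liftZ a x : qmod_lift (a *: x) = a *: qmod_lift x.
Proof.
by have [m ->] := qclassP x; rewrite -qclassZ !qmod_liftE hZ.
Qed.
End Lift.

End QuotientModule.
Arguments qclass {A N} K n.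

Section PrimeIdeals.
Variable A : comPzRingType.

Definition prime_submodule (P : prime_ideal A) : submodule (A^o : lmodType A) :=
  @Submodule A A^o P (pideal0 P) (@pidealD _ P) (@pidealM _ P).

(** An ideal maximal among those that contain [I] and avoid the multiplicative set [D] is prime. *)
Lemma prime_ideal_avoiding (I : submodule (A^o : lmodType A)) (D : A -> Prop) :
  D 1 -> (forall a b, D a -> D b -> D (a * b)) -> (forall a, I a -> ~ D a) ->
  exists P : prime_ideal A, (forall a, I a -> P a) /\ forall a, D a -> ~ P a.
Proof.
move=> D1 DM ID.
(* Zorn's lemma is applied to sets [Z] whose union with [I] is an ideal, rather than to ideals
   containing [I]: the union of the empty chain is empty and must be admissible too. *)
pose ok (Z : set A) := [/\
  forall a b, Z a \/ I a -> Z b \/ I b -> Z (a + b) \/ I (a + b),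
  forall a b, Z b \/ I b -> Z (a * b) \/ I (a * b) & forall a, Z a -> ~ D a].
have [F Fok Ftot|Z [[ZD ZM ZN] Zmax]] := @Zorn_bigcup A ok.
  split=> [a b|a b [[G FG Gb]|Ib]|a [G FG Ga]].
  - move=> [[G FG Ga]|Ia] [[H FH Hb]|Ib].
    + have [GH|HG] := Ftot _ _ FG FH.
      * have [hD _ _] := Fok _ FH.
        by case: (hD _ _ (or_introl (GH _ Ga)) (or_introl Hb)); [left; exists H|right].
      * have [hD _ _] := Fok _ FG.
        by case: (hD _ _ (or_introl Ga) (or_introl (HG _ Hb))); [left; exists G|right].
    + have [hD _ _] := Fok _ FG.
      by case: (hD _ _ (or_introl Ga) (or_intror Ib)); [left; exists G|right].
    + have [hD _ _] := Fok _ FH.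
      by case: (hD _ _ (or_intror Ia) (or_introl Hb)); [left; exists H|right].
    + by right; apply: smemD.
  - have [_ hM _] := Fok _ FG.
    by case: (hM a _ (or_introl Gb)); [left; exists G|right].
  - by right; apply: (smemZ (s := I)).
  - by have [_ _ hN] := Fok _ FG; apply: hN.
pose J a := Z a \/ I a.
have JD a : J a -> ~ D a by case=> [/ZN|/ID].
have J0 : J 0 by right; apply: smem0.
(* By maximality, the ideal generated by [J] and an element outside [J] meets [D]. *)
have ext a : ~ J a -> exists d j r, [/\ D d, J j & d = j + r * a].
  move=> Ja; pose Z' : set A := fun x => exists j r, J j /\ x = j + r * a.
  have ZJ' x : J x -> Z' x by move=> Jx; exists x, 0; rewrite mul0r addr0.
  have IZ' x : Z' x \/ I x -> Z' x by case=> // Ix; apply: ZJ'; right.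
  apply: contrapT => nd; apply: (Zmax Z'); last split.
  - split=> [x Zx|h]; first by apply: ZJ'; left.
    by apply/Ja; left; apply: h; exists 0, 1; rewrite mul1r add0r.
  - move=> x y /IZ' [j [r [Jj ->]]] /IZ' [k [s [Jk ->]]]; left.
    by exists (j + k), (r + s); split; [apply: ZD|rewrite mulrDl addrACA].
  - move=> x y /IZ' [j [r [Jj ->]]]; left.
    by exists (x * j), (x * r); split; [apply: ZM|rewrite mulrDr mulrA].
  - by move=> d [j [r [Jj dE]]] Dd; apply: nd; exists d, j, r.
(* If [a] and [b] lie outside [J], multiply the two elements of [D] given by [ext]: every term of
   the product lies in [J] once [a * b] does. *)
have Jp a b : J (a * b) -> J a \/ J b.
  move=> Jab; case: (pselect (J a)) => Ja; first by left.
  right; apply: contrapT => Jb.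
  have [d [j [r [Dd Jj e]]]] := ext _ Ja; have [d' [k [s [Dd' Jk e']]]] := ext _ Jb.
  apply: (JD (d * d')) (DM _ _ Dd Dd').
  rewrite {1}e e' mulrDr; apply: (ZD _ _); first exact: (ZM _ _).
  rewrite mulrDl; apply: (ZD _ _); first by rewrite mulrC; apply: (ZM _ _).
  by rewrite mulrACA; apply: (ZM _ _).
have J1 : ~ J 1 by move=> /JD.
exists (PrimeIdeal J0 ZD ZM J1 Jp); split=> a ha; first by right.
by move=> /JD.
Qed.

End PrimeIdeals.

(** * Base change of modules *)

Lemma morphD0 (M N : zmodType) (h : M -> N) : {morph h : m n / m + n} -> h 0 = 0.
Proof. by move=> hD; apply: (addrI (h 0)); rewrite -hD !addr0. Qed.

Lemma morphDB (M N : zmodType) (h : M -> N) :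
  {morph h : m n / m + n} -> {morph h : m n / m - n}.
Proof. by move=> hD m n; apply: (addIr (h n)); rewrite -hD !subrK. Qed.

Lemma bct0 (A B : comPzRingType) (eta : {rmorphism A -> B}) (N : lmodType A) b :
  (bct b 0 : bc eta N) = 0.
Proof. by apply: (addrI (bct b 0)); rewrite -bctDr !addr0. Qed.

Section Change.
Variables (A B C : comPzRingType) (eta : {rmorphism A -> B}).
Variables (eta' : {rmorphism A -> C}) (N : lmodType A).

(** This is [rho] tensored with the identity of [N]. As [rho] is a bare function, pointwise equal
    ring morphisms can be exchanged by [funext]. *)
Definition bc_change (rho : B -> C) : bc eta N -> bc eta' N :=
  bc_ext (P := bc eta' N) rho (bct 1).

Variable rho : {rmorphism B -> C}.
Hypothesis rho_eta : forall a, rho (eta a) = eta' a.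

Let fD : {morph (bct 1 : N -> bc eta' N) : m n / m + n}.
Proof. exact: bctDr. Qed.
Let fZ a n : (bct 1 (a *: n) : bc eta' N) = rho (eta a) *: bct 1 n.
Proof. by rewrite bct1Z rho_eta. Qed.

Lemma bc_change_tens b n : bc_change rho (bct b n) = bct (rho b) n.
Proof. by rewrite /bc_change (bc_ext_tens fD fZ) bcZ mulr1. Qed.
Lemma bc_changeD : {morph bc_change rho : s t / s + t}.
Proof. exact: (bc_extD fD fZ). Qed.
Lemma bc_changeZ b t : bc_change rho (b *: t) = rho b *: bc_change rho t.
Proof. exact: (bc_extZ fD fZ). Qed.

End Change.
Arguments bc_change {A B C eta eta' N} rho t.

Lemma bc_change_comp (A B C D : comPzRingType) (eta : {rmorphism A -> B})
    (eta' : {rmorphism A -> C}) (eta'' : {rmorphism A -> D}) (N : lmodType A)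
    (rho : {rmorphism B -> C}) (rho' : {rmorphism C -> D})
    (rho'' : {rmorphism B -> D}) :
  (forall a, rho (eta a) = eta' a) -> (forall a, rho' (eta' a) = eta'' a) ->
  (forall b, rho'' b = rho' (rho b)) ->
  forall t : bc eta N,
  bc_change (eta' := eta'') rho'' t = bc_change rho' (bc_change (eta' := eta') rho t).
Proof.
move=> e e' e''; have f a : rho'' (eta a) = eta'' a by rewrite e'' e e'.
apply: bc_eq_ext => [s t|s t|b n].
- exact: bc_changeD.
- by rewrite (bc_changeD e) (bc_changeD e').
- by rewrite (bc_change_tens f) (bc_change_tens e) (bc_change_tens e') e''.
Qed.

Section Associativity.
Variables (A B C : comPzRingType) (phi : {rmorphism A -> B}).
Variables (psi : {rmorphism B -> C}) (tot : {rmorphism A -> C}).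
Hypothesis totE : forall a, tot a = psi (phi a).
Variable N : lmodType A.

(** With [bc_merge], the isomorphism between [C (x)_A N] and [C (x)_B (B (x)_A N)]. The composite
    [tot] is a separate morphism with a pointwise equation, because the ring map of a composite
    arrow is a composite only propositionally. *)
Definition bc_split : bc tot N -> bc psi (bc phi N) :=
  bc_ext (P := bc psi (bc phi N)) (@idfun C) (fun n => bct 1 (bct 1 n)).
Definition bc_merge : bc psi (bc phi N) -> bc tot N :=
  bc_ext (P := bc tot N) (@idfun C) (bc_change psi).

Let fD : {morph (fun n => bct 1 (bct 1 n) : bc psi (bc phi N)) : m n / m + n}.
Proof. by move=> m n; rewrite !bctDr. Qed.
Let fZ a n : (bct 1 (bct 1 (a *: n)) : bc psi (bc phi N))
  = (idfun (tot a)) *: bct 1 (bct 1 n).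
Proof. by rewrite !bct1Z totE. Qed.
Let totE' a : psi (phi a) = tot a.
Proof. by rewrite totE. Qed.
Let gZ b (t : bc phi N) : (bc_change psi (b *: t) : bc tot N)
  = (idfun (psi b)) *: bc_change psi t.
Proof. by rewrite (bc_changeZ totE'). Qed.

Lemma bc_split_tens c n : bc_split (bct c n) = bct c (bct 1 n).
Proof. by rewrite /bc_split (bc_ext_tens fD fZ) bcZ mulr1. Qed.
Lemma bc_splitD : {morph bc_split : s t / s + t}.
Proof. exact: (bc_extD fD fZ). Qed.
Lemma bc_merge_tens c t : bc_merge (bct c t) = c *: bc_change psi t.
Proof. exact: (bc_ext_tens (bc_changeD totE') gZ). Qed.
Lemma bc_mergeD : {morph bc_merge : s t / s + t}.
Proof. exact: (bc_extD (bc_changeD totE') gZ). Qed.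

Lemma bc_splitK : cancel bc_split bc_merge.
Proof.
apply: bc_eq_ext => [s t|//|c n]; first by rewrite bc_splitD bc_mergeD.
by rewrite bc_split_tens bc_merge_tens (bc_change_tens totE') rmorph1 bcZ mulr1.
Qed.

Lemma bc_mergeK : cancel bc_merge bc_split.
Proof.
apply: bc_eq_ext => [s t|//|c t]; first by rewrite bc_mergeD bc_splitD.
rewrite bc_merge_tens; move: t; apply: bc_eq_ext => [s t|s t|b n].
- by rewrite (bc_changeD totE') scalerDr bc_splitD.
- by rewrite bctDr.
- rewrite (bc_change_tens totE') bcZ bc_split_tens.
  by rewrite bctA bcZ mulr1.
Qed.

End Associativity.
Arguments bc_split {A B C} phi psi {tot N} _.
Arguments bc_merge {A B C phi psi} tot {N} _.

Section RingTensorFold.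
Variables (R A B R' : comPzRingType).
Variables (f : {rmorphism R -> A}) (g : {rmorphism R -> B}).
Variables (eta : {rmorphism R' -> rtens f g}) (N : lmodType R').
Variables (Z : zmodType) (Phi : A -> B -> N -> Z).
Hypotheses (PhiDl : forall a a' b n, Phi (a + a') b n = Phi a b n + Phi a' b n)
  (PhiDm : forall a b b' n, Phi a (b + b') n = Phi a b n + Phi a b' n)
  (PhiDr : forall a b n n', Phi a b (n + n') = Phi a b n + Phi a b n')
  (PhiA : forall r a b n, Phi (a * f r) b n = Phi a (g r * b) n).

(** Maps out of [(A (x)_R B) (x)_{R'} N] are given by functions of three variables: the ring tensor
    is eliminated with [n] fixed, then the outer tensor. *)
Definition rt_fold1 (n : N) (t : rtens f g) : Z :=
  balt_sum (fun a b => Phi a b n) t.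
Definition rt_fold (x : bc eta N) : Z := balt_sum (fun t n => rt_fold1 n t) x.

Let bal n : balanced (fun (r : R) (a : A) => a * f r)
  (fun (r : R) (b : B) => g r * b) (fun a b => Phi a b n).
Proof. by split=> *. Qed.

Lemma rt_fold1_tens n a b : rt_fold1 n (rt a b) = Phi a b n.
Proof. exact: balt_sum_tens (bal n). Qed.
Lemma rt_fold1D n : {morph rt_fold1 n : s t / s + t}.
Proof. by move=> s t; apply: balt_sumD (bal n). Qed.

(** [eta r] need not be a pure tensor, so balancedness over [R'] is expressed through [rt_fold1]. *)
Hypothesis Phi_eta : forall r a b n,
  rt_fold1 n (rt a b * eta r) = Phi a b (r *: n).

Let bal2 : balanced (fun (r : R') (t : rtens f g) => t * eta r)
  (fun r (n : N) => r *: n) (fun t n => rt_fold1 n t).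
Proof.
split=> [s t n|t m n|r t n]; first exact: rt_fold1D.
- move: t; apply: rt_eq_ext => [s t|s t|a b]; rewrite ?rt_fold1_tens ?rt_fold1D //.
  by rewrite addrACA.
- move: t; apply: rt_eq_ext => [s t|s t|a b]; rewrite ?rt_fold1_tens ?Phi_eta //.
    by rewrite mulrDl rt_fold1D.
  exact: rt_fold1D.
Qed.

Lemma rt_fold_tens t n : rt_fold (bct t n) = rt_fold1 n t.
Proof. exact: balt_sum_tens bal2. Qed.
Lemma rt_foldD : {morph rt_fold : s t / s + t}.
Proof. by move=> s t; apply: balt_sumD bal2. Qed.

End RingTensorFold.

Section Pushouts.
Variables (R A B P : comPzRingType).
Variables (f : {rmorphism R -> A}) (g : {rmorphism R -> B}).
Variables (i : {rmorphism A -> P}) (j : {rmorphism B -> P}).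

(** Fibre products in a stack determine their rings only up to isomorphism, whence a universal
    property instead of the ring [rtens f g] itself. *)
Definition is_pushout : Prop :=
  (forall r, i (f r) = j (g r)) /\
  forall (C : comPzRingType) (h : {rmorphism A -> C}) (k : {rmorphism B -> C}),
    (forall r, h (f r) = k (g r)) ->
    exists! theta : {rmorphism P -> C},
      (forall a, theta (i a) = h a) /\ (forall b, theta (j b) = k b).

End Pushouts.

Section RingTensorExt.
Variables (R A B C : comPzRingType).
Variables (f : {rmorphism R -> A}) (g : {rmorphism R -> B}).
Variables (h : {rmorphism A -> C}) (k : {rmorphism B -> C}).
Hypothesis hk : forall r, h (f r) = k (g r).

Definition rt_ext_fun (t : rtens f g) : C := rt_ext h k t.
Fact rt_ext_zmod : zmod_morphism rt_ext_fun.
Proof. exact: morphDB (rt_extD hk). Qed.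
Fact rt_ext_monoid : monoid_morphism rt_ext_fun.
Proof.
split; last exact: rt_extM.
by rewrite /rt_ext_fun [1]/(rt 1 1) rt_ext_tens // !rmorph1 mulr1.
Qed.
Definition rt_ext_rmorph : {rmorphism rtens f g -> C} :=
  HB.pack rt_ext_fun (GRing.isZmodMorphism.Build _ _ rt_ext_fun rt_ext_zmod)
    (GRing.isMonoidMorphism.Build _ _ rt_ext_fun rt_ext_monoid).
Lemma rt_ext_inl a : rt_ext_rmorph (rt_inl a) = h a.
Proof. by rewrite /= /rt_ext_fun rt_ext_tens // rmorph1 mulr1. Qed.
Lemma rt_ext_inr b : rt_ext_rmorph (rt_inr b) = k b.
Proof. by rewrite /= /rt_ext_fun rt_ext_tens // rmorph1 mul1r. Qed.
End RingTensorExt.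

(** * Flatness and faithfulness *)

Lemma flatP (A B : comPzRingType) (phi : {rmorphism A -> B}) : flat phi <->
  forall (N N' : lmodType A) (h : N -> N'), {morph h : m n / m + n} ->
    (forall a n, h (a *: n) = a *: h n) -> injective h -> injective (bc_map phi h).
Proof.
split=> [fl N N' h hD hZ hi|fl N N' h hi]; last first.
  by apply: fl => // [m n|a n]; rewrite ?linearD ?linearZ.
have hl : linear h by move=> a m n; rewrite hD hZ.
pose h' : {linear N -> N'} := HB.pack h (GRing.isLinear.Build A N N' _ h hl).
exact: (fl N N' h').
Qed.

Lemma flat_comp (A B C : comPzRingType) (phi : {rmorphism A -> B})
    (psi : {rmorphism B -> C}) (tot : {rmorphism A -> C}) :
  (forall a, tot a = psi (phi a)) -> flat phi -> flat psi -> flat tot.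
Proof.
move=> e /flatP fphi /flatP fpsi; apply/flatP => N N' h hD hZ hi.
have kD := bc_mapD (eta := phi) hD hZ; have kZ := bc_mapZ (eta := phi) hD hZ.
have sq t : bc_split phi psi (bc_map tot h t)
    = bc_map psi (bc_map phi h) (bc_split phi psi t).
  move: t; apply: bc_eq_ext => [s t|s t|c n].
  - by rewrite (bc_mapD hD hZ) (bc_splitD e).
  - by rewrite (bc_splitD e) (bc_mapD kD kZ).
  - rewrite (bc_map_tens _ hD hZ) !(bc_split_tens e) (bc_map_tens _ kD kZ).
    by rewrite (bc_map_tens _ hD hZ).
move=> s t /(congr1 (bc_split phi psi)); rewrite !sq.
move=> /(fpsi _ _ _ kD kZ (fphi _ _ _ hD hZ hi)).
exact: (can_inj (@bc_splitK _ _ _ _ _ _ e N)).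
Qed.

Section FlatBaseChange.
Variables (R A B : comPzRingType) (f : {rmorphism R -> A}) (g : {rmorphism R -> B}).

(** [(A (x)_R B) (x)_B N -> A (x)_R N], [(a (x) b) (x) n |-> a (x) b n]. *)
Definition bc_cancel (N : lmodType B) :
    bc (rt_inr : {rmorphism B -> rtens f g}) N -> bc f (restr g N) :=
  rt_fold (fun a b (n : N) => bct a (b *: n : restr g N) : bc f (restr g N)).

Section One.
Variable N : lmodType B.

Let Phi (a : A) (b : B) (n : N) : bc f (restr g N) := bct a (b *: n : restr g N).
Let PhiDl a a' b n : Phi (a + a') b n = Phi a b n + Phi a' b n.
Proof. exact: bctDl. Qed.
Let PhiDm a b b' n : Phi a (b + b') n = Phi a b n + Phi a b' n.
Proof. by rewrite /Phi scalerDl; apply: bctDr. Qed.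
Let PhiDr a b n n' : Phi a b (n + n') = Phi a b n + Phi a b n'.
Proof. by rewrite /Phi scalerDr; apply: bctDr. Qed.
Let PhiA r a b n : Phi (a * f r) b n = Phi a (g r * b) n.
Proof. by rewrite /Phi bctA restrZ scalerA. Qed.
Let Phi_eta b' a b n :
  rt_fold1 Phi n (rt a b * rt_inr b' : rtens f g) = Phi a b (b' *: n).
Proof.
by rewrite /rt_inr rtM mulr1 (rt_fold1_tens PhiDl PhiDm PhiA) /Phi scalerA.
Qed.

Lemma bc_cancel_tens a b n :
  bc_cancel (bct (rt a b) n) = bct a (b *: n : restr g N).
Proof.
rewrite /bc_cancel (rt_fold_tens (Phi := Phi) PhiDl PhiDm PhiDr PhiA Phi_eta).
by rewrite (rt_fold1_tens PhiDl PhiDm PhiA).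
Qed.
Lemma bc_cancelD : {morph @bc_cancel N : s t / s + t}.
Proof. exact: (rt_foldD (Phi := Phi) PhiDl PhiDm PhiDr PhiA Phi_eta). Qed.

Lemma bc_cancel_ext (Z : zmodType)
    (h k : bc (rt_inr : {rmorphism B -> rtens f g}) N -> Z) :
  {morph h : s t / s + t} -> {morph k : s t / s + t} ->
  (forall a b n, h (bct (rt a b) n) = k (bct (rt a b) n)) -> h =1 k.
Proof.
move=> hD kD e; apply: bc_eq_ext => // t n; move: t.
by apply: rt_eq_ext => [s t|s t|a b] //=; rewrite bctDl ?hD ?kD.
Qed.

Let inl1 : N -> bc (rt_inr : {rmorphism B -> rtens f g}) N := bct 1.
Let inlD : {morph (inl1 : restr g N -> _) : m n / m + n}.
Proof. by move=> m n; apply: (@bctDr _ _ _ N). Qed.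
Let inlZ r (n : restr g N) :
  inl1 (r *: n) = (rt_inl (f r) : rtens f g) *: inl1 n.
Proof. by rewrite /inl1 restrZ bct1Z rt_glue. Qed.

Lemma bc_cancel_inj : injective (@bc_cancel N).
Proof.
pose back : bc f (restr g N) -> bc rt_inr N := bc_ext (P := bc (rt_inr : {rmorphism B -> rtens f g}) N)
   (rt_inl : A -> rtens f g) (inl1 : restr g N -> _).
apply: (can_inj (g := back)); apply: bc_cancel_ext => // [s t|a b n].
  by rewrite bc_cancelD /back (bc_extD inlD inlZ).
rewrite bc_cancel_tens /back (bc_ext_tens inlD inlZ) /inl1.
by rewrite bct1Z scalerA bcZ mulr1 rtE.
Qed.
End One.

(** By [bc_cancel], base change of [N] along [rt_inr] embeds, naturally in [N], into base change
    along [f] of the restriction of [N] to [R]. *)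
Lemma flat_rt_inr : flat f -> flat (rt_inr : {rmorphism B -> rtens f g}).
Proof.
move=> /flatP ff; apply/flatP => N N' h hD hZ hi.
pose h' : restr g N -> restr g N' := h.
have hD' : {morph h' : m n / m + n} by exact: hD.
have hZ' r n : h' (r *: n) = r *: h' n by rewrite /h' restrZ hZ.
have sq t : bc_cancel (bc_map rt_inr h t) = bc_map f h' (bc_cancel t).
  move: t; apply: bc_cancel_ext => [s t|s t|a b n].
  - by rewrite (bc_mapD hD hZ) bc_cancelD.
  - by rewrite bc_cancelD (bc_mapD hD' hZ').
  - by rewrite (bc_map_tens _ hD hZ) !bc_cancel_tens (bc_map_tens _ hD' hZ') /h' hZ.
move=> s t /(congr1 (@bc_cancel _)); rewrite !sq => /(ff _ _ _ hD' hZ' hi).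
exact: bc_cancel_inj.
Qed.

(** The map [th] from [P] to [rtens f g] has the left inverse [back], so base change along [j]
    embeds naturally into base change along [rt_inr]. *)
Lemma pushout_flat (P : comPzRingType) (i : {rmorphism A -> P})
    (j : {rmorphism B -> P}) : is_pushout f g i j -> flat f -> flat j.
Proof.
move=> [ij univ] /flat_rt_inr /flatP fl; apply/flatP => N N' h hD hZ hi.
have [th [[thl thr] _]] := univ _ rt_inl rt_inr (rt_glue f g).
pose back := rt_ext_rmorph ij.
have e b : th (j b) = rt_inr b by rewrite thr.
have e' b : back (rt_inr b) = j b by rewrite /back rt_ext_inr.
have thK p : back (th p) = p.
  have [x [_ xu]] := univ _ i j ij.
  transitivity (x p); last by rewrite (xu (@idfun P)).
  rewrite (xu (back \o th : {rmorphism P -> P})) //; split=> b.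
    by rewrite -[LHS]/(back (th (i b))) thl /back rt_ext_inl.
  by rewrite -[LHS]/(back (th (j b))) thr /back rt_ext_inr.
have sq t : bc_change (eta' := rt_inr) th (bc_map j h t)
    = bc_map rt_inr h (bc_change th t).
  move: t; apply: bc_eq_ext => [s t|s t|b n].
  - by rewrite (bc_mapD hD hZ) (bc_changeD e).
  - by rewrite (bc_changeD e) (bc_mapD hD hZ).
  - by rewrite (bc_map_tens _ hD hZ) !(bc_change_tens e) (bc_map_tens _ hD hZ).
have ci : injective
    (bc_change (eta := j) (eta' := (rt_inr : {rmorphism B -> rtens f g})) (N := N) th).
  apply: (@can_inj _ _ _ (bc_change back)).
  apply: bc_eq_ext => [s t|//|p n].
    by rewrite (bc_changeD e) (bc_changeD e').
  by rewrite (bc_change_tens e) (bc_change_tens e') thK.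
move=> s t /(congr1 (bc_change (eta' := rt_inr) th)); rewrite !sq.
by move=> /(fl _ _ _ hD hZ hi) /ci.
Qed.

End FlatBaseChange.

(** * Faithful families of ring maps and surjectivity on spectra *)

Section Annihilator.
Variables (A : comPzRingType) (N : lmodType A) (x : N).

Definition annihilator : submodule (A^o : lmodType A).
Proof.
exists (fun a : A^o => (a : A) *: x = 0); first by rewrite scale0r.
- by move=> a b ea eb; rewrite scalerDl ea eb addr0.
- by move=> a b eb; rewrite -scalerA eb scaler0.
Defined.

Lemma annihilator_inj : injective (qmod_lift (K := annihilator) (fun a : A^o => (a : A) *: x)).
Proof.
have D : {morph (fun a : A^o => (a : A) *: x) : a b / a + b}.
  by move=> a b; rewrite scalerDl.
have Z (a : A) (b : A^o) : ((a *: b : A^o) : A) *: x = a *: ((b : A) *: x).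
  by rewrite scalerA.
move=> s t; have [[a ->] [b ->]] := (qclassP s, qclassP t).
rewrite !(qmod_liftE D Z) // => e; apply/qclass_eqP => /=.
by rewrite scalerBl e subrr.
Qed.
End Annihilator.

Section FaithfullyFlatCover.
Variables (A : comPzRingType) (n : nat) (B : 'I_n -> comPzRingType).
Variable phi : forall i, {rmorphism A -> B i}.

(** This is injectivity of the map from [N] to the product of the [B i (x) N], for all [N]. Unlike
    joint surjectivity on spectra, it passes to base changes directly, and it is the form that
    descent consumes. *)
Definition faithful_family : Prop := forall (N : lmodType A) (x : N),
  (forall i, (bct 1 x : bc (phi i) N) = 0) -> x = 0.

(** If [x] is nonzero, its annihilator [I] lies in a prime [P], the contraction of a prime [Q] of
    some [B i]. By flatness [B i (x) A/I] embeds in [B i (x) N], with [1 (x) 1] going to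
    [1 (x) x = 0]; but [B i (x) A/I] also maps to [B i / Q], where [1 (x) 1] becomes the nonzero
    class of [1]. *)
Lemma cover_faithful :
  (forall i, flat (phi i)) -> jointly_surjective phi -> faithful_family.
Proof.
move=> fl js N x hx; pose I := annihilator x.
suff : I 1 by rewrite /= scale1r.
apply: contrapT => I1; have [| | |P [IP _]] := @prime_ideal_avoiding A I (eq 1).
- by [].
- by move=> a b <- <-; rewrite mulr1.
- by move=> a Ia e; apply: I1; rewrite e.
have [i [Q PQ]] := js P.
have D : {morph (fun a : A^o => (a : A) *: x) : a b / a + b}.
  by move=> a b; rewrite scalerDl.
have Z (a : A) (b : A^o) : ((a *: b : A^o) : A) *: x = a *: ((b : A) *: x).
  by rewrite scalerA.
have K a : I a -> (a : A) *: x = 0 by [].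
have hD := qmod_liftD (K := I) D Z K; have hZ := qmod_liftZ (K := I) D Z K.
have one0 : (bct 1 (qclass I 1) : bc (phi i) (qmod I)) = 0.
  have inj := proj1 (flatP (phi i)) (fl i) _ _ _ hD hZ (@annihilator_inj _ _ x).
  apply: inj.
  rewrite (bc_map_tens _ hD hZ) (qmod_liftE (K := I) D Z K) scale1r hx.
  by rewrite (morphD0 (bc_mapD hD hZ)).
pose T : lmodType (B i) := qmod (prime_submodule Q).
pose k0 (a : A^o) : restr (phi i) T := qclass (prime_submodule Q) (phi i a).
have k0D : {morph k0 : a b / a + b} by move=> a b; rewrite /k0 rmorphD qclassD.
have k0Z a b : k0 (a *: b) = a *: k0 b.
  by rewrite /k0 rmorphM restrZ -qclassZ.
have k0K a : I a -> k0 a = 0 by move=> Ia; apply/qclass_eq0/PQ/IP.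
pose k : qmod I -> T := qmod_lift k0.
have kD : {morph k : y z / y + z} := qmod_liftD (K := I) k0D k0Z k0K.
have kZ a y : k (a *: y) = idfun (phi i a) *: k y.
  exact: (qmod_liftZ (K := I) k0D k0Z k0K).
have := congr1 (bc_ext (P := T) (@idfun (B i)) k) one0.
rewrite (bc_ext_tens kD kZ) /k (qmod_liftE (K := I) k0D k0Z k0K) scale1r.
rewrite (morphD0 (bc_extD kD kZ)) /k0 rmorph1.
by move=> /qclass_eq0 /(pideal1 (p := Q)).
Qed.

(** For a prime [P] of [A], the primes of [B i] above [P] are those containing
    the annihilator of [1 (x) 1] in [B i (x) A/P] and avoiding the image of the
    complement of [P]. *)
Lemma faithful_surjective : faithful_family -> jointly_surjective phi.
Proof.
move=> ff P; pose N : lmodType A := qmod (prime_submodule P).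
pose one i : bc (phi i) N := bct 1 (qclass (prime_submodule P) 1).
apply: contrapT => nQ.
have ex i : exists d, ~ P d /\ phi i d *: one i = 0.
  apply: contrapT => nd; apply: nQ; exists i.
  have [| | |Q [IQ DQ]] := @prime_ideal_avoiding (B i) (annihilator (one i))
      (fun b => exists2 d, ~ P d & b = phi i d).
  - by exists 1; rewrite ?rmorph1 //; apply: pideal1.
  - move=> _ _ [d Pd ->] [d' Pd' ->]; exists (d * d'); rewrite ?rmorphM //.
    by move=> /(pideal_prime (p := P)) [].
  - by move=> a da [d Pd e]; apply: nd; exists d; split=> //; rewrite -e.
  exists Q => a; split=> [Pa|Qa].
    by apply: IQ; rewrite /= /one -bct1Z -qclassZ (proj2 (qclass_eq0 _ _)) ?bct0 //=
      -[_ *: _]/(a * 1) mulr1.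
  by apply: contrapT => Pa; apply: (DQ (phi i a)); first by exists a.
(* The product of the [d i] lies outside [P], yet kills [1 (x) 1] for every [i]; by faithfulness its
   class in [A/P] vanishes, a contradiction. *)
have [d dE] := choice ex.
have Pd : ~ P (\prod_i d i).
  apply: (big_ind (fun x => ~ P x)) => [|x y Px Py|i _]; first exact: pideal1.
    by move=> /(pideal_prime (p := P)) [].
  by have [] := dE i.
apply: Pd; apply/(qclass_eq0 (prime_submodule P))/ff => i.
have -> : qclass (prime_submodule P) (\prod_i d i) = (\prod_i d i) *: (qclass (prime_submodule P) 1 : N).
  by rewrite -qclassZ; congr qclass; apply: esym (mulr1 _).
rewrite bct1Z (bigD1 i) //= mulrC rmorphM -scalerA.
by rewrite (proj2 (dE i)) scaler0.
Qed.

(** Restrict [N] to [A]: the module [P i (x)_{A'} N] maps to [B i (x)_A N] with [1 (x) x] going to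
    [1 (x) x], so faithfulness over [A] applies. *)
Lemma faithful_base_change (A' : comPzRingType) (g : {rmorphism A -> A'})
    (P : 'I_n -> comPzRingType) (k : forall i, {rmorphism B i -> P i})
    (j : forall i, {rmorphism A' -> P i}) :
  (forall i, is_pushout (phi i) g (k i) (j i)) -> faithful_family ->
  forall (N : lmodType A') (x : N), (forall i, (bct 1 x : bc (j i) N) = 0) -> x = 0.
Proof.
move=> po ff N x hx; apply: (ff (restr g N)) => i.
have [_ univ] := po i.
have [th [[_ thr] _]] := univ _ rt_inl rt_inr (rt_glue (phi i) g).
have := congr1 (fun t => bc_cancel (bc_change (eta' := rt_inr) th t)) (hx i).
rewrite /= (bc_change_tens thr) rmorph1 -[1]/(rt 1 1) bc_cancel_tens scale1r => ->.
by rewrite (morphD0 (bc_changeD thr)) (morphD0 (@bc_cancelD _ _ _ _ _ _)).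
Qed.

End FaithfullyFlatCover.

(** * Faithfully flat descent *)

Section FiniteProduct.
Variables (A : comPzRingType) (n : nat) (M : 'I_n -> lmodType A).

Definition mprod : Type := forall i, M i.
HB.instance Definition _ := gen_eqMixin mprod.
HB.instance Definition _ := gen_choiceMixin mprod.

Definition mprod_add (x y : mprod) : mprod := fun i => x i + y i.
Definition mprod_opp (x : mprod) : mprod := fun i => - x i.
Definition mprod_scale (a : A) (x : mprod) : mprod := fun i => a *: x i.
Definition mprod_zero : mprod := fun=> 0.

Lemma mprod_ext (x y : mprod) : (forall i, x i = y i) -> x = y.
Proof. exact: functional_extensionality_dep. Qed.

Fact mprod_addA : associative mprod_add.
Proof. by move=> x y z; apply: mprod_ext => i; apply: addrA. Qed.
Fact mprod_addC : commutative mprod_add.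
Proof. by move=> x y; apply: mprod_ext => i; apply: addrC. Qed.
Fact mprod_add0 : left_id mprod_zero mprod_add.
Proof. by move=> x; apply: mprod_ext => i; apply: add0r. Qed.
Fact mprod_addN : left_inverse mprod_zero mprod_opp mprod_add.
Proof. by move=> x; apply: mprod_ext => i; apply: addNr. Qed.
HB.instance Definition _ :=
  GRing.isZmodule.Build mprod mprod_addA mprod_addC mprod_add0 mprod_addN.

Fact mprod_scaleA a b x : mprod_scale a (mprod_scale b x) = mprod_scale (a * b) x.
Proof. by apply: mprod_ext => i; apply: scalerA. Qed.
Fact mprod_scale1 : left_id 1 mprod_scale.
Proof. by move=> x; apply: mprod_ext => i; apply: scale1r. Qed.
Fact mprod_scaleDr : right_distributive mprod_scale +%R.
Proof. by move=> a x y; apply: mprod_ext => i; apply: scalerDr. Qed.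
Fact mprod_scaleDl x : {morph mprod_scale^~ x : a b / a + b}.
Proof. by move=> a b; apply: mprod_ext => i; apply: scalerDl. Qed.
HB.instance Definition _ :=
  GRing.Zmodule_isLmodule.Build A mprod
    mprod_scaleA mprod_scale1 mprod_scaleDr mprod_scaleDl.

Lemma mprodD (x y : mprod) i : (x + y) i = x i + y i. Proof. by []. Qed.
Lemma mprodZ a (x : mprod) i : (a *: x) i = a *: x i. Proof. by []. Qed.
Lemma mprod0 i : (0 : mprod) i = 0. Proof. by []. Qed.
Lemma mprod_sum (I : finType) (F : I -> mprod) i :
  (\sum_k F k) i = \sum_k F k i.
Proof. exact: (big_morph (fun x : mprod => x i) (fun x y => mprodD x y i)). Qed.

Definition mprod_in i (m : M i) : mprod :=
  dfwith (T := fun k => M k) (fun=> 0) m.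

Lemma mprod_inE (x : mprod) : x = \sum_i mprod_in (x i).
Proof.
apply: mprod_ext => i; rewrite mprod_sum (bigD1 i) //= /mprod_in dfwith_in.
by rewrite big1 ?addr0 // => k ki; rewrite dfwith_out.
Qed.

Lemma mprod_inD i : {morph @mprod_in i : m m' / m + m'}.
Proof.
move=> m m'; apply: mprod_ext => k; rewrite mprodD /mprod_in.
have [e|ik] := eqVneq i k; first by case: k / e; rewrite !dfwith_in.
by rewrite !dfwith_out // addr0.
Qed.

Lemma mprod_inZ i a (m : M i) : mprod_in (a *: m) = a *: mprod_in m.
Proof.
apply: mprod_ext => k; rewrite mprodZ /mprod_in.
have [e|ik] := eqVneq i k; first by case: k / e; rewrite !dfwith_in.
by rewrite !dfwith_out // scaler0.
Qed.

End FiniteProduct.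

Section Descent.
Variables (A : comPzRingType) (n : nat) (B : 'I_n -> comPzRingType).
Variable phi : forall i, {rmorphism A -> B i}.
Hypothesis ff : faithful_family phi.
Variable N : lmodType A.

Let M i : lmodType A := restr (phi i) (bc (phi i) N).
Let P : lmodType A := mprod M.
Let iota (x : N) : P := fun i => bct 1 x.
Let iotaD : {morph iota : x y / x + y}.
Proof. by move=> x y; apply: mprod_ext => i; apply: bctDr. Qed.
Let iotaZ a x : iota (a *: x) = a *: iota x.
Proof. by apply: mprod_ext => i; rewrite mprodZ restrZ; apply: bct1Z. Qed.

Let diagonal : submodule P.
Proof.
exists (fun y => exists x, y = iota x).
- by exists 0; apply: mprod_ext => i; rewrite mprod0 /iota bct0.
- by move=> y z [x ->] [x' ->]; exists (x + x'); rewrite iotaD.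
- by move=> a y [x ->]; exists (a *: x); rewrite iotaZ.
Defined.
Let Q : lmodType A := qmod diagonal.
Let class i (m : M i) : Q := qclass diagonal (mprod_in m).

Let classD i : {morph @class i : m m' / m + m'}.
Proof. by move=> m m'; rewrite /class mprod_inD qclassD. Qed.
Let classZ i a m : @class i (a *: m) = a *: class m.
Proof. by rewrite /class mprod_inZ qclassZ. Qed.

Section Pair.
Variables j i : 'I_n.
(** Folded, this is the map [B j (x) B i (x) N -> B j (x) Q] which tensors the identity of [B j]
    with the class in [Q] of the [i]-th component. *)
Definition descent_map (b : B j) (b' : B i) (x : N) : bc (phi j) Q :=
  bct b (class (bct b' x : M i)).
Notation tot f := (f \o phi _ : {rmorphism A -> rtens (phi j) (phi i)}).
Let PhiDl a a' b x :
  descent_map (a + a') b x = descent_map a b x + descent_map a' b x.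
Proof. exact: bctDl. Qed.
Let PhiDm a b b' x :
  descent_map a (b + b') x = descent_map a b x + descent_map a b' x.
Proof. by rewrite /descent_map bctDl classD bctDr. Qed.
Let PhiDr a b x y :
  descent_map a b (x + y) = descent_map a b x + descent_map a b y.
Proof. by rewrite /descent_map bctDr classD bctDr. Qed.
Let PhiA r a b x : descent_map (a * phi j r) b x = descent_map a (phi i r * b) x.
Proof. by rewrite /descent_map bctA -classZ restrZ bcZ. Qed.
Let Phi_eta r a b x :
  rt_fold1 descent_map x (rt a b * tot rt_inl r) = descent_map a b (r *: x).
Proof.
rewrite /rt_inl /= rtM mulr1 (rt_fold1_tens PhiDl PhiDm PhiA) PhiA.
by rewrite /descent_map mulrC bctA.
Qed.
Definition descent_fold : bc (tot rt_inl) N -> bc (phi j) Q := rt_fold descent_map.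
Lemma descent_foldD : {morph descent_fold : s t / s + t}.
Proof. exact: (rt_foldD PhiDl PhiDm PhiDr PhiA Phi_eta). Qed.
Lemma descent_fold_tens b b' x :
  descent_fold (bct (rt b b') x) = bct b (class (bct b' x : M i)).
Proof.
rewrite /descent_fold (rt_fold_tens PhiDl PhiDm PhiDr PhiA Phi_eta).
by rewrite (rt_fold1_tens PhiDl PhiDm PhiA).
Qed.
Let inl_eta a : rt_inl (phi j a) = tot rt_inl a. Proof. by []. Qed.
Let inr_eta a : rt_inr (phi i a) = tot rt_inl a. Proof. exact/esym/rt_glue. Qed.

Lemma descent_fold_inr (m : bc (phi i) N) :
  descent_fold (bc_change rt_inr m) = bct 1 (class (m : M i)).
Proof.
move: m; apply: bc_eq_ext => [s t|s t|b x].
- by rewrite (bc_changeD inr_eta) descent_foldD.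
- by rewrite classD bctDr.
- by rewrite (bc_change_tens inr_eta) descent_fold_tens.
Qed.
Lemma descent_fold_inl b x :
  descent_fold (bc_change rt_inl (bct b x : bc (phi j) N))
  = bct b (class (bct 1 x : M i)).
Proof. by rewrite (bc_change_tens inl_eta) descent_fold_tens. Qed.
Lemma descent_fold_inlD :
  {morph (fun m : bc (phi j) N => descent_fold (bc_change rt_inl m)) : s t / s + t}.
Proof. by move=> s t; rewrite (bc_changeD inl_eta) descent_foldD. Qed.
End Pair.

(** In [P], the product of the [B i (x) N], let [Q] be the cokernel of
    [iota : N -> P]. The class of [m] in [Q] becomes, in [B j (x) Q], the image of
    [m j] under [id (x) (class of iota) = 0]; so it vanishes by faithfulness. *)
Lemma flat_descent (m : forall i, bc (phi i) N) :
  (forall i j, bc_change rt_inl (m i) = bc_change rt_inr (m j)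
     :> bc (rt_inl \o phi i : {rmorphism A -> rtens (phi i) (phi j)}) N) ->
  exists! x : N, forall i, bct 1 x = m i.
Proof.
move=> mE; have [y yE] : diagonal (m : P).
  apply/qclass_eq0/ff => j.
  rewrite (mprod_inE (m : P)) (big_morph _ (qclassD diagonal) (erefl _)).
  have bD : {morph (bct 1 : Q -> bc (phi j) Q) : s t / s + t} by apply: bctDr.
  rewrite (big_morph _ bD (bct0 _ _ _)).
  (* The class of the [i]-th component is read off from [m i] extended to [B j (x) B i]. The gluing
     condition replaces [m i] by [m j] there, so that only [m j] remains, and additivity reduces to
     [m j = b (x) x]. *)
  transitivity (\sum_i descent_fold (bc_change rt_inl (m j)
      : bc (rt_inl \o phi j : {rmorphism A -> rtens (phi j) (phi i)}) N)).
    by apply: eq_bigr => i _; rewrite mE descent_fold_inr.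
  move: (m j); apply: bc_eq_ext => [s t|s t|b x].
  - by rewrite -big_split; apply: eq_bigr => i _; apply: descent_fold_inlD.
  - by rewrite addr0.
  - transitivity (bct b (qclass diagonal (iota x)) : bc (phi j) Q).
      rewrite (mprod_inE (iota x)) (big_morph _ (qclassD diagonal) (erefl _)).
      have cD : {morph (bct b : Q -> bc (phi j) Q) : s t / s + t} by apply: bctDr.
      rewrite (big_morph _ cD (bct0 _ _ _)).
      by apply: eq_bigr => i _; rewrite descent_fold_inl.
    by rewrite (proj2 (qclass_eq0 _ _)) ?bct0 //; exists x.
exists y; split=> [i|z zE]; first by rewrite yE.
apply/eqP; rewrite -subr_eq0; apply/eqP/ff => i.
by apply: (addIr (bct 1 z)); rewrite -bctDr subrK add0r zE yE.
Qed.

End Descent.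

(** * Finite presentation *)

Fixpoint pexp_bind (A A' : comPzRingType) n n' (k : A -> pexp A' n')
    (v : 'I_n -> pexp A' n') (e : pexp A n) : pexp A' n' :=
  match e with
  | PVar i => v i
  | PConst a => k a
  | PAdd e1 e2 => PAdd (pexp_bind k v e1) (pexp_bind k v e2)
  | PMul e1 e2 => PMul (pexp_bind k v e1) (pexp_bind k v e2)
  end.

Lemma peval_bind (A A' C : comPzRingType) n n' (k : A -> pexp A' n')
    (v : 'I_n -> pexp A' n') (psi : A' -> C) c (e : pexp A n) :
  peval psi c (pexp_bind k v e)
  = peval (fun a => peval psi c (k a)) (fun i => peval psi c (v i)) e.
Proof. by elim: e => //= e1 -> e2 ->. Qed.

Lemma peval_rmorph (A B C : comPzRingType) n (th : {rmorphism B -> C})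
    (psi : A -> B) (c : 'I_n -> B) (e : pexp A n) :
  th (peval psi c e) = peval (fun a => th (psi a)) (fun i => th (c i)) e.
Proof.
by elim: e => //= e1 h1 e2 h2; rewrite ?rmorphD ?rmorphM h1 h2.
Qed.

Lemma peval_ext (A C : comPzRingType) n (psi psi' : A -> C) (c c' : 'I_n -> C) :
  psi =1 psi' -> c =1 c' -> peval psi c =1 peval psi' c'.
Proof. by move=> hp hc; elim=> //= e1 -> e2 ->. Qed.

Section Generation.
Variables (A B : comPzRingType) (phi : {rmorphism A -> B}).
Variables (n : nat) (b : 'I_n -> B).

Definition generated : {pred B} := fun x => `[< exists e, x = peval phi b e >].

Lemma generatedP x : reflect (exists e, x = peval phi b e) (x \in generated).
Proof. exact: asboolP. Qed.

Fact generated_subring : subring_closed generated.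
Proof.
split=> [|x y /generatedP [e ->] /generatedP [e' ->]|x y /generatedP [e ->] /generatedP [e' ->]].
- by apply/generatedP; exists (PConst n 1); rewrite /= rmorph1.
- apply/generatedP; exists (PAdd e (PMul (PConst n (-1)) e')).
  by rewrite /= rmorphN rmorph1 mulN1r.
- by apply/generatedP; exists (PMul e e').
Qed.
HB.instance Definition _ := GRing.isSubringClosed.Build B generated generated_subring.

Record generated_ring := GeneratedRing { gval :> B; _ : gval \in generated }.
HB.instance Definition _ := [isSub for gval].
HB.instance Definition _ := [Choice of generated_ring by <:].
HB.instance Definition _ := GRing.SubChoice_isSubComPzRing.Build
  B generated generated_ring generated_subring.

Lemma generated_const a : phi a \in generated.
Proof. by apply/generatedP; exists (PConst n a). Qed.
Lemma generated_var i : b i \in generated.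
Proof. by apply/generatedP; exists (PVar A i). Qed.

Definition generated_map (a : A) : generated_ring := GeneratedRing (generated_const a).
Fact generated_map_zmod : zmod_morphism generated_map.
Proof. by move=> a a'; apply: val_inj; rewrite /= rmorphB. Qed.
Fact generated_map_monoid : monoid_morphism generated_map.
Proof. by split=> [|a a']; apply: val_inj; rewrite /= ?rmorph1 ?rmorphM. Qed.
HB.instance Definition _ :=
  GRing.isZmodMorphism.Build A generated_ring generated_map generated_map_zmod.
HB.instance Definition _ :=
  GRing.isMonoidMorphism.Build A generated_ring generated_map generated_map_monoid.

End Generation.

Definition presents (A B : comPzRingType) (phi : {rmorphism A -> B}) (n m : nat)
    (e : 'I_m -> pexp A n) (b : 'I_n -> B) : Prop :=
  (forall k, peval phi b (e k) = 0) /\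
  forall (C : comPzRingType) (psi : {rmorphism A -> C}) (c : 'I_n -> C),
    (forall k, peval psi c (e k) = 0) ->
    exists! theta : {rmorphism B -> C},
      (forall a, theta (phi a) = psi a) /\ (forall i, theta (b i) = c i).

(** The subring of polynomial expressions in the generators is a retract of [B]
    by the universal property, so it is [B]. *)
Lemma presents_generated (A B : comPzRingType) (phi : {rmorphism A -> B}) n m
    (e : 'I_m -> pexp A n) (b : 'I_n -> B) :
  presents phi e b -> forall x, exists e', x = peval phi b e'.
Proof.
move=> [e0 univ] x; pose G := generated_ring phi b.
pose c i : G := GeneratedRing (generated_var phi b i).
have ec k : peval (generated_map phi b) c (e k) = 0.
  by apply: val_inj; rewrite -[LHS]/((val : {rmorphism G -> B}) _) peval_rmorph e0.
have [th [[th1 th2] _]] := univ G (generated_map phi b) c ec.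
have [id [_ idu]] := univ B phi b e0.
suff -> : x = val (th x) by apply/(generatedP phi b)/(valP (th x)).
transitivity (id x); first by rewrite (idu (@idfun B)).
rewrite (idu ((val : {rmorphism G -> B}) \o th : {rmorphism B -> B})) //.
by split=> y; rewrite -[LHS]/(val (th _)) ?th1 ?th2.
Qed.

(** The generators are those of [B] over [A] and of [C] over [B]. The relations are those of [B],
    and those of [C] with each coefficient in [B] replaced by a chosen expression [lft] in the
    generators of [B]. *)
Lemma fp_comp (A B C : comPzRingType) (phi : {rmorphism A -> B})
    (psi : {rmorphism B -> C}) (tot : {rmorphism A -> C}) :
  (forall a, tot a = psi (phi a)) ->
  finitely_presented phi -> finitely_presented psi -> finitely_presented tot.
Proof.
move=> totE [n [m [e [b pphi]]]] [n' [m' [e' [c ppsi]]]].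
have [lft lftE] := choice (presents_generated pphi).
have [e0 uphi] := pphi; have [e'0 upsi] := ppsi.
pose emb := pexp_bind (@PConst A (n + n')) (fun i => PVar A (lshift n' i)).
pose v (i : 'I_(n + n')) := match split i with inl j => psi (b j) | inr j => c j end.
pose E (k : 'I_(m + m')) : pexp A (n + n') := match split k with
  | inl j => emb (e j)
  | inr j => pexp_bind (fun x => emb (lft x)) (fun i => PVar A (rshift n i)) (e' j)
  end.
have vl i : v (lshift n' i) = psi (b i) by rewrite /v -/(unsplit (inl i)) unsplitK.
have vr i : v (rshift n i) = c i by rewrite /v -/(unsplit (inr i)) unsplitK.
have El k : E (lshift m' k) = emb (e k).
  by rewrite /E -/(unsplit (inl k)) unsplitK.
have Er k : E (rshift m k) = pexp_bind (fun x => emb (lft x))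
    (fun i => PVar A (rshift n i)) (e' k).
  by rewrite /E -/(unsplit (inr k)) unsplitK.
have embE (D : comPzRingType) (k : A -> D) w x :
  peval k w (emb x) = peval k (fun i => w (lshift n' i)) x by rewrite peval_bind.
exists (n + n')%N, (m + m')%N, E, v; split.
  move=> k; rewrite -[k]splitK; case: (split k) => j /=.
  - rewrite El embE (peval_ext totE vl) -(peval_rmorph psi phi b).
    by rewrite e0 rmorph0.
  - rewrite Er peval_bind /= -[RHS](e'0 j); apply: peval_ext => // x.
    by rewrite embE (peval_ext totE vl) -(peval_rmorph psi phi b) -lftE.
move=> D k w Ew.
have [|th [[th1 th2] thu]] := uphi D k (fun i => w (lshift n' i)).
  by move=> j; rewrite -embE -El.
have thE x : th x = peval k w (emb (lft x)).
  rewrite {1}[x]lftE peval_rmorph embE; exact: peval_ext.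
have [|th' [[th'1 th'2] th'u]] := upsi D th (fun i => w (rshift n i)).
  move=> j; rewrite -[RHS](Ew (rshift m j)) Er peval_bind.
  by apply: peval_ext.
exists th'; split.
  split=> [a|i]; first by rewrite totE th'1 th1.
  rewrite -[i]splitK; case: (split i) => j /=; first by rewrite vl th'1 th2.
  by rewrite vr th'2.
move=> x [x1 x2]; apply: th'u; split=> [y|i]; last by rewrite -vr x2.
have -> : th = (x \o psi : {rmorphism B -> D}).
  apply: thu; split=> [a|i] /=; first by rewrite -totE x1.
  by rewrite -vl x2.
by [].
Qed.

(** The images of the generators, with the same relations after their coefficients are moved along
    [g], present [P] over [B]. *)
Lemma pushout_fp (R A B P : comPzRingType) (f : {rmorphism R -> A})
    (g : {rmorphism R -> B}) (i : {rmorphism A -> P}) (j : {rmorphism B -> P}) :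
  is_pushout f g i j -> finitely_presented f -> finitely_presented j.
Proof.
move=> [ij univ] [n [m [e [b [e0 uf]]]]].
pose E k := pexp_bind (fun r => PConst n (g r)) (@PVar B n) (e k).
have EE (C : comPzRingType) (k : B -> C) c l :
  peval k c (E l) = peval (fun r => k (g r)) c (e l) by rewrite peval_bind.
exists n, m, E, (fun k => i (b k)); split.
  move=> k; rewrite EE -[RHS](rmorph0 i) -(e0 k) peval_rmorph.
  by apply: peval_ext => // r; rewrite ij.
move=> C k c Ec.
have [|th [[th1 th2] thu]] := uf C (k \o g : {rmorphism R -> C}) c.
  by move=> l; rewrite -[RHS](Ec l) EE.
have [|x [[x1 x2] xu]] := univ C th k; first exact: th1.
exists x; split; first by split=> // l; rewrite x1 th2.
move=> y [y1 y2]; apply: xu; split=> // a.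
have -> // : th = (y \o i : {rmorphism A -> C}).
by apply: thu; split=> [r|l] /=; rewrite ?ij ?y1 ?y2.
Qed.

Lemma flat_fp_comp (A B C : comPzRingType) (phi : {rmorphism A -> B})
    (psi : {rmorphism B -> C}) (tot : {rmorphism A -> C}) :
  (forall a, tot a = psi (phi a)) -> flat_fp phi -> flat_fp psi -> flat_fp tot.
Proof.
by move=> e [? ?] [? ?]; split; [apply: (flat_comp e)|apply: (fp_comp e)].
Qed.

Lemma pushout_flat_fp (R A B P : comPzRingType) (f : {rmorphism R -> A})
    (g : {rmorphism R -> B}) (i : {rmorphism A -> P}) (j : {rmorphism B -> P}) :
  is_pushout f g i j -> flat_fp f -> flat_fp j.
Proof.
by move=> h [? ?]; split; [apply: (pushout_flat h)|apply: (pushout_fp h)].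
Qed.

(** * Fibre products in a category fibred in groupoids *)

Lemma exists_unique_eq (T : Type) (P : T -> Prop) (x y : T) :
  (exists! z, P z) -> P x -> P y -> x = y.
Proof. by move=> [z [_ zu]] /zu <- /zu. Qed.

Section RelativeFibreProducts.
Variables (S : ring_functor) (X : cfg S).

Definition is_pullback (U V W Z : aff S) (u : ob X U) (v : ob X V) (w : ob X W)
    (z : ob X Z) (e : arrow v u) (b : arrow w u) (al : arrow z v) (be : arrow z w) :
    Prop :=
  comp e al = comp b be /\
  forall (T : aff S) (t : ob X T) (x : arrow t v) (y : arrow t w),
    comp e x = comp b y -> exists! c : arrow t z, comp al c = x /\ comp be c = y.

Section Square.
Variables (U V W : aff S) (u : ob X U) (v : ob X V) (w : ob X W).
Variables (e : arrow v u) (b : arrow w u).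

(** Ring maps are turned into arrows: [h] pulls [v] back to an object [t] over the spectrum of [C],
    cartesianness of [b] makes [k] an arrow from [t] to [w], and the induced arrow from [t] to [z]
    lies over the required map. Any other candidate lifts through the cartesian arrow [al], whence
    uniqueness. *)
Lemma pullback_pushout (Z : aff S) (z : ob X Z) (al : arrow z v) (be : arrow z w) :
  is_pullback e b al be -> is_pushout (base e) (base b) (base al) (base be).
Proof.
move=> [sq univ]; split=> [r|C h k hk].
  by rewrite -!base_comp sq.
pose T : aff S := Aff (pts_map h (struct V)).
pose lv : amor T V := @AMor S T V h erefl.
have ks : pts_map k (struct W) = struct T.
  rewrite /= -(comor_struct (base b)) -(comor_struct (base e)) -!pts_comp.
  by congr pts_map; apply: rmorph_ext => r; rewrite /= hk.
pose lw : amor T W := @AMor S T W k ks.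
have [t [a aE]] := pullback lv v.
have [|y [[by_ yE] _]] := @cartesian _ X _ _ _ _ _ _ b (comp e a) lw.
  by move=> r; rewrite base_comp aE /= hk.
have [|c [[c1 c2] cu]] := univ _ t a y; first by rewrite by_.
exists (base c); split.
  split=> r; first by rewrite -base_comp c1 aE.
  by rewrite -base_comp c2 yE.
move=> th [th1 th2]; have ths : pts_map th (struct Z) = struct T.
  rewrite -(comor_struct (base al)) -pts_comp /=.
  by congr pts_map; apply: rmorph_ext => r; rewrite /= th1.
have [|c' [[c'1 c'E] _]] := @cartesian _ X _ _ _ _ _ _ al a (@AMor S T Z th ths).
  by move=> r; rewrite aE /= th1.
suff -> : c = c' by apply: rmorph_ext.
apply: cu; split=> //.
have kb r : base (comp e a) r = lw (base b r).
  by rewrite base_comp aE /= hk.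
apply: (exists_unique_eq (cartesian kb)); last by split.
split=> [|r]; first by rewrite comp_assoc -sq -comp_assoc c'1.
by rewrite base_comp c'E /= th2.
Qed.

Definition tensor_aff : aff S :=
  @Aff S (rtens (base e) (base b)) (pts_map rt_inl (struct V)).

(** All arrows are cartesian, so it suffices to pull [v] back to the spectrum of the tensor product
    and to factor the result through [b]. *)
Lemma pullback_exists : exists (z : ob X tensor_aff) (al : arrow z v) (be : arrow z w),
  [/\ is_pullback e b al be, base al =1 rt_inl & base be =1 rt_inr].
Proof.
pose lv : amor tensor_aff V := @AMor S tensor_aff V rt_inl erefl.
have ws : pts_map rt_inr (struct W) = struct tensor_aff.
  rewrite /= -(comor_struct (base b)) -(comor_struct (base e)) -!pts_comp.
  by congr pts_map; apply: rmorph_ext => r; rewrite /= rt_glue.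
pose lw : amor tensor_aff W := @AMor S tensor_aff W rt_inr ws.
have [z [al alE]] := pullback lv v.
have [|be [[bbe beE] _]] := @cartesian _ X _ _ _ _ _ _ b (comp e al) lw.
  by move=> r; rewrite base_comp alE /= rt_glue.
exists z, al, be; split=> //; split=> // T t x y xy.
have hk r : base x (base e r) = base y (base b r) by rewrite -!base_comp xy.
pose ext := rt_ext_rmorph hk.
have exts : pts_map ext (struct tensor_aff) = struct T.
  rewrite /= -pts_comp -(comor_struct (base x)).
  by congr pts_map; apply: rmorph_ext => r; rewrite /= -[LHS]/(ext _) rt_ext_inl.
have [|c [[c1 cE] cu]] := @cartesian _ X _ _ _ _ _ _ al x (@AMor S T tensor_aff ext exts).
  by move=> r; rewrite alE /= -[RHS]/(ext _) rt_ext_inl.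
have c2 : comp be c = y.
  have kb r : base (comp e x) r = base y (base b r) by rewrite base_comp hk.
  apply: (exists_unique_eq (cartesian kb)); last by split.
  split=> [|r]; first by rewrite comp_assoc bbe -comp_assoc c1.
  by rewrite base_comp beE cE /= -[LHS]/(ext _) rt_ext_inr.
exists c; split=> // c' [c'1 c'2]; apply: cu; split=> //.
apply: rt_eq_ext => [s s'|s s'|r r']; rewrite ?rmorphD //.
rewrite rtE !rmorphM /=; congr (_ * _).
  by rewrite -[RHS]/(ext _) rt_ext_inl -alE -base_comp c'1.
by rewrite -[RHS]/(ext _) rt_ext_inr -beE -base_comp c'2.
Qed.

End Square.

(** The fibre of [v] over [t] is the pullback of [v -> u] along the fibre of [u] over [t]. *)
Lemma flat_fp_mor_comp (U V : aff S) (u : ob X U) (v : ob X V) (e : arrow v u) :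
  flat_fp (base e) -> flat_fp_mor u -> flat_fp_mor v.
Proof.
move=> fe fu T t; have [W [w [a [b [wP fb]]]]] := fu T t.
have [z [al [be [zP alE beE]]]] := pullback_exists e a.
exists (tensor_aff e a), z, al, (comp b be); split.
  move=> T' t' x y; have [c [[c1 c2] cu]] := wP _ t' (comp e x) y.
  have [|d [[d1 d2] du]] := proj2 zP _ t' x c; first by rewrite c1.
  exists d; split; first by rewrite -comp_assoc d2.
  move=> d' [d'1 d'2]; apply: du; split=> //; apply/esym/cu.
  by rewrite !comp_assoc -(proj1 zP) -comp_assoc d'1 d'2.
apply: (flat_fp_comp (base_comp b be) fb).
exact: (pushout_flat_fp (pullback_pushout zP) fe).
Qed.

(** [has_property] asserts mere existence. Packing a fibre product into one record lets [cid] choose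
    it, which makes [u |-> u x_X p] a function on objects. *)
Record fibre (P : forall A B : comPzRingType, {rmorphism A -> B} -> Prop)
    (U : aff S) (u : ob X U) (T : aff S) (t : ob X T) := Fibre {
  fib_aff : aff S;
  fib_ob : ob X fib_aff;
  fib_l : arrow fib_ob u;
  fib_r : arrow fib_ob t;
  fib_prod : is_fibre_product fib_l fib_r;
  fib_prop : P T fib_aff (base fib_r) }.

Lemma fibre_exists P (U : aff S) (u : ob X U) (T : aff S) (t : ob X T) :
  has_property P u -> exists _ : fibre P u t, True.
Proof. by move=> h; have [W [w [a [b [wP pb]]]]] := h T t; exists (Fibre wP pb). Qed.

Definition pick_fibre P (U : aff S) (u : ob X U) (T : aff S) (t : ob X T)
  (h : has_property P u) : fibre P u t := projT1 (cid (fibre_exists t h)).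

End RelativeFibreProducts.

(** * Coinduction along a presentation *)

(** Modules on the site of [X] over [p]. The equation in [omres] is kept
    propositional, so that no transport is needed in [omres_comp]. *)
Record over_mod (S : ring_functor) (X : cfg S) (U : aff S) (p : ob X U) := OverMod {
  omsec : forall w : site X, arrow (sob w) p -> lmodType (saff w);
  omres : forall (w w' : site X) (e : shom w w') (a : arrow (sob w) p)
    (a' : arrow (sob w') p), comp a' e = a -> omsec a' -> omsec a;
  omresD : forall w w' e a a' h, {morph @omres w w' e a a' h : s t / s + t};
  omresZ : forall w w' e a a' h r s,
    @omres w w' e a a' h (r *: s) = base e r *: @omres w w' e a a' h s;
  omres_id : forall w a h s, @omres w w (id_arrow _) a a h s = s;
  omres_comp : forall w w' w'' e e' a a' a'' h h' h'' s,
    @omres w w'' (comp e' e) a a'' h'' s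
    = @omres w w' e a a' h (@omres w' w'' e' a' a'' h' s) }.
Arguments omres {S X U p} o {w w' e a a'} h s.

Section OverModules.
Variables (S : ring_functor) (X : cfg S) (U : aff S) (p : ob X U).

Lemma omres_eq (E : over_mod p) (w w' : site X) (e e' : shom w w')
    (a : arrow (sob w) p) (a' : arrow (sob w') p) (h : comp a' e = a)
    (h' : comp a' e' = a) s :
  e = e' -> omres E h s = omres E h' s.
Proof. by move=> ee; move: h; rewrite ee => h; rewrite (Prop_irrelevance h h'). Qed.

Definition om_sheaf (E : over_mod p) : Prop :=
  forall (w : site X) (a : arrow (sob w) p) n (v : 'I_n -> site X)
    (b : forall i, arrow (sob (v i)) p)
    (g : forall i, shom (v i) w) (gb : forall i, comp a (g i) = b i),
  fppf_cover g -> forall s : forall i, omsec E (b i),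
  (forall i j (t : site X) (c : arrow (sob t) p) (x : shom t (v i))
     (y : shom t (v j)) (hx : comp (b i) x = c) (hy : comp (b j) y = c),
     comp (g i) x = comp (g j) y -> omres E hx (s i) = omres E hy (s j)) ->
  exists! z : omsec E a, forall i, omres E (gb i) z = s i.

Variable fp : flat_fp_mor p.

Definition over_fibre (u : site X) : fibre flat_fp p (sob u) := pick_fibre (sob u) fp.
Definition over (u : site X) : site X :=
  Site (flat_fp_mor_comp (fib_prop (over_fibre u)) (sflat u)).
Definition over_p u : arrow (sob (over u)) p := fib_l (over_fibre u).
Definition over_r u : shom (over u) u := fib_r (over_fibre u).

Lemma over_pair (u : site X) (T : aff S) (t : ob X T) (x : arrow t p)
    (y : arrow t (sob u)) :
  exists! c : arrow t (sob (over u)), comp (over_p u) c = x /\ comp (over_r u) c = y.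
Proof. exact: fib_prod. Qed.

Lemma over_eq (u : site X) (T : aff S) (t : ob X T) (c d : arrow t (sob (over u))) :
  comp (over_p u) c = comp (over_p u) d -> comp (over_r u) c = comp (over_r u) d ->
  c = d.
Proof. by move=> hp hr; apply: (exists_unique_eq (over_pair _ _)). Qed.

Lemma over_map_exists (u v : site X) (e : shom u v) :
  exists c : shom (over u) (over v),
    comp (over_p v) c = over_p u /\ comp (over_r v) c = comp e (over_r u).
Proof.
by have [c [h _]] := over_pair (over_p u) (comp e (over_r u)); exists c.
Qed.
Definition over_map (u v : site X) (e : shom u v) : shom (over u) (over v) :=
  projT1 (cid (over_map_exists e)).
Lemma over_map_p u v (e : shom u v) : comp (over_p v) (over_map e) = over_p u.
Proof. exact (proj1 (projT2 (cid (over_map_exists e)))). Qed.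
Lemma over_map_r u v (e : shom u v) :
  comp (over_r v) (over_map e) = comp e (over_r u).
Proof. exact (proj2 (projT2 (cid (over_map_exists e)))). Qed.

Lemma over_map_id u : over_map (id_arrow (sob u)) = id_arrow (sob (over u)).
Proof.
by apply: over_eq; rewrite ?over_map_p ?over_map_r ?comp_idr ?comp_idl.
Qed.
Lemma over_map_comp u v w (e' : shom v w) (e : shom u v) :
  over_map (comp e' e) = comp (over_map e') (over_map e).
Proof.
apply: over_eq; first by rewrite comp_assoc !over_map_p.
by rewrite [RHS]comp_assoc !over_map_r -[RHS]comp_assoc over_map_r comp_assoc.
Qed.

Lemma over_map_pullback u v (e : shom u v) :
  is_pullback e (over_r v) (over_r u) (over_map e).
Proof.
split=> [|T t x y exy]; first by rewrite over_map_r.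
have [c [[cp cr] cu]] := over_pair (comp (over_p v) y) x.
exists c; split.
  split=> //; apply: over_eq; first by rewrite comp_assoc over_map_p.
  by rewrite comp_assoc over_map_r -comp_assoc cr.
move=> d [dr dm]; apply: cu; split=> //.
by rewrite -dm comp_assoc over_map_p.
Qed.

(** Joint surjectivity is transferred through modules: a flat cover is a faithful family, which
    survives base change and is again surjective on spectra. *)
Lemma over_map_cover (u : site X) n (v : 'I_n -> site X) (g : forall i, shom (v i) u) :
  fppf_cover g -> fppf_cover (fun i => over_map (g i)).
Proof.
move=> [gf js]; have po i := pullback_pushout (over_map_pullback (g i)).
split=> [i|]; first exact: pushout_flat_fp (po i) (gf i).
apply: faithful_surjective; apply: faithful_base_change po _.
by apply: cover_faithful => // i; have [] := gf i.
Qed.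

(** [coind E] is [u |-> E (u x_X p)]. *)
Definition coind (E : over_mod p) : pmod X.
Proof.
exists (fun u => restr (base (over_r u)) (omsec E (over_p u)) : lmodType (saff u))
  (fun u v e => omres E (over_map_p e)).
- move=> u v e; exact: omresD.
- move=> u v e r s; have := omresZ (o := E) (over_map_p e) (base (over_r v) r) s.
  by rewrite -base_comp over_map_r base_comp.
- move=> u s; rewrite -[RHS](omres_id (o := E) (comp_idr _)).
  by apply: omres_eq; apply: over_map_id.
- move=> u v w b a s.
  have h : comp (over_p w) (comp (over_map b) (over_map a)) = over_p u.
    by rewrite comp_assoc !over_map_p.
  by rewrite -(omres_comp _ _ h); apply: omres_eq; apply: over_map_comp.
Defined.

Lemma coind_sheaf (E : over_mod p) : om_sheaf E -> is_sheaf (psh_of (coind E)).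
Proof.
move=> Esh u n v g gc s sE.
apply: (Esh _ _ _ _ _ _ _ (over_map_cover gc)).
move=> i j t c x y hx hy xy.
(* The hypothesis on [s] only concerns objects [t x_X p], for [t] over the [v i]. The section [sg]
   of [t x_X p -> t] determined by [c] transfers it to [t] itself. *)
have [sg [[sp sr] _]] := over_pair c (id_arrow (sob t)).
have lift k (z : shom t (over (v k))) (hz : comp (over_p (v k)) z = c) :
    omres E hz (s k) = omres E sp (omres E (over_map_p (comp (over_r (v k)) z)) (s k)).
  have h : comp (over_p (v k)) (comp (over_map (comp (over_r (v k)) z)) sg) = c.
    by rewrite comp_assoc over_map_p.
  rewrite -(omres_comp _ _ h); apply: omres_eq; apply: over_eq.
    by rewrite comp_assoc over_map_p hz sp.
  by rewrite comp_assoc over_map_r -comp_assoc sr comp_idr.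
rewrite !lift; congr (omres E sp _); apply: sE.
by rewrite !comp_assoc -!over_map_r -!comp_assoc xy.
Qed.

Definition om_restrict (M : pmod X) : over_mod p.
Proof.
by exists (fun w _ => M w) (fun w w' e a a' _ => mres e) => *;
  [apply: mresD|apply: mresZ|apply: mres_id|apply: mres_comp].
Defined.

Lemma om_restrict_sheaf (M : pmod X) : is_sheaf (psh_of M) -> om_sheaf (om_restrict M).
Proof.
move=> Msh w a n v b g gb gc s sE; apply: (Msh w n v g gc s) => i j t x y xy.
apply: (sE i j t (comp (b i) x) x y erefl _ xy).
by rewrite -!gb -!comp_assoc xy.
Qed.

End OverModules.

(** * Germs and the inverse image *)

Section AssociatedSheaf.
Variables (S : ring_functor) (X : cfg S).

Lemma ash_ext (P H : psh X) (a : assoc_sheaf P) (n n' : pmap a H) : is_sheaf H ->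
  (forall u s, n u (ash_unit a u s) = n' u (ash_unit a u s)) ->
  forall u s, n u s = n' u s.
Proof.
move=> Hsh e u s; have [k [_ ku]] := ash_univ a Hsh (pmap_comp n (ash_unit a)).
by rewrite (ku n (fun _ _ => erefl)) (ku n' (fun u s => esym (e u s))).
Qed.

Lemma ash_map_unit (sh : sheafification X) (P Q : psh X) (m : pmap P Q) u s :
  ash_map sh m u (ash_unit (sh P) u s) = ash_unit (sh Q) u (m u s).
Proof. by rewrite /ash_map; case: cid => n [h _] /=; rewrite h. Qed.

End AssociatedSheaf.

Section GermPairings.
Variables (S : ring_functor) (X Y : cfg S) (f : fmor X Y).
Variable sh : sheafification X.

Lemma pre_inv_res (P : psh Y) u v (a : shom u v) (e : germ f P v) :
  res (p := pre_inv f P) a (germ_class e) = germ_class (germ_res a e).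
Proof. exact/germ_classP/germ_res_eq/germ_repr_class. Qed.

Lemma pre_inv_mapE (P Q : psh Y) (m : pmap P Q) u (e : germ f P u) :
  pre_inv_map f m u (germ_class e) = germ_class (germ_push m e).
Proof. exact/germ_classP/germ_push_eq/germ_repr_class. Qed.

Definition germ_section (P : psh Y) (u : site X) (v : site Y)
    (g : arrow (f _ (sob u)) (sob v)) (s : P v) : inv f sh P u :=
  ash_unit (sh (pre_inv f P)) u (germ_class (Germ g s)).

Lemma inv_ext (P : psh Y) (H : psh X) (n n' : pmap (inv f sh P) H) : is_sheaf H ->
  (forall u v (g : arrow (f _ (sob u)) (sob v)) (s : P v),
     n u (germ_section g s) = n' u (germ_section g s)) ->
  forall u s, n u s = n' u s.
Proof.
move=> Hsh e; apply: ash_ext => // u c; rewrite -[c]germ_reprK.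
by case: (germ_repr c) => v g s; apply: e.
Qed.

Lemma germ_section_res (P : psh Y) u u' (a : shom u u') (v : site Y)
    (g : arrow (f _ (sob u')) (sob v)) (s : P v) :
  res a (germ_section g s) = germ_section (comp g (fhom f a)) s.
Proof. by rewrite /germ_section -pmap_nat pre_inv_res. Qed.

Lemma germ_section_comp (P : psh Y) u (v v' : site Y) (j : shom v v')
    (g : arrow (f _ (sob u)) (sob v)) (s : P v') :
  germ_section (comp j g) s = germ_section g (res j s).
Proof.
by congr (ash_unit _ _ _); apply/germ_classP/GermSym/GermStep.
Qed.

Lemma inv_map_germ (P Q : psh Y) (m : pmap P Q) u (v : site Y)
    (g : arrow (f _ (sob u)) (sob v)) (s : P v) :
  inv_map f sh m u (germ_section g s) = germ_section g (m v s).
Proof. by rewrite /inv_map ash_map_unit pre_inv_mapE. Qed.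

Lemma inv_op_germ (P Q H : psh Y) (m : pmap (prod_psh P Q) H) u (v : site Y)
    (g : arrow (f _ (sob u)) (sob v)) (s : P v) (t : Q v) :
  inv_op m (germ_section g s) (germ_section g t)
    (germ_section g (m v ((s, t) : prod_psh P Q v))).
Proof.
by exists (germ_section g ((s, t) : prod_psh P Q v)); rewrite !inv_map_germ.
Qed.

Variables (rho : pmap (inv f sh (structure_psh Y)) (structure_psh X)).
Hypothesis rhoP : is_inv_structure rho.

Lemma inv_structure_germ u (v : site Y) (g : arrow (f _ (sob u)) (sob v)) r :
  rho u (germ_section (P := structure_psh Y) g r) = base g r.
Proof. by rewrite rhoP; apply: (germ_fun_eq (germ_repr_class _)). Qed.

Variable F : pmod Y.

(** The restriction of a pairing of [O_X] with [f^{-1} F] to [1] and germs. *)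
Record germ_pairing (T : pmod X)
    (th : forall (u : site X) (v : site Y), arrow (f _ (sob u)) (sob v) -> F v -> T u) :
    Prop := GermPairing {
  gpD : forall u v g, {morph @th u v g : s t / s + t};
  gpZ : forall u v g r s, @th u v g (r *: s) = base g r *: @th u v g s;
  gp_res : forall u u' v (e : shom u u') g s,
    mres e (@th u' v g s) = @th u v (comp g (fhom f e)) s;
  gp_comp : forall u v v' (j : shom v v') g s,
    @th u v' (comp j g) s = @th u v g (mres j s) }.

Definition germ_value (T : pmod X)
    (tau : forall u : site X, saff u -> inv f sh (psh_of F) u -> T u)
    (u : site X) (v : site Y) (g : arrow (f _ (sob u)) (sob v)) (s : F v) : T u :=
  tau u 1 (germ_section (P := psh_of F) g s).

Lemma germ_value_pairing (T : pmod X)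
    (tau : forall u : site X, saff u -> inv f sh (psh_of F) u -> T u) :
  balanced_pairing rho tau -> germ_pairing (germ_value tau).
Proof.
case=> tDl tDr tA tZ tnat; split.
- by move=> u v g s t; apply: tDr; apply: (inv_op_germ (add_psh F)).
- move=> u v g r s; rewrite /germ_value -tZ.
  rewrite (tA u 1 _ _ _ (inv_op_germ (scale_psh F) g (r : structure_psh Y v) s)).
  by rewrite inv_structure_germ mul1r mulr1.
- move=> u u' v e g s.
  by rewrite /germ_value -tnat rmorph1 germ_section_res.
- by move=> u v v' j g s; rewrite /germ_value germ_section_comp.
Qed.

Section Extension.
Variables (T : pmod X) (Tsh : is_sheaf (psh_of T)).
Variable th :
  forall (u : site X) (v : site Y), arrow (f _ (sob u)) (sob v) -> F v -> T u.
Hypothesis thP : germ_pairing th.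

Definition germ_apply (u : site X) (e : germ f (psh_of F) u) : T u :=
  th (germ_hom e) (germ_sec e : F (germ_ob e)).

Lemma germ_apply_eq u (e e' : germ f (psh_of F) u) :
  germ_eq e e' -> germ_apply e = germ_apply e'.
Proof.
elim=> {e e'} [w w' g j s|e|e e' _ ->|e e' e'' _ -> _ ->] //.
by rewrite /germ_apply /= (gp_comp thP).
Qed.

Definition colim_apply : pmap (pre_inv f (psh_of F)) (psh_of T).
Proof.
exists (fun u c => germ_apply (germ_repr c)) => u v a c.
rewrite (germ_apply_eq (germ_repr_class _)).
by rewrite /germ_apply /= (gp_res thP).
Defined.

Lemma inv_apply_exists : exists L : pmap (inv f sh (psh_of F)) (psh_of T),
  forall u v (g : arrow (f _ (sob u)) (sob v)) (s : F v),
    L u (germ_section (P := psh_of F) g s) = th g s.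
Proof.
have [L [LE _]] := ash_univ (sh (pre_inv f (psh_of F))) Tsh colim_apply.
exists L => u v g s; rewrite LE /= (germ_apply_eq (germ_repr_class _)).
by [].
Qed.

(** The pairing is [b *: L s]. Since [inv_op] provides a section of [f^{-1} (F x F)], additivity of
    [L] is an equality of two sheaf maps out of [f^{-1} (F x F)], which [inv_ext] reduces to germs;
    likewise for scalars with [f^{-1} (O_Y x F)]. *)
Lemma germ_pairing_extends :
  exists tau : forall u : site X, saff u -> inv f sh (psh_of F) u -> T u,
    balanced_pairing rho tau /\ forall u v g s, @germ_value T tau u v g s = th g s.
Proof.
have [L LE] := inv_apply_exists.
have Lnat u v (a : shom u v) s : L u (res a s) = mres a (L v s) by apply: pmap_nat.
exists (fun u b s => b *: (L u s : T u)); split; last first.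
  by move=> u v g s; rewrite /germ_value scale1r LE.
split=> [u b b' s|u b s t r|u b c s r|u b c s|u v a b s].
- exact: scalerDl.
- move=> [z [<- <- <-]]; rewrite -scalerDr; congr (_ *: _).
  have @A : pmap (inv f sh (prod_psh (psh_of F) (psh_of F))) (psh_of T).
    exists (fun u z => (L u (inv_map f sh (fst_psh (psh_of F) (psh_of F)) u z) : T u)
      + L u (inv_map f sh (snd_psh (psh_of F) (psh_of F)) u z)).
    by move=> u' v' a z'; rewrite !pmap_nat /= mresD.
  apply: (inv_ext (n := pmap_comp L (inv_map f sh (add_psh F))) (n' := A)) => //.
  move=> u' v' g [x y]; rewrite /= !inv_map_germ !LE /=.
  exact: (gpD thP).
- move=> [z [<- <- <-]]; rewrite -scalerA; congr (_ *: _).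
  have @A : pmap (inv f sh (prod_psh (structure_psh Y) (psh_of F))) (psh_of T).
    exists (fun u z => rho u (inv_map f sh (fst_psh (structure_psh Y) (psh_of F)) u z)
      *: (L u (inv_map f sh (snd_psh (structure_psh Y) (psh_of F)) u z) : T u)).
    by move=> u' v' a z'; rewrite !pmap_nat /= mresZ.
  apply: (inv_ext (n := pmap_comp L (inv_map f sh (scale_psh F))) (n' := A)) => //.
  move=> u' v' g [x y]; rewrite /= !inv_map_germ inv_structure_germ !LE /=.
  exact: (gpZ thP).
- by rewrite scalerA.
- by rewrite Lnat mresZ.
Qed.
End Extension.

Section Tensor.
Variables (T : pmod X) (tau : forall u : site X, saff u -> inv f sh (psh_of F) u -> T u).
Hypothesis tauP : is_tensor rho tau.

Lemma tensor_germ_map (T' : pmod X)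
    (th : forall (u : site X) (v : site Y), arrow (f _ (sob u)) (sob v) -> F v -> T' u) :
  is_sheaf (psh_of T') -> germ_pairing th ->
  exists h : pmod_hom T T', forall u v g s, h u (@germ_value T tau u v g s) = th u v g s.
Proof.
move=> Tsh /(germ_pairing_extends Tsh) [tau' [tauP' tauE]].
have [h [hE _]] := tensor_univ tauP Tsh tauP'; exists h => u v g s.
by rewrite /germ_value hE -tauE.
Qed.

(** By linearity a morphism out of [T] is determined by its values on the [1 (x) s]. These form a
    sheaf map out of [f^{-1} F], which is determined by germs. *)
Lemma tensor_germ_ext (T' : pmod X) (h h' : pmod_hom T T') :
  is_sheaf (psh_of T') ->
  (forall u v g s, h u (@germ_value T tau u v g s) = h' u (@germ_value T tau u v g s)) ->
  h = h'.
Proof.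
move=> Tsh e; have [tDl tDr tA tZ tnat] := tensor_pairing tauP.
have tauE u b s : @tau u b s = b *: @tau u 1 s by rewrite -tZ mulr1.
have @one (k : pmod_hom T T') : pmap (inv f sh (psh_of F)) (psh_of T').
  exists (fun u s => k u (@tau u 1 s)) => u v a s.
  by rewrite -(rmorph1 (base a)) tnat mhom_nat.
have hh u s : h u (@tau u 1 s) = h' u (@tau u 1 s).
  exact: (inv_ext (n := one h) (n' := one h')).
have bal : balanced_pairing rho (fun u b s => h u (@tau u b s)).
  split=> [u b b' s|u b s t r /tDr|u b c s r /tA|u b c s|u v a b s].
  - by rewrite tDl mhomD.
  - by move=> ->; rewrite mhomD.
  - by move=> ->.
  - by rewrite tZ mhomZ.
  - by rewrite tnat mhom_nat.
apply: (exists_unique_eq (tensor_univ tauP Tsh bal)) => // u b s.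
by rewrite tauE !mhomZ hh.
Qed.

End Tensor.
End GermPairings.

(** * Coordinates of sections along a presentation *)

Section SemilinearExtension.
Variables (A B : comPzRingType) (eta : {rmorphism A -> B}).
Variables (N : lmodType A) (P : lmodType B) (h : N -> P).
Hypotheses (hD : {morph h : m n / m + n})
  (hZ : forall a n, h (a *: n) = eta a *: h n).

Definition bc_lin : bc eta N -> P := bc_ext (P := P) (@idfun B) h.
Lemma bc_lin_tens b n : bc_lin (bct b n) = b *: h n.
Proof. exact: (bc_ext_tens (rho := @idfun B) hD hZ). Qed.
Lemma bc_linD : {morph bc_lin : s t / s + t}.
Proof. exact: (bc_extD (rho := @idfun B) hD hZ). Qed.
Lemma bc_linZ b t : bc_lin (b *: t) = b *: bc_lin t.
Proof. exact: (bc_extZ (rho := @idfun B) hD hZ). Qed.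

Lemma bc_lin_change (C : comPzRingType) (rho : {rmorphism B -> C})
    (eta' : {rmorphism A -> C}) (P' : lmodType C) (r : P -> P') :
  (forall a, rho (eta a) = eta' a) ->
  {morph r : x y / x + y} -> (forall b x, r (b *: x) = rho b *: r x) ->
  forall t, bc_ext (eta := eta') (P := P') (@idfun C) (fun n => r (h n)) (bc_change rho t)
    = r (bc_lin t).
Proof.
move=> e rD rZ.
have kD : {morph (fun n => r (h n)) : m n / m + n} by move=> m n; rewrite hD rD.
have kZ a n : r (h (a *: n)) = idfun (eta' a) *: r (h n) by rewrite hZ rZ e.
apply: bc_eq_ext => [s t|s t|b n].
- by rewrite (bc_changeD e) (bc_extD kD kZ).
- by rewrite bc_linD rD.
- by rewrite (bc_change_tens e) (bc_ext_tens kD kZ) bc_lin_tens rZ.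
Qed.

End SemilinearExtension.
Arguments bc_lin {A B} eta {N P} h t.

Section Coordinates.
Variables (S : ring_functor) (Y : cfg S) (F : pmod Y) (hF : qcoh F).
Variables (V : aff S) (q : ob Y V) (fq : flat_fp_mor q).
Let sq : site Y := Site fq.
Notation N := (F (Site fq)).

Definition coord_map (z : site Y) (al : arrow (sob z) q) : bc (base al) N -> F z :=
  bc_lin (base al) (@mres _ _ F z sq al).
Arguments coord_map {z} al t.

Let cD (z : site Y) (al : arrow (sob z) q) :
  {morph @mres _ _ F z sq al : m n / m + n}.
Proof. exact: mresD. Qed.
Let cZ (z : site Y) (al : arrow (sob z) q) a n :
  @mres _ _ F z sq al (a *: n) = base al a *: @mres _ _ F z sq al n.
Proof. exact: mresZ. Qed.

Lemma coord_map_bij (z : site Y) (al : arrow (sob z) q) : bijective (coord_map al).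
Proof. exact: (hF (u := z) (v := sq) al). Qed.

Lemma coord_map_res (z z' : site Y) (al : arrow (sob z) q) (e : shom z' z)
    (al' : arrow (sob z') q) t : comp al e = al' ->
  coord_map al' (bc_change (base e) t) = mres e (coord_map al t).
Proof.
move=> <-; rewrite /coord_map.
have e1 a : base e (base al a) = base (comp al e) a by rewrite base_comp.
rewrite -(bc_lin_change (eta' := base (comp al e)) (cD al) (cZ al) e1
  (@mresD _ _ _ _ _ e) (@mresZ _ _ _ _ _ e)).
by congr bc_ext; apply: funext => n; rewrite (mres_comp (v := z) (w := sq)).
Qed.

(** As [F] is quasi-coherent, its sections over [v x_Y q] have coordinates in the
    module of [q]; [t] is the pullback to [y] of those of [s]. Any [z] mapping to
    [v] and [q] may replace [v x_Y q]. *)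
Definition is_coord (R : aff S) (y : ob Y R) (k : arrow y q) (v : site Y)
    (g : arrow y (sob v)) (s : F v) (t : bc (base k) N) : Prop :=
  exists (z : site Y) (al : arrow (sob z) q) (be : shom z v) (h : arrow y (sob z))
    (t0 : bc (base al) N),
  [/\ comp al h = k, comp be h = g, coord_map al t0 = mres be s
    & t = bc_change (base h) t0].
Arguments is_coord {R y} k {v} g s t.

Section One.
Variables (R : aff S) (y : ob Y R) (k : arrow y q) (v : site Y) (g : arrow y (sob v)).

(** Every witness [z] maps to [v x_Y q] through [al] and [be], and [coord_map] is injective over [z]
    by quasi-coherence; so all witnesses yield the coordinates computed on [v x_Y q]. *)
Lemma is_coord_normal s t (h : arrow y (sob (over fq v)))
    (t0 : bc (base (over_p fq v)) N) :
  is_coord k g s t -> comp (over_p fq v) h = k -> comp (over_r fq v) h = g ->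
  coord_map (over_p fq v) t0 = mres (over_r fq v) s -> t = bc_change (base h) t0.
Proof.
move=> [z [al [be [h' [t1 [ak bg t1E ->]]]]]] hk hg t0E.
have [e [[ep er] _]] := over_pair fq al be.
have -> : h = comp e h'.
  by apply: over_eq; rewrite comp_assoc ?ep ?er ?ak ?bg.
have -> : t1 = bc_change (base e) t0.
  apply: (bij_inj (coord_map_bij al)); rewrite (coord_map_res _ ep) t0E t1E.
  by rewrite -mres_comp er.
apply/esym/bc_change_comp => [a|a|b]; last exact: base_comp.
- by rewrite -ep base_comp.
- by rewrite -ak base_comp.
Qed.

Lemma is_coord_over s : exists (h : arrow y (sob (over fq v)))
    (t0 : bc (base (over_p fq v)) N),
  [/\ comp (over_p fq v) h = k, comp (over_r fq v) h = g
    & coord_map (over_p fq v) t0 = mres (over_r fq v) s].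
Proof.
have [h [[hp hr] _]] := over_pair fq k g.
have [c _ cK] := coord_map_bij (over_p fq v).
by exists h, (c (mres (over_r fq v) s)); split.
Qed.

Lemma coord_exists s : exists t, is_coord k g s t.
Proof.
have [h [t0 [hp hr e]]] := is_coord_over s; exists (bc_change (base h) t0).
by exists (over fq v), (over_p fq v), (over_r fq v), h, t0.
Qed.

Definition coord s : bc (base k) N := projT1 (cid (coord_exists s)).
Lemma coordP s : is_coord k g s (coord s).
Proof. exact (projT2 (cid (coord_exists s))). Qed.

Lemma coord_unique s t : is_coord k g s t -> coord s = t.
Proof.
have [h [t0 [hp hr e]]] := is_coord_over s => ht.
rewrite (is_coord_normal ht hp hr e).
exact: is_coord_normal (coordP s) hp hr e.
Qed.

Lemma coordD : {morph coord : s t / s + t}.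
Proof.
move=> s t; apply: coord_unique.
have [h [s0 [hp hr es]]] := is_coord_over s.
have [h' [t0 [hp' hr' et]]] := is_coord_over t.
have hh : h' = h by apply: (@over_eq _ _ _ _ fq); rewrite ?hp ?hr.
exists (over fq v), (over_p fq v), (over_r fq v), h, (s0 + t0); split=> //.
  by rewrite /coord_map (bc_linD (cD _) (cZ _)) mresD -es -et.
have e a : base h (base (over_p fq v) a) = base k a by rewrite -hp base_comp.
rewrite (bc_changeD e) (is_coord_normal (coordP s) hp hr es).
by rewrite (is_coord_normal (coordP t) hp hr et).
Qed.

Lemma coordZ r s : coord (r *: s) = base g r *: coord s.
Proof.
apply: coord_unique; have [h [s0 [hp hr es]]] := is_coord_over s.
exists (over fq v), (over_p fq v), (over_r fq v), h,
  (base (over_r fq v) r *: s0); split=> //.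
  by rewrite /coord_map (bc_linZ (cD _) (cZ _)) mresZ -es.
have e a : base h (base (over_p fq v) a) = base k a by rewrite -hp base_comp.
by rewrite (bc_changeZ e) (is_coord_normal (coordP s) hp hr es) -hr base_comp.
Qed.
End One.

Lemma coord_comp (R : aff S) (y : ob Y R) (k : arrow y q) (v v' : site Y)
    (j : shom v v') (g : arrow y (sob v)) (s : F v') :
  coord k (comp j g) s = coord k g (mres j s).
Proof.
apply: coord_unique; have [z [al [be [h [t0 [ak bg e ->]]]]]] := coordP k g (mres j s).
exists z, al, (comp j be), h, t0; split=> //; first by rewrite -comp_assoc bg.
by rewrite e mres_comp.
Qed.

Lemma coord_arrow (R R' : aff S) (y : ob Y R) (y' : ob Y R') (c : arrow y' y)
    (k : arrow y q) (k' : arrow y' q) (v : site Y) (g : arrow y (sob v))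
    (g' : arrow y' (sob v)) (s : F v) (rho : R -> R') :
  base c =1 rho -> comp k c = k' -> comp g c = g' ->
  coord k' g' s = bc_change rho (coord k g s).
Proof.
move=> /funext <- ck cg.
apply: coord_unique; have [z [al [be [h [t0 [ak bg e ->]]]]]] := coordP k g s.
exists z, al, be, (comp h c), t0.
split; rewrite ?comp_assoc ?ak ?bg //.
apply/esym/bc_change_comp => [a|a|b]; last exact: base_comp.
- by rewrite -ak base_comp.
- by rewrite -ck base_comp.
Qed.

Lemma coord_id (R : aff S) (y : ob Y R) (k : arrow y q) (s : N) :
  coord k (v := sq) k s = bct 1 s.
Proof.
apply: coord_unique; exists sq, (id_arrow q), (id_arrow q), k, (bct 1 s).
split; rewrite ?comp_idl //.
  by rewrite /coord_map (bc_lin_tens (cD _) (cZ _)) scale1r.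
rewrite bc_change_tens ?rmorph1 // => a.
by rewrite base_id.
Qed.

Section Germs.
Variables (X : cfg S) (f : fmor X Y) (T : pmod X).
Variable th :
  forall (u : site X) (v : site Y), arrow (f _ (sob u)) (sob v) -> F v -> T u.
Hypothesis thP : germ_pairing th.

Definition germ_lin (w : site X) (k : arrow (f _ (sob w)) q) : bc (base k) N -> T w :=
  bc_lin (base k) (@th w sq k).
Arguments germ_lin {w} k t.

Let tD w (k : arrow (f _ (sob w)) q) : {morph @th w sq k : s t / s + t}.
Proof. exact: (gpD thP). Qed.
Let tZ w (k : arrow (f _ (sob w)) q) a s : @th w sq k (a *: s) = base k a *: @th w sq k s.
Proof. exact: (gpZ thP). Qed.

Lemma germ_lin_tens w (k : arrow (f _ (sob w)) q) b s :
  germ_lin k (bct b s) = b *: @th w sq k s.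
Proof. exact: (bc_lin_tens (@tD w k) (@tZ w k)). Qed.
Lemma germ_linD w (k : arrow (f _ (sob w)) q) : {morph germ_lin k : s t / s + t}.
Proof. exact: (bc_linD (@tD w k) (@tZ w k)). Qed.
Lemma germ_linZ w (k : arrow (f _ (sob w)) q) b t :
  germ_lin k (b *: t) = b *: germ_lin k t.
Proof. exact: (bc_linZ (@tD w k) (@tZ w k)). Qed.

Lemma germ_lin_res (w w' : site X) (e : shom w w') (k : arrow (f _ (sob w)) q)
    (k' : arrow (f _ (sob w')) q) t : comp k' (fhom f e) = k ->
  germ_lin k (bc_change (base e) t) = mres e (germ_lin k' t).
Proof.
move=> ke; have e1 a : base e (base k' a) = base k a.
  by rewrite -ke base_comp fhom_base.
rewrite /germ_lin -(bc_lin_change (eta' := base k) (@tD w' k') (@tZ w' k') e1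
  (@mresD _ _ _ _ _ e) (@mresZ _ _ _ _ _ e)).
by congr bc_ext; apply: funext => n; rewrite (gp_res thP) ke.
Qed.

(** The coordinates [t0] express the restriction of [s] to [z] by sections of [F] over [q], and [th]
    respects such restrictions by [gp_comp]. This is what makes the two morphisms to
    [u |-> T (u x_X p)] agree on germs. *)
Lemma germ_lin_coord (w : site X) (v : site Y) (k : arrow (f _ (sob w)) q)
    (g : arrow (f _ (sob w)) (sob v)) (s : F v) :
  germ_lin k (coord k g s) = @th w v g s.
Proof.
have [z [al [be [h [t0 [ak bg e ->]]]]]] := coordP k g s.
rewrite -bg (gp_comp thP) -e; move: t0 {e}; apply: bc_eq_ext => [s0 t|s0 t|b n].
- rewrite bc_changeD ?germ_linD // => a; by rewrite -ak base_comp.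
- by rewrite /coord_map (bc_linD (cD _) (cZ _)) (gpD thP).
- rewrite bc_change_tens => [|a]; last by rewrite -ak base_comp.
  rewrite germ_lin_tens /coord_map (bc_lin_tens (cD _) (cZ _)) (gpZ thP).
  by rewrite -(gp_comp thP (v' := sq)) ak.
Qed.
End Germs.

End Coordinates.
Arguments germ_lin {S Y F V q} fq {X f T} th {w} k t.

(** * Pulling back the module of a presentation *)

Lemma bc_split_change (A B C D : comPzRingType) (phi : {rmorphism A -> B})
    (psi : {rmorphism B -> C}) (tot : {rmorphism A -> C})
    (psi' : {rmorphism B -> D}) (tot' : {rmorphism A -> D})
    (rho : {rmorphism C -> D}) (N : lmodType A) :
  (forall a, tot a = psi (phi a)) -> (forall a, tot' a = psi' (phi a)) ->
  (forall b, rho (psi b) = psi' b) ->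
  forall t : bc tot N, bc_split phi psi' (bc_change (eta' := tot') rho t)
    = bc_change rho (bc_split phi psi t).
Proof.
move=> e e' e''; have e3 a : rho (tot a) = tot' a by rewrite e e' e''.
apply: bc_eq_ext => [s t|s t|c n].
- by rewrite (bc_changeD e3) (bc_splitD e').
- by rewrite (bc_splitD e) (bc_changeD e'').
- by rewrite (bc_change_tens e3) !bc_split_tens // (bc_change_tens e'').
Qed.

Lemma bc_split_one (A B C : comPzRingType) (phi : {rmorphism A -> B})
    (psi : {rmorphism B -> C}) (tot : {rmorphism A -> C}) (N : lmodType A) :
  (forall a, tot a = psi (phi a)) ->
  forall t : bc phi N, bc_split phi psi (bc_change (eta' := tot) psi t) = bct 1 t.
Proof.
move=> e t; apply: (can_inj (@bc_mergeK _ _ _ _ _ _ e N)).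
by rewrite bc_splitK // bc_merge_tens // scale1r.
Qed.

Section BaseChangeOfFibre.
Variables (S : ring_functor) (X Y : cfg S) (f : fmor X Y).
Variables (U V : aff S) (p : ob X U) (q : ob Y V).
Variable gamma : arrow (f U p) q.
Variable N : lmodType V.

Definition to_q (W : aff S) (w : ob X W) (a : arrow w p) : arrow (f _ w) q :=
  comp gamma (fhom f a).

Lemma to_q_comp (W W' : aff S) (w : ob X W) (w' : ob X W') (e : arrow w w')
    (a : arrow w p) (a' : arrow w' p) :
  comp a' e = a -> comp (to_q a') (fhom f e) = to_q a.
Proof. by move=> <-; rewrite /to_q fhom_comp comp_assoc. Qed.

Lemma base_to_q_comp (W W' : aff S) (w : ob X W) (w' : ob X W') (e : arrow w w')
    (a : arrow w p) (a' : arrow w' p) : comp a' e = a ->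
  forall r, base e (base (to_q a') r) = base (to_q a) r.
Proof. by move=> /to_q_comp <- r; rewrite base_comp fhom_base. Qed.

Definition om_tensor : over_mod p.
Proof.
exists (fun w a => bc (base (to_q a)) N : lmodType (saff w))
  (fun w w' e a a' _ => bc_change (base e)).
- by move=> w w' e a a' h; apply/bc_changeD/base_to_q_comp.
- by move=> w w' e a a' h; apply/bc_changeZ/base_to_q_comp.
- move=> w a h; have e r := base_id (sob w) r.
  have e1 r : base (id_arrow (sob w)) (base (to_q a) r) = base (to_q a) r by rewrite e.
  apply: bc_eq_ext => [s t|//|b n]; first exact: (bc_changeD e1).
  by rewrite (bc_change_tens e1) e.
- move=> w w' w'' e e' a a' a'' h h' h'' s.
  apply: bc_change_comp; [exact: base_to_q_comp|exact: base_to_q_comp|].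
  exact: base_comp.
Defined.

(** As [O(v i) (x)_{O(V)} N] is [O(v i) (x)_{O(w)} (O(w) (x)_{O(V)} N)], this is flat descent for
    the module [O(w) (x)_{O(V)} N]. *)
Lemma om_tensor_sheaf : om_sheaf om_tensor.
Proof.
move=> w a n v b g gb [gf js] s sE.
have totE i r : base (to_q (b i)) r = base (g i) (base (to_q a) r).
  by rewrite (base_to_q_comp (gb i)).
pose m i := bc_split (base (to_q a)) (base (g i)) (s i : bc (base (to_q (b i))) N).
have splitI i : injective (@bc_split _ _ _ (base (to_q a)) (base (g i)) (base (to_q (b i))) N).
  exact: can_inj (@bc_splitK _ _ _ _ _ _ (totE i) N).
have splitE i (z : bc (base (to_q a)) N) :
    (bct 1 z = m i :> bc (base (g i)) _) <-> omres om_tensor (gb i) z = s i.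
  rewrite -(bc_split_one (totE i)) /m; split=> [/splitI //|h].
  by rewrite -h.
have ff : faithful_family (fun i => comor (base (g i))).
  by apply: cover_faithful => // i; have [] := gf i.
have [|z [zE zu]] := flat_descent ff (m := m); last first.
  exists z; split=> [i|z' z'E]; first by apply/splitE.
  by apply: zu => i; apply/splitE.
(* The spectrum of [O(v i) (x)_{O(w)} O(v j)] carries an object of the site; the compatibility of
   the [s i] there is the condition of [flat_descent]. *)
move=> i j; have [y [al [be [yP alE beE]]]] := pullback_exists (g i) (g j).
pose t : site X := Site (flat_fp_mor_comp
  (pushout_flat_fp (pullback_pushout yP) (gf i)) (sflat (v j))).
have hy : comp (b j) be = comp (b i) al.
  by rewrite -!gb -!comp_assoc (proj1 yP).
have := sE i j t (comp (b i) al) al be erefl hy (proj1 yP).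
rewrite /= (funext alE) (funext beE) => E.
have e0 r : base (to_q (comp (b i) al)) r = rt_inl (base (g i) (base (to_q a) r)).
  by rewrite -alE -totE (base_to_q_comp (erefl (comp (b i) al))).
pose psi := (rt_inl \o base (g i)
  : {rmorphism saff w -> rtens (base (g i)) (base (g j))}).
rewrite /m -(bc_split_change (psi' := psi) (totE i) e0) // E.
rewrite (bc_split_change (psi' := psi) (totE j) e0) //.
by move=> r; rewrite /= rt_glue.
Qed.

End BaseChangeOfFibre.

(** * Sections of the inverse image over a presentation *)

Section SectionsOverPresentation.
Variables (S : ring_functor) (X Y : cfg S) (f : fmor X Y).
Variable sh : sheafification X.
Variables (rho : pmap (inv f sh (structure_psh Y)) (structure_psh X)).
Hypothesis rhoP : is_inv_structure rho.
Variables (F : pmod Y) (hF : qcoh F).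
Variables (T : pmod X) (tau : forall u : site X, saff u -> inv f sh (psh_of F) u -> T u).
Hypothesis tauP : is_tensor rho tau.
Variables (U V : aff S) (p : ob X U) (q : ob Y V).
Variables (fp : flat_fp_mor p) (fq : flat_fp_mor q) (gamma : arrow (f U p) q).
Notation N := (F (Site fq)).
Notation sp := (Site fp).

Let th := germ_value tau.
Let thP : germ_pairing th := germ_value_pairing rhoP (tensor_pairing tauP).

Let T1 : pmod X := coind fp (om_tensor gamma N).
Let T2 : pmod X := coind fp (om_restrict p T).

Let th1 u (v : site Y) (g : arrow (f _ (sob u)) (sob v)) (s : F v) : T1 u :=
  coord hF fq (to_q gamma (over_p fp u)) (comp g (fhom f (over_r fp u))) s.

Let th1P : germ_pairing th1.
Proof.
split.
- by move=> u v g; apply: coordD.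
- move=> u v g r s; have := coordZ hF fq (to_q gamma (over_p fp u))
    (comp g (fhom f (over_r fp u))) r s.
  by rewrite base_comp fhom_base.
- move=> u u' v e g s; 
  have eg : comp (comp g (fhom f (over_r fp u'))) (fhom f (over_map fp e))
      = comp (comp g (fhom f e)) (fhom f (over_r fp u)).
    by rewrite -!comp_assoc -!fhom_comp over_map_r.
  have ek := to_q_comp gamma (over_map_p fp e).
  exact (esym (coord_arrow hF fq s (fhom_base f (over_map fp e)) ek eg)).
- by move=> u v v' j g s; rewrite /th1 -comp_assoc coord_comp.
Qed.

Let h_exists := tensor_germ_map rhoP tauP
  (coind_sheaf (om_tensor_sheaf (gamma := gamma) (N := N))) th1P.
Let h : pmod_hom T T1 := projT1 (cid h_exists).
Let hE u v g s : h u (@th u v g s) = th1 g s.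
Proof. exact (projT2 (cid h_exists) u v g s). Qed.

Let h1 : pmod_hom T T2.
Proof.
exists (fun u x => germ_lin fq th (to_q gamma (over_p fp u)) (h u x) : T2 u).
- by move=> u x y; rewrite mhomD (germ_linD thP).
- by move=> u r x; rewrite mhomZ restrZ (germ_linZ thP).
- move=> u v e x; rewrite mhom_nat.
  exact/(germ_lin_res thP)/to_q_comp/over_map_p.
Defined.

Let h2 : pmod_hom T T2.
Proof.
exists (fun u x => mres (over_r fp u) x : T2 u).
- by move=> u x y; exact (mresD (over_r fp u) x y).
- by move=> u r x; exact (mresZ (over_r fp u) r x).
- move=> u v e x; rewrite -[RHS]/(mres (over_map fp e) (mres (over_r fp v) x)).
  by rewrite -!mres_comp over_map_r.
Defined.

Let h12 : h1 = h2.
Proof.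
apply: (tensor_germ_ext tauP); first exact/coind_sheaf/om_restrict_sheaf/tensor_sheaf/tauP.
move=> u v g s; rewrite /= hE /th1 (germ_lin_coord hF fq thP).
by rewrite (gp_res thP).
Qed.

Definition sections_map : bc (base gamma) N -> T sp := germ_lin fq th (w := sp) gamma.

Lemma sections_map_bij : bijective sections_map.
Proof.
have [de [[dp dr] _]] := over_pair fp (u := sp) (id_arrow p) (id_arrow p).
have kd : comp (to_q gamma (over_p fp sp)) (fhom f de) = gamma.
  by rewrite /to_q -comp_assoc -fhom_comp dp fhom_id comp_idr.
have e a : base de (base (to_q gamma (over_p fp sp)) a) = base gamma a.
  by rewrite -[in RHS]kd base_comp fhom_base.
have e1 r : base de (base (over_r fp sp) r) = r by rewrite -base_comp dr base_id.
pose back (x : T sp) : bc (base gamma) N := bc_change (base de) (h sp x).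
exists back.
- have bD : {morph back : x y / x + y} by move=> x y; rewrite /back mhomD (bc_changeD e).
  apply: bc_eq_ext => [s t|//|b s]; first by rewrite /sections_map (germ_linD thP) bD.
  rewrite /sections_map (germ_lin_tens thP) /back mhomZ restrZ (bc_changeZ e) e1.
  have gd : comp (comp gamma (fhom f (over_r fp sp))) (fhom f de) = gamma.
    by rewrite -comp_assoc -fhom_comp dr fhom_id comp_idr.
  (* Pulled back along the diagonal [de], the coordinates of the germ of [s] along [gamma] are taken
     over [p] itself, where [coord_id] gives [1 (x) s]. *)
  have := coord_arrow hF fq (v := Site fq) s (fhom_base f de) kd gd.
  rewrite coord_id hE /th1 => <-.
  by rewrite bcZ mulr1.
- move=> x; rewrite /sections_map /back (germ_lin_res thP (w := sp) (w' := over fp sp) _ kd).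
  rewrite -[germ_lin _ _ _ _]/(h1 sp x) h12 /=.
  by rewrite -mres_comp dr mres_id.
Qed.

End SectionsOverPresentation.

(** * The comparison isomorphism *)

Lemma comodule_hom_inverse (B0 B1 : comPzRingType) (B : hopf_algebroid B0 B1)
    (M N : comodule B) (h : comodule_hom M N) : bijective h ->
  exists k : comodule_hom N M,
    comodule_comp k h = comodule_id M /\ comodule_comp h k = comodule_id N.
Proof.
move=> hb; have [g hK gK] := hb.
have gD : {morph g : m n / m + n}.
  by move=> m n; apply: (bij_inj hb); rewrite chomD !gK.
have gZ b n : g (b *: n) = b *: g n.
  by apply: (bij_inj hb); rewrite chomZ !gK.
have gC n : coact (g n) = bc_map (hetaR B) g (coact n).
  rewrite -{2}[n]gK chom_coact.
  rewrite -(bc_map_comp (@chomD _ _ _ _ _ h) (@chomZ _ _ _ _ _ h) gD gZ).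
  by rewrite (funext (g := @idfun M) hK) bc_map_id.
by exists (ComoduleHom gD gZ gC); split; apply: comodule_hom_ext => x /=.
Qed.

(** The comparison is constructed from [G] to [F], the direction in which tensors map out;
    naturality of its inverse follows formally. *)
Lemma natural_iso_of_inverse (C D : category) (F G : functor C D)
    (n : forall x, mor (G x) (F x)) :
  (forall x, exists k : mor (F x) (G x),
     mor_comp k (n x) = mor_id _ /\ mor_comp (n x) k = mor_id _) ->
  (forall x y (a : mor x y),
     mor_comp (n y) (fun_mor G a) = mor_comp (fun_mor F a) (n x)) ->
  inhabited (natural_iso F G).
Proof.
move=> inv nat; pose k x := projT1 (cid (inv x)).
have kn x : mor_comp (k x) (n x) = mor_id _ := proj1 (projT2 (cid (inv x))).
have nk x : mor_comp (n x) (k x) = mor_id _ := proj2 (projT2 (cid (inv x))).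
constructor; exists k n => // x y a.
rewrite -[fun_mor F a]mor_idr -(nk x) [mor_comp (fun_mor F a) _]mor_assoc -nat.
by rewrite -[mor_comp (mor_comp (n y) _) _]mor_assoc mor_assoc kn mor_idl.
Qed.

(** * Compatibility of the comparison with the coactions *)

Section SectionsComodule.
Variables (S : ring_functor) (X Y : cfg S) (f : fmor X Y).
Variables (U V : aff S) (p : ob X U) (q : ob Y V).
Variables (hp : presentation p) (hq : presentation q).
Variables (gamma : arrow (f U p) q).
Variables (U1 V1 : aff S) (B : hopf_algebroid U U1) (A : hopf_algebroid V V1).
Variables (hB : hopf_of_presentation p B) (hA : hopf_of_presentation q A).
Variable phi : hopf_hom A B.
Hypothesis phi0E : base gamma =1 hh0 phi.
Variable h1 : arrow (f U1 (hp_x1 hB)) (hp_x1 hA).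
Hypotheses (h1E : base h1 =1 hh1 phi)
  (h1L : comp (hp_pi1 hA) h1 = comp gamma (fhom f (hp_pi1 hB)))
  (h1R : comp (hp_pi2 hA) h1 = comp gamma (fhom f (hp_pi2 hB))).
Notation sp := (site_p hp).
Notation sq := (site_p hq).
Variables (F : pmod Y) (hF : qcoh F) (T : pmod X) (hT : qcoh T).
Variable th :
  forall (u : site X) (v : site Y), arrow (f _ (sob u)) (sob v) -> F v -> T u.
Hypothesis thP : germ_pairing th.

Definition comodule_map : bc (hh0 phi) (F sq) -> T sp :=
  bc_lin (hh0 phi) (@th sp sq gamma).

Let tD : {morph @th sp sq gamma : m n / m + n}.
Proof. exact: (gpD thP). Qed.
Let tZ a m : @th sp sq gamma (a *: m) = hh0 phi a *: @th sp sq gamma m.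
Proof. by rewrite (gpZ thP) phi0E. Qed.

Lemma comodule_map_tens b m : comodule_map (bct b m) = b *: @th sp sq gamma m.
Proof. exact: (bc_lin_tens tD tZ). Qed.
Lemma comodule_mapD : {morph comodule_map : s t / s + t}.
Proof. exact: (bc_linD tD tZ). Qed.
Lemma comodule_mapZ b t : comodule_map (b *: t) = b *: comodule_map t.
Proof. exact: (bc_linZ tD tZ). Qed.

Section Canonical.
Variables (X' : cfg S) (W W1 : aff S) (w : ob X' W) (C : hopf_algebroid W W1).
Variables (hw : presentation w) (hC : hopf_of_presentation w C) (G : pmod X').
Let cD : {morph @mres _ _ G (site_x1 hC) (site_p hw) (hp_pi2 hC) : m n / m + n}.
Proof. exact: mresD. Qed.
Let cZ b m : @mres _ _ G (site_x1 hC) (site_p hw) (hp_pi2 hC) (b *: m)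
  = hetaR C b *: @mres _ _ G (site_x1 hC) (site_p hw) (hp_pi2 hC) m.
Proof. by rewrite mresZ hp_etaR. Qed.
Lemma gamma_can_tens b m : gamma_can (hp := hw) hC (bct b m)
  = b *: @mres _ _ G (site_x1 hC) (site_p hw) (hp_pi2 hC) m.
Proof. exact: (bc_lin_tens cD cZ). Qed.
Lemma gamma_canD : {morph gamma_can (hp := hw) hC (F := G) : s t / s + t}.
Proof. exact: (bc_linD cD cZ). Qed.
Lemma gamma_canZ b t :
  gamma_can (hp := hw) hC (F := G) (b *: t) = b *: gamma_can (hp := hw) hC t.
Proof. exact: (bc_linZ cD cZ). Qed.
End Canonical.

(** [h1] lies over [hh1 phi] and, on second projections, covers [gamma], along which [comodule_map]
    is defined. So through [gamma_can] the map [phi1_id] becomes passage to germs along [h1]. *)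
Let gamma_can_phi1 (t : bc (hetaR A) (F sq)) :
  gamma_can (hp := hp) hB (bc_map (hetaR B) comodule_map (phi1_id phi t))
  = @th (site_x1 hB) (site_x1 hA) h1 (gamma_can (hp := hq) hA t).
Proof.
move: t; apply: bc_eq_ext => [s t|s t|a n].
- by rewrite phi1_idD (bc_mapD comodule_mapD comodule_mapZ) gamma_canD.
- by rewrite gamma_canD (gpD thP).
- rewrite phi1_id_tens (bc_map_tens _ comodule_mapD comodule_mapZ) gamma_can_tens.
  rewrite comodule_map_tens scale1r gamma_can_tens (gpZ thP) h1E; congr (_ *: _).
  by rewrite -(gp_comp thP (v' := sq)) h1R (gp_res thP (u' := sp)).
Qed.

(** After [gamma_can], both sides are multiples of germs of [m] over [X_1]: on the right along
    [hp_pi1 hA] composed with [h1], by [gamma_can_phi1], on the left along [gamma] composed with the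
    image of [hp_pi1 hB]. These arrows agree by [h1L]. *)
Lemma comodule_map_coact t :
  gamma_coact hB hT (comodule_map t)
  = bc_map (hetaR B) comodule_map (bc_coact (gamma_coact hA hF) t).
Proof.
apply: (bij_inj (gamma_can_bij hp hB hT)); rewrite gamma_can_invK.
have cD := @gamma_coactD _ _ _ _ _ _ hq hA F hF.
have cZ := @gamma_coactZ _ _ _ _ _ _ hq hA F hF.
have mD := bc_mapD (eta := hetaR B) comodule_mapD comodule_mapZ.
have mZ := bc_mapZ (eta := hetaR B) comodule_mapD comodule_mapZ.
move: t; apply: bc_eq_ext => [s t|s t|b m].
- by rewrite comodule_mapD mresD.
- by rewrite (bc_coactD cD cZ) mD gamma_canD.
- rewrite (bc_coact_tens phi cD cZ) mZ gamma_canZ gamma_can_phi1 gamma_can_invK.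
  rewrite comodule_map_tens mresZ hp_etaL; congr (_ *: _).
  by rewrite -(gp_comp thP (v' := sq)) h1L (gp_res thP (u' := sp)).
Qed.

Definition comodule_map_hom :
    comodule_hom (bc_comodule phi (gamma_comodule hq hA hF)) (gamma_comodule hp hB hT) :=
  @ComoduleHom _ _ B (bc_comodule phi (gamma_comodule hq hA hF))
    (gamma_comodule hp hB hT) comodule_map comodule_mapD comodule_mapZ
    comodule_map_coact.

End SectionsComodule.

Theorem corollary7p7
  (S : ring_functor) (hS : is_scheme S)
  (X Y : cfg S) (hX : is_geometric X) (hY : is_geometric Y) (f : fmor X Y)
  (U V : aff S) (p : ob X U) (q : ob Y V)
  (hp : presentation p) (hq : presentation q)
  (f0 : amor U V) (gamma : arrow (f U p) q) (hgamma : base gamma =1 f0)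
  (U1 V1 : aff S) (B : hopf_algebroid U U1) (A : hopf_algebroid V V1)
  (hB : hopf_of_presentation p B) (hA : hopf_of_presentation q A)
  (phi : hopf_hom A B) (hphi : hopf_hom_of_presentations hB hA f0 gamma phi)
  (sh : sheafification X) (fstar : inverse_image f sh) :
  inhabited (natural_iso
    (functor_comp (Gamma hp hB) fstar)
    (functor_comp (bc_functor phi) (Gamma hq hA))).
Proof.
have [hf0 [h1 [h1E h1L h1R]]] := hphi.
have phi0E : base gamma =1 hh0 phi by move=> r; rewrite hgamma hf0.
pose th (F : Qco Y) := germ_value (@ii_pairing _ _ _ _ _ fstar F).
have thP F : germ_pairing (th F) :=
  germ_value_pairing (ii_structureP fstar) (tensor_pairing (ii_tensor fstar F)).
pose n (F : Qco Y) : mor (functor_comp (bc_functor phi) (Gamma hq hA) F)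
    (functor_comp (Gamma hp hB) fstar F) :=
  comodule_map_hom hp hq phi0E h1E h1L h1R (svalP F) (svalP (fstar F)) (thP F).
apply: (natural_iso_of_inverse (n := n)) => [F|F G a].
  apply: comodule_hom_inverse => /=.
  have := sections_map_bij (ii_structureP fstar) (svalP F) (ii_tensor fstar F)
    (presentation_flat hp) (presentation_flat hq) gamma.
  (* [sections_map] uses the ring map of [gamma], the comodules use [hh0 phi]; bijectivity is
     transported along the equality of the two morphisms. *)
  have e : comor (base gamma) = hh0 phi by apply: rmorph_ext.
  by rewrite /sections_map /germ_lin /comodule_map; case: _ / e.
apply: comodule_hom_ext; apply: bc_eq_ext => [s t|s t|b m].
- by rewrite !chomD.
- by rewrite !chomD.
- have aD := @mhomD _ _ _ _ (a : pmod_hom _ _) (site_p hq).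
  have aZ := @mhomZ _ _ _ _ (a : pmod_hom _ _) (site_p hq).
  rewrite /= (bc_map_tens _ aD aZ) !(comodule_map_tens hp phi0E (thP _)).
  by rewrite mhomZ /th /germ_value ii_mor inv_map_germ.
Qed.
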